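(* ($(n+\mathcal S)$-th product identity) For any $\hat{\mathcal S}$-logarithmic vertex algebra $(V,\boldsymbol1,T,Y,\hat{\mathcal S})$ and $a,b\in V$, we have $$Y(a,z)_{(n+\hat{\mathcal S})}Y(b,z)=Y(a_{(n+\mathcal S)}b,z),\qquad n\in\mathbb Z.$$ In particular, $Y(Ta,z)=D_zY(a,z)$.
   Context: Conventions. All superspaces, tensor products and Hom's are over $\mathbb C$; $p(v)$ is the parity; formulas with $p$ are for homogeneous elements, extended linearly. $(\phi\otimes\psi)(a\otimes b)=(-1)^{p(\psi)p(a)}\phi(a)\otimes\psi(b)$; $[\cdot,\cdot]$ is the supercommutator, $\mathrm{ad}(a)b=[a,b]$; $P(a\otimes b)=(-1)^{p(a)p(b)}b\otimes a$; $I$ is the identity operator. $z,z_1,z_2,\dots$ and $\zeta,\zeta_1,\zeta_2,\dots$ are commuting even formal variables ($\zeta_i$ plays the role of $\log z_i$; setting $z_1=z$ also sets $\zeta_1=\zeta$). $D_z=\partial_z+z^{-1}\partial_\zeta$, $z_{12}=z_1-z_2$, $x^{(k)}=x^k/k!$ for $k\ge0$ and $x^{(k)}=0$ for $k<0$. $\vartheta_{12}=\zeta_1-\sum_{n\ge1}\frac1n z_1^{-n}z_2^n$, $\vartheta_{21}=\zeta_2-\sum_{n\ge1}\frac1n z_1^{n}z_2^{-n}$. Logarithmic fields. $\mathrm{LF}(V)=\mathrm{Hom}(V,V(\!(z)\!)[\zeta])$, with its natural superspace structure; elements are written $a(z)=a(z,\zeta)$. Braiding map. A braiding map on a superspace $U$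 is an even element $\mathcal S\in\mathrm{End}(U)\otimes\mathrm{End}(U)$ with $\mathcal SP=P\mathcal S$ and $[\mathcal S_{12},\mathcal S_{23}]=[\mathcal S_{13},\mathcal S_{23}]=[\mathcal S_{12},\mathcal S_{13}]=0$ on $U^{\otimes3}$, where $\mathcal S_{12}=\mathcal S\otimes I$, $\mathcal S_{23}=I\otimes\mathcal S$, $\mathcal S_{13}=(I\otimes P)\mathcal S_{12}(I\otimes P)$. Throughout, $\hat{\mathcal S}$ is a braiding map on $\mathrm{LF}(V)$, $\hat{\mathcal S}=\sum_{i}\Phi_i\otimes\Psi_i$ (finite sum) with the $\Phi_i$ linearly independent, the $\Psi_i$ linearly independent, $p(\Phi_i)=p(\Psi_i)$; it acts on $a(z_1)\otimes b(z_2)$ by $\sum_i(-1)^{p(\Psi_i)p(a)}(\Phi_ia)(z_1)\otimes(\Psi_ib)(z_2)$. Locality. Let $\mu(a(z_1)\otimes b(z_2))=a(z_1)b(z_2)$. A subspace $\mathcal V\subset\mathrm{LF}(V)$ is $\hat{\mathcal S}$-local if: (i) $\Phi_i\mathcal V\subset\mathcal V$ and $\Psi_i\mathcal V\subset\mathcal V$ for all $i$; (ii) for all $a,b\in\mathcal V$ there is $r\ge1$ with $\hat{\mathcal S}^r(a\otimes b)=0$; (iii) for all $a,b\in\mathcal V$ there is an integer $N\ge0$ with $\mu(z_{12}^Ne^{\vartheta_{12}\hat{\mathcal S}}a(z_1)\otimes b(z_2))=(-1)^{p(a)p(b)}\mu(z_{12}^Ne^{\vartheta_{21}\hat{\mathcal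 S}}b(z_2)\otimes a(z_1))$. Products. For $a,b$ in an $\hat{\mathcal S}$-local $\mathcal V$ and $n\in\mathbb Z$, the $(n+\hat{\mathcal S})$-th product $a_{(n+\hat{\mathcal S})}b=\hat\mu_{(n)}(a\otimes b)\in\mathrm{LF}(V)$ is $$\bigl(a(z)_{(n+\hat{\mathcal S})}b(z)\bigr)v=D_{z_1}^{(N-1-n)}\mu\bigl(z_{12}^Ne^{\vartheta_{12}\hat{\mathcal S}}a(z_1)\otimes b(z_2)\bigr)v\Big|_{z_1=z_2=z,\ \zeta_1=\zeta_2=\zeta}$$ with $N$ as in (iii) (independent of $N$). $\hat{\mathcal S}$-logarithmic vertex algebra $(V,\boldsymbol1,T,Y,\hat{\mathcal S})$: a superspace $V$, an even vector $\boldsymbol1$, an even $T\in\mathrm{End}(V)$, an even linear map $Y_z:V\to\mathrm{LF}(V)$, $a\mapsto Y(a,z)$, and a braiding map $\hat{\mathcal S}$ on $Y_z(V)$ such that: (vacuum) $Y(\boldsymbol1,z)=I$, $Y(a,z)\boldsymbol1\in V[\![z]\!]$, $Y(a,z)\boldsymbol1|_{z=0}=a$, $T\boldsymbol1=0$; (covariance) $[\mathrm{ad}(T)\otimes I,\hat{\mathcal S}]=[D_z\otimes I,\hat{\mathcal S}]=0$, $[T,Y(a,z)]=D_zY(a,z)$; (locality) $Y_z(V)$ is $\hat{\mathcal S}$-local; (hexagon) for all $n\in\mathbb Z$, $\hat{\mathcal S}(\hat\mu_{(n)}\otimes I)=(\hat\mu_{(n)}\otimes I)(\hat{\mathcal S}_{13}+\hat{\mathcal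 S}_{23})$ on $Y_z(V)^{\otimes3}$. Modes. The linear operators $a_{(n+\mathcal S)}\in\mathrm{End}(V)$ are defined (here ''$\mathcal S$'' is only part of the notation) by $Y(a,z)|_{\zeta=0}=\sum_{n\in\mathbb Z}a_{(n+\mathcal S)}z^{-n-1}$. *)

(* Defs.v *)
From HB Require Import structures.
From mathcomp Require Import all_boot all_order all_algebra.
From mathcomp Require Import all_classical reals.
From mathcomp Require Export complex.

Set Implicit Arguments.
Unset Strict Implicit.
Unset Printing Implicit Defensive.

Import Order.TTheory GRing.Theory Num.Theory.
Local Open Scope classical_set_scope.
Local Open Scope ring_scope.

(* A superspace V = V_0 (+) V_1 is given by the projections [hcomp p] onto its
   even (p = false) and odd (p = true) parts. *)
HB.mixin Record Lmodule_isSuper (K : nzRingType) V of GRing.Lmodule K V := {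
  hcomp : bool -> V -> V;
  hcomp_is_linear : forall p, linear (hcomp p);
  hcompE : forall p q v, hcomp p (hcomp q v) = if p == q then hcomp q v else 0;
  hcomp_sum : forall v, hcomp false v + hcomp true v = v
}.

#[short(type="superspaceType")]
HB.structure Definition Superspace (K : nzRingType) :=
  {V of GRing.Lmodule K V & Lmodule_isSuper K V}.

HB.instance Definition _ (K : nzRingType) (V : superspaceType K) p :=
  GRing.isLinear.Build K V V *:%R (@hcomp K V p) (@hcomp_is_linear K V p).

Section Super.
Context {K : nzRingType} {V : superspaceType K}.

Definition homog (p : bool) (v : V) := hcomp p v = v.

Definition homog_map (p : bool) (W : superspaceType K) (f : V -> W) :=
  forall q v, homog q v -> hcomp (q (+) p) (f v) = f v.

(* v |-> (-1)^{q p(v)} v *)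
Definition ptwist (q : bool) (v : V) : V :=
  hcomp false v + (-1) ^+ q *: hcomp true v.

End Super.

(* Elements of a tensor product are represented by finite formal sums of pure
   tensors, i.e. sequences of pairs or triples. [tens_eq] and [tens3_eq] are
   equality in U (x) W and in U (x) W (x) X: the congruences on formal sums
   generated by multilinearity. *)
Inductive fsum_eq (A : Type) (G : seq A -> seq A -> Prop) :
    seq A -> seq A -> Prop :=
| fsum_gen s t : G s t -> fsum_eq G s t
| fsum_refl s : fsum_eq G s s
| fsum_sym s t : fsum_eq G s t -> fsum_eq G t s
| fsum_trans s t u : fsum_eq G s t -> fsum_eq G t u -> fsum_eq G s u
| fsum_cat s s' t t' :
    fsum_eq G s s' -> fsum_eq G t t' -> fsum_eq G (s ++ t) (s' ++ t')
| fsum_catC s t : fsum_eq G (s ++ t) (t ++ s).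

Inductive tens_rel (K : nzRingType) (U W : lmodType K) :
    seq (U * W) -> seq (U * W) -> Prop :=
| tens_zero w : tens_rel [:: (0, w)] [::]
| tens_addl u u' w : tens_rel [:: (u + u', w)] [:: (u, w); (u', w)]
| tens_addr u w w' : tens_rel [:: (u, w + w')] [:: (u, w); (u, w')]
| tens_scale c u w : tens_rel [:: (c *: u, w)] [:: (u, c *: w)].

Inductive tens3_rel (K : nzRingType) (U W X : lmodType K) :
    seq (U * W * X) -> seq (U * W * X) -> Prop :=
| tens3_l s t x : tens_rel s t ->
    tens3_rel [seq (y, x) | y <- s] [seq (y, x) | y <- t]
| tens3_r u s t : tens_rel s t ->
    tens3_rel [seq (u, y.1, y.2) | y <- s] [seq (u, y.1, y.2) | y <- t].

Definition tens_eq (K : nzRingType) (U W : lmodType K) :=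
  fsum_eq (@tens_rel K U W).
Definition tens3_eq (K : nzRingType) (U W X : lmodType K) :=
  fsum_eq (@tens3_rel K U W X).

(* Additive extension to formal sums of a map defined on pure tensors. *)
Definition fsum_ext (A B : Type) (f : A -> seq B) (s : seq A) : seq B :=
  flatten (map f s).

(* S = \sum_i Phi_i (x) Psi_i in End(U) (x) End(U), even. *)
Record even_tensor_end (K : nzRingType) (U : superspaceType K) := EvenTensorEnd {
  te_size : nat;
  te_l : 'I_te_size -> {linear U -> U};
  te_r : 'I_te_size -> {linear U -> U};
  te_par : 'I_te_size -> bool;
  te_lhom : forall i, homog_map (te_par i) (te_l i);
  te_rhom : forall i, homog_map (te_par i) (te_r i);
  te_lfree : forall c : 'I_te_size -> K,
    (forall u, \sum_i c i *: te_l i u = 0) -> forall i, c i = 0;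
  te_rfree : forall c : 'I_te_size -> K,
    (forall u, \sum_i c i *: te_r i u = 0) -> forall i, c i = 0
}.

Section Braiding.
Context {K : nzRingType} {U : superspaceType K}.

Definition flip_op (x : U * U) : seq (U * U) :=
  [seq (hcomp q x.2, ptwist q x.1) | q <- [:: false; true]].

Definition te_op (S : even_tensor_end U) (x : U * U) : seq (U * U) :=
  [seq (te_l i (ptwist (te_par i) x.1), te_r i x.2)
     | i <- enum 'I_(te_size S)].

(* Action of an even operator f of U (x) U on factors 1,2 and 2,3. *)
Definition op12 (f : U * U -> seq (U * U)) (x : U * U * U) : seq (U * U * U) :=
  [seq (y, x.2) | y <- f x.1].
Definition op23 (f : U * U -> seq (U * U)) (x : U * U * U) : seq (U * U * U) :=
  [seq (x.1.1, y.1, y.2) | y <- f (x.1.2, x.2)].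
Definition op13 (f : U * U -> seq (U * U)) (x : U * U * U) : seq (U * U * U) :=
  fsum_ext (op23 flip_op) (fsum_ext (op12 f) (op23 flip_op x)).

Definition commute3 (A : set U) (f g : U * U * U -> seq (U * U * U)) :=
  forall a b c, A a -> A b -> A c ->
    tens3_eq (fsum_ext f (g (a, b, c))) (fsum_ext g (f (a, b, c))).

Definition te_stable (A : set U) (S : even_tensor_end U) :=
  forall i a, A a -> A (te_l i a) /\ A (te_r (e:=S) i a).

(* S restricts to a braiding map on the graded subspace A of U. *)
Definition braiding_on (A : set U) (S : even_tensor_end U) :=
  [/\ te_stable A S,
      forall a b, A a -> A b ->
        tens_eq (fsum_ext (te_op S) (flip_op (a, b)))
                (fsum_ext flip_op (te_op S (a, b))),
      commute3 A (op12 (te_op S)) (op23 (te_op S)),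
      commute3 A (op13 (te_op S)) (op23 (te_op S)) &
      commute3 A (op12 (te_op S)) (op13 (te_op S))].

End Braiding.

(* g \in V((z))[zeta], the coefficient of z^m zeta^j in g being g m j. *)
Definition log_laurent (V : zmodType) (g : int -> nat -> V) :=
  exists (M : int) (J : nat), forall m j, m < M \/ (J <= j)%N -> g m j = 0.

Section LogFields.
Context {K : fieldType}.
Implicit Type V : lmodType K.

Definition is_LF V (a : V -> int -> nat -> V) :=
  linear a /\ forall v, log_laurent (a v).

Definition LF_pred V : {pred V -> int -> nat -> V} := fun a => `[< is_LF a >].

(* LF(V) = Hom(V, V((z))[zeta]); the coefficient of z^m zeta^j in a(z)v is
   a v m j. *)
Record LF V := MkLF {
  LF_val :> V -> int -> nat -> V;
  _ : LF_val \in @LF_pred V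
}.

Lemma log_laurent0 V : log_laurent (fun _ _ => 0 : V).
Proof. by exists 0, 0%N. Qed.

Lemma log_laurentD V (g h : int -> nat -> V) :
  log_laurent g -> log_laurent h -> log_laurent (fun m j => g m j + h m j).
Proof.
move=> [M [J gP]] [M' [J' hP]]; exists (Order.min M M'), (maxn J J') => m j.
rewrite lt_min geq_max => mj.
by rewrite gP ?hP ?addr0//; case: mj => /andP[]; [left|right|left|right].
Qed.

Lemma log_laurent_map V (f : V -> V) (g : int -> nat -> V) :
  f 0 = 0 -> log_laurent g -> log_laurent (fun m j => f (g m j)).
Proof. by move=> f0 [M [J gP]]; exists M, J => m j /gP ->. Qed.

Lemma is_LF_submod V : submod_closed (@LF_pred V).
Proof.
split=> [|c a b /asboolP[la pa] /asboolP[lb pb]]; apply/asboolP; split.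
- by move=> k u v; apply/funext => m; apply/funext => j; rewrite scaler0 addr0.
- by move=> v; apply: log_laurent0.
- move=> k u v; apply/funext => m; apply/funext => j.
  rewrite /= !fctE la lb !fctE !scalerDr !scalerA (mulrC k) !addrA.
  by congr (_ + _); rewrite addrAC.
- move=> v; apply: (@log_laurentD V (fun m j => c *: a v m j)) => //.
  by apply: log_laurent_map (pa v); rewrite scaler0.
Qed.

HB.instance Definition _ V := [isSub for @LF_val V].
HB.instance Definition _ V := [Choice of LF V by <:].
HB.instance Definition _ V :=
  GRing.isSubmodClosed.Build K (V -> int -> nat -> V) (@LF_pred V)
    (@is_LF_submod V).
HB.instance Definition _ V := [SubChoice_isSubLmodule of LF V by <:].

Definition LF_of V (a : V -> int -> nat -> V) (aLF : is_LF a) : LF V :=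
  MkLF (asboolT aLF).

Lemma LFP V (a : LF V) : is_LF a.
Proof. exact: asboolW (valP a). Qed.

Lemma LF_linearE V (a : LF V) k u v m j :
  a (k *: u + v) m j = k *: a u m j + a v m j.
Proof. by rewrite (LFP a).1. Qed.

Lemma LF_valE V (a b : LF V) k v m j :
  (k *: a + b) v m j = k *: a v m j + b v m j.
Proof. by []. Qed.

Lemma LFext V (a b : LF V) : (forall v m j, a v m j = b v m j) -> a = b.
Proof.
move=> ab; apply: val_inj; apply/funext => v.
by apply/funext => m; apply/funext => j; apply: ab.
Qed.

End LogFields.

(* The identity field I. *)
Section LFone.
Context {K : fieldType} (V : lmodType K).

Definition LFone_coef (v : V) (m : int) (j : nat) : V :=
  if (m == 0) && (j == 0%N) then v else 0.

Lemma LFone_subproof : is_LF LFone_coef.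
Proof.
split=> [k u v|v].
  apply/funext => m; apply/funext => j; rewrite /LFone_coef !fctE.
  by case: ifP => // _; rewrite scaler0 addr0.
exists 0, 1%N => m j; rewrite /LFone_coef => -[/lt_eqF -> //|].
by case: j => // j; rewrite andbF.
Qed.

Definition LFone : LF V := LF_of LFone_subproof.

End LFone.

Section LFoperators.
Context {K : fieldType} {V : lmodType K}.

Definition Dz_coef (a : LF V) (v : V) (m : int) (j : nat) : V :=
  (m + 1)%:~R *: a v (m + 1) j + j.+1%:R *: a v (m + 1) j.+1.

Lemma Dz_subproof a : is_LF (Dz_coef a).
Proof.
split=> [k u v|v].
  apply/funext => m; apply/funext => j; rewrite /Dz_coef !fctE !LF_linearE.
  rewrite !scalerDr !scalerA ![k * _]mulrC !addrA.
  by congr (_ + _); rewrite addrAC.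
have [M [J aP]] := (LFP a).2 v; exists (M - 1), J => m j mj.
rewrite /Dz_coef !aP ?scaler0 ?addr0//.
  by case: mj => [?|/leqW]; [left; rewrite -ltrBrDr|right].
by case: mj => [?|]; [left; rewrite -ltrBrDr|right].
Qed.

(* D_z = d/dz + z^-1 d/dzeta *)
Definition Dz (a : LF V) : LF V := LF_of (Dz_subproof a).

Definition LF_ad_coef (T : {linear V -> V}) (a : LF V) v m j : V :=
  T (a v m j) - a (T v) m j.

Lemma LF_ad_subproof T a : is_LF (LF_ad_coef T a).
Proof.
split=> [k u v|v].
  apply/funext => m; apply/funext => j.
  rewrite /LF_ad_coef !fctE linearP !LF_linearE linearP scalerBr opprD !addrA.
  by congr (_ + _); rewrite addrAC.
apply: log_laurentD; first exact/log_laurent_map/(LFP a).2/linear0.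
by apply: log_laurent_map; [rewrite oppr0|exact: (LFP a).2].
Qed.

(* ad(T) for an even T in End(V) *)
Definition LF_ad (T : {linear V -> V}) (a : LF V) : LF V :=
  LF_of (LF_ad_subproof T a).

End LFoperators.

Section LFsuper.
Context {K : fieldType} {V : superspaceType K}.

Definition LF_comp_coef (p : bool) (a : LF V) v m j : V :=
  hcomp p (a (hcomp false v) m j) + hcomp (~~ p) (a (hcomp true v) m j).

Lemma LF_comp_subproof p a : is_LF (LF_comp_coef p a).
Proof.
split=> [k u v|v].
  apply/funext => m; apply/funext => j; rewrite /LF_comp_coef !fctE.
  rewrite !linearP !LF_linearE !linearP /= scalerDr !addrA.
  by congr (_ + _); rewrite addrAC.
by apply: log_laurentD; apply: log_laurent_map; rewrite ?linear0//;
  apply: (LFP a).2.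
Qed.

Definition LF_comp p (a : LF V) : LF V := LF_of (LF_comp_subproof p a).

Lemma LF_comp_linear p : linear (LF_comp p).
Proof.
move=> k a b; apply: LFext => v m j; rewrite LF_valE /= /LF_comp_coef.
rewrite !LF_valE !(hcomp_is_linear _ k) scalerDr !addrA.
by congr (_ + _); rewrite addrAC.
Qed.

Lemma LF_compE p q a :
  LF_comp p (LF_comp q a) = if p == q then LF_comp q a else 0.
Proof.
have h0 r : hcomp r (0 : V) = 0 by apply: linear0.
have a0 m j : a 0 m j = 0.
  by have := LF_linearE a (-1) 0 0 m j; rewrite scaler0 addr0 scaleN1r addNr.
apply: LFext => v m j; rewrite /= /LF_comp_coef /= /LF_comp_coef !hcompE /= !a0.
rewrite !h0 addr0 add0r !hcompE.
by case: p; case: q => //=; rewrite addr0.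
Qed.

Lemma LF_comp_sum a : LF_comp false a + LF_comp true a = a.
Proof.
rewrite -[LF_comp false a]scale1r.
apply: LFext => v m j; rewrite LF_valE scale1r /= /LF_comp_coef /=.
rewrite addrACA hcomp_sum [X in _ + X]addrC hcomp_sum.
by have := LF_linearE a 1 (hcomp false v) (hcomp true v) m j;
  rewrite !scale1r hcomp_sum => ->.
Qed.

HB.instance Definition _ :=
  Lmodule_isSuper.Build K (LF V) LF_comp_linear LF_compE LF_comp_sum.

End LFsuper.

(* Formal series in z_1, zeta_1, z_2, zeta_2: the coefficient of
   z_1^m1 zeta_1^j1 z_2^m2 zeta_2^j2 in F is F m1 j1 m2 j2. *)
Definition series2 (V : Type) := int -> nat -> int -> nat -> V.

Section Series2.
Context {K : fieldType} {V : lmodType K}.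
Implicit Type F : series2 V.

(* Exchange of (z_1, zeta_1) and (z_2, zeta_2). *)
Definition swap12 F : series2 V := fun m1 j1 m2 j2 => F m2 j2 m1 j1.

(* Multiplication by z_12 = z_1 - z_2. *)
Definition z12_mul F : series2 V :=
  fun m1 j1 m2 j2 => F (m1 - 1) j1 m2 j2 - F m1 j1 (m2 - 1) j2.

(* Multiplication by
     vartheta_12 = zeta_1 - \sum_(n >= 1) n^-1 z_1^-n z_2^n,
   for F whose exponents of z_2 are bounded below. Multiplication by
   vartheta_21 is its conjugate by [swap12]. *)
Definition theta12_mul F : series2 V := fun m1 j1 m2 j2 =>
  (if j1 is j.+1 then F m1 j m2 j2 else 0)
  - \sum_(n \in [set n | (0 < n)%N]) n%:R^-1 *: F (m1 + n%:Z) j1 (m2 - n%:Z) j2.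

(* D_(z_1) = d/dz_1 + z_1^-1 d/dzeta_1 *)
Definition Dz1 F : series2 V := fun m1 j1 m2 j2 =>
  (m1 + 1)%:~R *: F (m1 + 1) j1 m2 j2 + j1.+1%:R *: F (m1 + 1) j1.+1 m2 j2.

(* F at z_1 = z_2 = z, zeta_1 = zeta_2 = zeta. *)
Definition diag12 F : int -> nat -> V := fun m j =>
  \sum_(i \in [set: int]) \sum_(k < j.+1) F i k (m - i) (j - k)%N.

End Series2.

Section Locality.
Context {K : fieldType} {V : superspaceType K}.
Variable S : even_tensor_end (LF V).
Implicit Types (a b : LF V) (s : seq (LF V * LF V)).

(* mu(s)v = \sum_(a (x) b in s) a(z_1)b(z_2)v *)
Definition mu12 s (v : V) : series2 V := fun m1 j1 m2 j2 =>
  \sum_(x <- s) x.1 (x.2 v m2 j2) m1 j1.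

Definition te_iter (k : nat) s := iter k (fsum_ext (te_op S)) s.

(* mu(e^(vartheta_12 S) s)v; the sum over k is finite when S^r s = 0 for
   some r. *)
Definition exp_mu12 s (v : V) : series2 V := fun m1 j1 m2 j2 =>
  \sum_(k \in [set: nat])
    k`!%:R^-1 *: iter k theta12_mul (mu12 (te_iter k s) v) m1 j1 m2 j2.

Definition local_order a b (N : nat) := forall v,
  iter N z12_mul (exp_mu12 [:: (a, b)] v)
  = iter N z12_mul (swap12 (exp_mu12 (flip_op (a, b)) v)).

Definition is_local (A : set (LF V)) :=
  [/\ te_stable A S,
      forall a b, A a -> A b ->
        exists2 r, (0 < r)%N & tens_eq (te_iter r [:: (a, b)]) [::] &
      forall a b, A a -> A b -> exists N, local_order a b N].

(* The exponent N - 1 - n of the divided power may be negative, in which case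
   the product is 0. *)
Definition nprod_coef (N : nat) (n : int) a b (v : V) : int -> nat -> V :=
  if N%:Z - 1 - n is Posz k then
    diag12 (fun m1 j1 m2 j2 =>
      k`!%:R^-1 *:
        iter k Dz1 (iter N z12_mul (exp_mu12 [:: (a, b)] v)) m1 j1 m2 j2)
  else fun _ _ => 0.

(* a_(n + S) b, computed with some N as in the locality condition. The default
   value 0 of [insubd] is not used for such N, by [nprod_coef_LF]. *)
Definition nprod (n : int) a b : LF V :=
  insubd 0 (nprod_coef (xget 0%N (local_order a b)) n a b).

(* mu_(n) (x) I on pure tensors *)
Definition nprod12 (n : int) (x : LF V * LF V * LF V) : seq (LF V * LF V) :=
  [:: (nprod n x.1.1 x.1.2, x.2)].

Definition hexagon (A : set (LF V)) := forall n a b c, A a -> A b -> A c ->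
  tens_eq (fsum_ext (te_op S) (nprod12 n (a, b, c)))
          (fsum_ext (nprod12 n)
             (op13 (te_op S) (a, b, c) ++ op23 (te_op S) (a, b, c))).

(* [f (x) I, S] = 0 on A (x) A, for an even operator f on LF(V). *)
Definition commute_l (A : set (LF V)) (f : LF V -> LF V) :=
  forall a b, A a -> A b ->
    tens_eq [seq (f x.1, x.2) | x <- te_op S (a, b)] (te_op S (f a, b)).

End Locality.

(* The coefficients of the n-th product of a local pair form an element of
   LF(V). *)
Section FsumLinear.
Context {K : fieldType} {V : lmodType K}.

Lemma fsum_linear (I : choiceType) (P B : set I) (f g : I -> V) (k : K) :
  finite_set B -> (forall i, P i -> ~ B i -> f i = 0 /\ g i = 0) ->
  \sum_(i \in P) (k *: f i + g i)
  = k *: (\sum_(i \in P) f i) + \sum_(i \in P) g i.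
Proof.
move=> finB fg0.
have PBP : P `&` B `<=` P by move=> i [].
have finPB : finite_set (P `&` B) by apply: sub_finite_set finB => i [].
have fg i : (P `\` (P `&` B)) i -> f i = 0 /\ g i = 0.
  by move=> [Pi nPB]; apply: fg0 => // Bi; apply: nPB.
rewrite -!(fsbig_widen _ _ _ PBP).
- by rewrite !fsbig_finite//= big_split/= scaler_sumr.
- by move=> i /fg[].
- by move=> i /fg[].
- by move=> i /fg[] /= -> ->; rewrite scaler0 addr0.
Qed.

Lemma finite_int_itv (M : int) (N : nat) :
  finite_set [set i : int | M <= i /\ i <= M + N%:Z].
Proof.
apply: sub_finite_set (finite_image (fun n : nat => M + n%:Z) (finite_II N.+1)).
move=> i [Mi iM]; exists (`|i - M|%N).
  by rewrite /= ltnS -lez_nat gez0_abs ?subr_ge0// lerBlDl.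
by rewrite /= gez0_abs ?subr_ge0// subrKC.
Qed.

End FsumLinear.

Section TensorCongruence.
Context {K : nzRingType}.

Lemma fsum_ext_cat (A B : Type) (f : A -> seq B) s t :
  fsum_ext f (s ++ t) = fsum_ext f s ++ fsum_ext f t.
Proof. by rewrite /fsum_ext map_cat flatten_cat. Qed.

Lemma fsum_ext_eq (A B : Type) (G : seq A -> seq A -> Prop)
    (H : seq B -> seq B -> Prop) (f : A -> seq B) :
  (forall s t, G s t -> fsum_eq H (fsum_ext f s) (fsum_ext f t)) ->
  forall s t, fsum_eq G s t -> fsum_eq H (fsum_ext f s) (fsum_ext f t).
Proof.
move=> GH s t; elim=> {s t} [s t /GH//|s|s t _|s t u _ h _|s s' t t' _ h _ h'|s t].
- exact: fsum_refl.
- exact: fsum_sym.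
- exact: fsum_trans.
- by rewrite !fsum_ext_cat; apply: fsum_cat.
- by rewrite !fsum_ext_cat; apply: fsum_catC.
Qed.

Lemma fsum_eq_map2 (A B : Type) (G : seq B -> seq B -> Prop)
    (f g h : A -> B) (r : seq A) :
  (forall x, G [:: f x] [:: g x; h x]) ->
  fsum_eq G (map f r) (map g r ++ map h r).
Proof.
move=> fgh; elim: r => [|x r IHr] /=; first exact: fsum_refl.
apply: fsum_trans (_ : fsum_eq G ([:: g x; h x] ++ (map g r ++ map h r)) _).
  by apply: (fsum_cat (s := [:: _]) _ IHr); apply: fsum_gen.
apply: (@fsum_cat _ G [:: g x] [:: g x] (h x :: (map g r ++ map h r))
  (map g r ++ h x :: map h r)); first exact: fsum_refl.
rewrite -cat_cons -[h x :: map h r]cat1s catA.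
apply: fsum_cat (fsum_refl _ _); exact: (@fsum_catC _ G [:: h x]).
Qed.

Lemma te_op_eq (U : superspaceType K) (S : even_tensor_end U) s t :
  tens_eq s t -> tens_eq (fsum_ext (te_op S) s) (fsum_ext (te_op S) t).
Proof.
have tw0 q : ptwist q (0 : U) = 0 by rewrite /ptwist !linear0 scaler0 addr0.
have twD q (u v : U) : ptwist q (u + v) = ptwist q u + ptwist q v.
  by rewrite /ptwist !linearD /= scalerDr addrACA.
have twZ q c (u : U) : ptwist q (c *: u) = c *: ptwist q u.
  rewrite /ptwist !linearZ /= scalerDr !scalerA; congr (_ + _ *: _).
  by case: q; rewrite ?expr0 ?expr1 ?mul1r ?mulr1// mulrN1 mulN1r.
apply: fsum_ext_eq => {}s {}t [w|u u' w|u w w'|c u w];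
  rewrite /fsum_ext /= ?cats0 /te_op /=.
- elim: (enum _) => [|i r IHr] /=; first exact: fsum_refl.
  rewrite tw0 (linear0 (te_l _)); apply: (fsum_cat (s := [:: _]) (s' := [::]) _ IHr).
  by apply: fsum_gen; apply: tens_zero.
- apply: fsum_eq_map2 => i; rewrite twD (linearD (te_l _)); apply: tens_addl.
- apply: fsum_eq_map2 => i; rewrite (linearD (te_r _)); apply: tens_addr.
- elim: (enum _) => [|i r IHr] /=; first exact: fsum_refl.
  apply: (fsum_cat (s := [:: _]) (s' := [:: _]) _ IHr).
  by rewrite twZ [te_l _ (_ *: _)]linearZ [te_r _ (_ *: _)]linearZ; apply: fsum_gen; apply: tens_scale.
Qed.

End TensorCongruence.

Section ProductInLF.
Context {K : fieldType} {V : superspaceType K}.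
Variable S : even_tensor_end (LF V).
Implicit Types (F G : series2 V) (s : seq (LF V * LF V)).

Let bnd2 F := exists (M : int) (J : nat), forall m1 j1 m2 j2,
  m2 < M \/ (J <= j2)%N -> F m1 j1 m2 j2 = 0.

Let lin (F : V -> series2 V) := forall k u v m1 j1 m2 j2,
  F (k *: u + v) m1 j1 m2 j2 = k *: F u m1 j1 m2 j2 + F v m1 j1 m2 j2.

Let bnd2_0 : bnd2 (fun _ _ _ _ => 0).
Proof. by exists 0, 0%N. Qed.

Let bnd2D F G : bnd2 F -> bnd2 G ->
  bnd2 (fun m1 j1 m2 j2 => F m1 j1 m2 j2 + G m1 j1 m2 j2).
Proof.
move=> [M [J FP]] [M' [J' GP]]; exists (Order.min M M'), (maxn J J').
move=> m1 j1 m2 j2; rewrite lt_min geq_max => mj.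
by rewrite FP ?GP ?addr0//; case: mj => /andP[]; [left|right|left|right].
Qed.

Let bnd2Z F (c : int -> nat -> K) : bnd2 F ->
  bnd2 (fun m1 j1 m2 j2 => c m1 j1 *: F m1 j1 m2 j2).
Proof. by move=> [M [J FP]]; exists M, J => *; rewrite FP// scaler0. Qed.

Let bnd2_theta F : bnd2 F -> bnd2 (theta12_mul F).
Proof.
move=> [M [J FP]]; exists M, J => m1 j1 m2 j2 mj; rewrite /theta12_mul.
rewrite fsbig1 ?subr0; first by case: j1 => // j1; apply: FP.
move=> n _; rewrite FP ?scaler0//; case: mj => mj; [left|by right].
by apply: le_lt_trans mj; rewrite gerBl.
Qed.

Let lin_theta (F : V -> series2 V) : lin F -> (forall v, bnd2 (F v)) ->
  lin (fun v => theta12_mul (F v)).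
Proof.
move=> linF bF k u v m1 j1 m2 j2; rewrite /theta12_mul.
have [[M [J FP]] [M' [J' FP']]] := (bF u, bF v).
have -> : \sum_(n \in [set n | (0 < n)%N])
    n%:R^-1 *: F (k *: u + v) (m1 + n%:Z) j1 (m2 - n%:Z) j2
  = \sum_(n \in [set n | (0 < n)%N])
     (k *: (n%:R^-1 *: F u (m1 + n%:Z) j1 (m2 - n%:Z) j2)
      + n%:R^-1 *: F v (m1 + n%:Z) j1 (m2 - n%:Z) j2).
  by apply: eq_fsbigr => n _; rewrite linF scalerDr !scalerA (mulrC k).
rewrite (@fsum_linear _ _ _ _ `I_(`|m2 - Order.min M M'|%N.+1))//; last first.
  move=> n _ /negP; rewrite -leqNgt => mn.
  have {}mn : m2 - n%:Z < Order.min M M'.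
    rewrite ltrBlDr -ltrBlDl; apply: le_lt_trans (ler_norm _) _.
    by rewrite -abszE ltz_nat.
  by move: mn; rewrite lt_min => /andP[? ?]; rewrite FP ?FP' ?scaler0//; left.
rewrite scalerBr opprD addrACA; congr (_ + _).
by case: j1 => [|j1]; rewrite ?scaler0 ?addr0 ?linF.
Qed.

Let mu12_bnd2 s v : bnd2 (mu12 s v).
Proof.
elim: s => [|x s IHs].
  by exists 0, 0%N => m1 j1 m2 j2 _; rewrite /mu12 big_nil.
have [M [J sP]] := IHs; have [M' [J' xP]] := (LFP x.2).2 v.
exists (Order.min M M'), (maxn J J') => m1 j1 m2 j2 mj.
have x0 m j : x.1 0 m j = 0.
  by have := LF_linearE x.1 (-1) 0 0 m j; rewrite scaler0 addr0 scaleN1r addNr.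
move: mj; rewrite /mu12 big_cons lt_min geq_max => mj.
rewrite xP ?x0 ?add0r ?[LHS](sP m1 j1)//.
  by case: mj => /andP[]; [left|right].
by case: mj => /andP[]; [left|right].
Qed.

Let mu12_lin s : lin (mu12 s).
Proof.
move=> k u v m1 j1 m2 j2; rewrite /mu12 scaler_sumr -big_split /=.
by apply: eq_bigr => x _; rewrite !LF_linearE.
Qed.

Let mu12_eq s t v : tens_eq s t -> mu12 s v = mu12 t v.
Proof.
have mu_cat s' t' : mu12 (s' ++ t') v
    = fun m1 j1 m2 j2 => mu12 s' v m1 j1 m2 j2 + mu12 t' v m1 j1 m2 j2.
  apply/funext => m1; apply/funext => j1; apply/funext => m2.
  by apply/funext => j2; rewrite /mu12 big_cat.
have LFD (a : LF V) x y m j : a (x + y) m j = a x m j + a y m j.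
  by have := LF_linearE a 1 x y m j; rewrite !scale1r.
have a0 (a : LF V) m j : a 0 m j = 0.
  by have := LF_linearE a (-1) 0 0 m j; rewrite scaler0 addr0 scaleN1r addNr.
elim=> {s t} [s t st|s|s t _ ->|s t u _ -> _ ->|s s' t t' _ h _ h'|s t] //.
- apply/funext => m1; apply/funext => j1; apply/funext => m2; apply/funext => j2.
  case: st => [w|u u' w|u w w'|c u w];
    rewrite /mu12 ?big_cons !big_nil /= ?addr0 //.
  + exact: LFD.
  + have := LF_linearE u c (w v m2 j2) 0 m1 j1.
    by rewrite !addr0 a0 addr0 => ->.
- by rewrite !mu_cat h h'.
- rewrite !mu_cat; apply/funext => m1; apply/funext => j1.
  by apply/funext => m2; apply/funext => j2; rewrite addrC.
Qed.

Let theta_iter_bnd2 k F : bnd2 F -> bnd2 (iter k theta12_mul F).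
Proof. by move=> bF; elim: k => [//|k]; apply: bnd2_theta. Qed.

Let theta_iter_lin k (F : V -> series2 V) : lin F -> (forall v, bnd2 (F v)) ->
  lin (fun v => iter k theta12_mul (F v)).
Proof.
move=> lF bF; elim: k => [//|k IHk]; apply: (lin_theta IHk) => v.
exact: theta_iter_bnd2.
Qed.

Let exp_muE r s v : tens_eq (te_iter S r s) [::] ->
  exp_mu12 S s v = fun m1 j1 m2 j2 => \sum_(k < r)
    k`!%:R^-1 *: iter k theta12_mul (mu12 (te_iter S k s) v) m1 j1 m2 j2.
Proof.
move=> Sr0; apply/funext => m1; apply/funext => j1; apply/funext => m2.
apply/funext => j2; rewrite /exp_mu12.
have SrD k : tens_eq (te_iter S (k + r) s) [::].
  elim: k => // k IHk; exact: (te_op_eq S IHk).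
have z k : (r <= k)%N -> iter k theta12_mul (mu12 (te_iter S k s) v)
    = fun _ _ _ _ => 0.
  move=> rk; rewrite (_ : mu12 _ v = fun _ _ _ _ => 0).
    elim: k {rk} => //= k ->; apply/funext => n1; apply/funext => i1.
    apply/funext => n2; apply/funext => i2.
    rewrite /theta12_mul fsbig1 ?subr0; first by case: i1.
    by move=> n _; rewrite scaler0.
  rewrite -(subnK rk) (mu12_eq _ (SrD _)).
  by do 4 apply/funext => ?; rewrite /mu12 big_nil.
rewrite -(fsbig_widen `I_r)//.
  by rewrite -fsbig_ord.
move=> k [_ /negP]; rewrite -leqNgt => rk /=.
by rewrite z// scaler0.
Qed.

Let exp_mu_bnd2 r s v : tens_eq (te_iter S r s) [::] -> bnd2 (exp_mu12 S s v).
Proof.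
move=> /exp_muE ->; elim: r => [|r IHr].
  by exists 0, 0%N => *; rewrite big_ord0.
rewrite (_ : (fun _ _ _ _ => _) = fun m1 j1 m2 j2 => \sum_(k < r)
    k`!%:R^-1 *: iter k theta12_mul (mu12 (te_iter S k s) v) m1 j1 m2 j2
    + r`!%:R^-1 *: iter r theta12_mul (mu12 (te_iter S r s) v) m1 j1 m2 j2).
  apply: (bnd2D IHr); apply: (bnd2Z (fun _ _ => _)).
  exact/theta_iter_bnd2/mu12_bnd2.
by do 4 apply/funext => ?; rewrite big_ord_recr.
Qed.

Let exp_mu_lin r s : tens_eq (te_iter S r s) [::] -> lin (exp_mu12 S s).
Proof.
move=> Sr0 k u v m1 j1 m2 j2; rewrite !(exp_muE _ Sr0) scaler_sumr -big_split/=.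
apply: eq_bigr => i _; have /= -> := theta_iter_lin i (mu12_lin _) (mu12_bnd2 _).
by rewrite scalerDr !scalerA (mulrC k).
Qed.

Let bnd2_z12 F : bnd2 F -> bnd2 (z12_mul F).
Proof.
move=> [M [J FP]]; exists M, J => m1 j1 m2 j2 mj; rewrite /z12_mul !FP ?subr0//.
by case: mj => mj; [left|right] => //; apply: lt_trans mj; rewrite gtrBl.
Qed.

Let bnd1_z12 F : bnd2 (swap12 F) -> bnd2 (swap12 (z12_mul F)).
Proof.
move=> [M [J FP]]; exists M, J => m1 j1 m2 j2 mj; rewrite /z12_mul /swap12.
rewrite [F (m2 - 1) _ _ _](FP m1 j1) 1?[F m2 _ _ _](FP (m1 - 1) j1) ?subr0//.
by case: mj => mj; [left|right] => //; apply: lt_trans mj; rewrite gtrBl.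
Qed.

Let bnd2_Dz1 F : bnd2 F -> bnd2 (Dz1 F).
Proof. by move=> [M [J FP]]; exists M, J => *; rewrite /Dz1 !FP ?scaler0 ?addr0. Qed.

Let bnd1_Dz1 F : bnd2 (swap12 F) -> bnd2 (swap12 (Dz1 F)).
Proof.
move=> [M [J FP]]; exists (M - 1), J => m1 j1 m2 j2 mj; rewrite /Dz1 /swap12.
rewrite [F _ j2 _ _](FP m1 j1) 1?[F _ j2.+1 _ _](FP m1 j1) ?scaler0 ?addr0//.
  by case: mj => [?|/leqW]; [left; rewrite -ltrBrDr|right].
by case: mj => [?|]; [left; rewrite -ltrBrDr|right].
Qed.

Lemma nprod_coef_LF N n a b r r' :
  tens_eq (te_iter S r [:: (a, b)]) [::] ->
  tens_eq (te_iter S r' (flip_op (a, b))) [::] ->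
  local_order S a b N -> is_LF (nprod_coef S N n a b).
Proof.
move=> r0 r'0 abN; rewrite /nprod_coef.
case: (N%:Z - 1 - n) => k; last first.
  split=> [c u v|v]; last exact: log_laurent0.
  by apply/funext => m; apply/funext => j; rewrite !fctE scaler0 addr0.
pose G v := iter k Dz1 (iter N z12_mul (exp_mu12 S [:: (a, b)] v)).
pose H v : series2 V := fun m1 j1 m2 j2 => k`!%:R^-1 *: G v m1 j1 m2 j2.
have H2 v : bnd2 (H v).
  apply: (bnd2Z (fun _ _ => _)); rewrite /G.
  elim: (k) => [|l IHl]; last exact: bnd2_Dz1.
  elim: (N) => [|l' IHl']; last exact: bnd2_z12.
  exact: exp_mu_bnd2 r0.
have H1 v : bnd2 (swap12 (H v)).
  apply: (bnd2Z (fun _ _ => _)); rewrite -/(swap12 (G v)) /G.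
  elim: (k) => [|l IHl]; last exact: bnd1_Dz1.
  rewrite /= abN; elim: (N) => [|l' IHl']; last exact: bnd1_z12.
  exact: exp_mu_bnd2 r'0.
have Hlin : lin H.
  move=> c u v m1 j1 m2 j2; rewrite /H scalerA (mulrC c) -scalerA -scalerDr.
  congr (_ *: _); rewrite /G.
  elim: (k) m1 j1 m2 j2 => [|l IHl] m1 j1 m2 j2 /=.
    elim: (N) m1 j1 m2 j2 => [|l' IHl'] m1 j1 m2 j2 /=.
      exact: exp_mu_lin r0 c u v m1 j1 m2 j2.
    by rewrite /z12_mul !IHl' scalerBr opprD addrACA.
  rewrite /Dz1 !IHl !scalerDr !scalerA ![c * _]mulrC.
  by rewrite addrACA.
have Hout v : exists (M1 M2 : int) (J1 J2 : nat), forall m1 j1 m2 j2,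
    [\/ m1 < M1, m2 < M2, (J1 <= j1)%N | (J2 <= j2)%N] -> H v m1 j1 m2 j2 = 0.
  have [[M2 [J2 HP2]] [M1 [J1 HP1]]] := (H2 v, H1 v).
  exists M1, M2, J1, J2 => m1 j1 m2 j2 [] ?.
  - by apply: (HP1 m2 j2); left.
  - by apply: HP2; left.
  - by apply: (HP1 m2 j2); right.
  - by apply: HP2; right.
rewrite -/G; split=> [c u v|v].
  apply/funext => m; apply/funext => j; rewrite !fctE /diag12.
  have [M1 [M2 [J1 [J2 uP]]]] := Hout u.
  have [M1' [M2' [J1' [J2' vP]]]] := Hout v.
  rewrite -(@fsum_linear _ _ _ _
    [set i | Order.min M1 M1' <= i /\
       i <= Order.min M1 M1' + (absz (m - Order.min M2 M2' - Order.min M1 M1')%R)%:Z]).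
  - apply: eq_fsbigr => i _; rewrite scaler_sumr -big_split /=.
    by apply: eq_bigr => l _; apply: Hlin.
  - exact: finite_int_itv.
  move=> i _ /= /not_andP ni.
  have {}ni : i < Order.min M1 M1' \/ m - i < Order.min M2 M2'.
    case: ni => [/negP|/negP]; rewrite -ltNge => ni; [by left|right].
    rewrite ltrBlDr -ltrBlDl; apply: le_lt_trans ni.
    by rewrite -lerBlDl abszE ler_norm.
  split; apply: big1 => l _.
    by apply: uP; case: ni; rewrite lt_min => /andP[? _];
      [apply: Or41|apply: Or42].
  by apply: vP; case: ni; rewrite lt_min => /andP[_ ?];
    [apply: Or41|apply: Or42].
have [M1 [M2 [J1 [J2 vP]]]] := Hout v; exists (M1 + M2), (J1 + J2)%N => m j mj.
rewrite /diag12 fsbig1// => i _; apply: big1 => l _; apply: vP.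
case: mj => mj.
  have [?|Mi] := ltP i M1; first exact: Or41.
  by apply: Or42; rewrite ltrBlDr (lt_le_trans mj)// addrC lerD2l.
have [?|lJ] := leqP J1 l; first exact: Or43.
apply: Or44; rewrite leq_subRL; last by rewrite -ltnS.
by apply: leq_trans mj; rewrite leq_add2r ltnW.
Qed.

End ProductInLF.

(* Modes: Y(a,z)|_(zeta = 0) = \sum_n a_(n + S) z^(-n-1). *)
Definition mode (K : fieldType) (V : lmodType K) (a : LF V) (n : int) (v : V) :=
  a v (- n - 1) 0%N.

(* The operators in S are defined on all of LF(V), because the hexagon axiom
   applies S to products of elements of Y_z(V), which are not assumed to lie in
   Y_z(V) again; all conditions on S are imposed on Y_z(V) only. *)
Record log_vertex_algebra (K : fieldType) (V : superspaceType K) :=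
    LogVertexAlgebra {
  lva_vac : V;
  lva_T : {linear V -> V};
  lva_Y : {linear V -> LF V};
  lva_S : even_tensor_end (LF V);
  lva_vac_even : homog false lva_vac;
  lva_T_even : homog_map false lva_T;
  lva_Y_even : homog_map false lva_Y;
  lva_braiding : braiding_on (range lva_Y) lva_S;
  lva_Y_vac : lva_Y lva_vac = LFone V;
  lva_creation : forall a m j, m < 0 \/ (0 < j)%N -> lva_Y a lva_vac m j = 0;
  lva_creation0 : forall a, lva_Y a lva_vac 0 0%N = a;
  lva_T_vac : lva_T lva_vac = 0;
  lva_S_ad : commute_l lva_S (range lva_Y) (LF_ad lva_T);
  lva_S_Dz : commute_l lva_S (range lva_Y) Dz;
  lva_covariance : forall a, LF_ad lva_T (lva_Y a) = Dz (lva_Y a);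
  lva_local : is_local lva_S (range lva_Y);
  lva_hexagon : hexagon lva_S (range lva_Y)
}.

(* Main.v *)
(* Call a field P covariant if [T, P] = D_z P. The coefficients of zeta^j in a
   covariant field are determined recursively by those for j = 0, so both
   identities need only be checked at zeta = 0. There the action of a field A on a
   vector c is read off from the skew-symmetric product: if A is local with Y(c)
   and A(z)1 is a logarithm-free power series, then for large R the series
     z_12^R e^(vartheta_12 S) A(z_1) Y(c, z_2) 1
       = +- z_12^R e^(vartheta_21 S) Y(c, z_2) A(z_1) 1
   has no logarithms and no negative powers, and f = f(z_1, z_2) satisfies
   (d_1 + d_2) f = T f. Hence f is determined by f(0, z_2), which depends only on
   A(z)1 at z = 0, and A(z)c at zeta = 0 is z^-R f(z, 0). So A is determined by
   u = A(z)1 at z = 0. This applies to A = Y(u), to A = D_z Y(a), for which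
   u = T a, and to A = Y(a)_(n + S) Y(b), for which u = a_(n + S) b; in the last
   case locality of A with Y(c) is Dong's lemma, applied before setting z_1 = z_2
   and expressed through the action of S_13 and S_23 on a (x) b (x) c. *)
Require Import Defs.
From mathcomp Require Import all_boot all_order all_algebra.
From mathcomp Require Import all_classical reals.
From HB Require Import structures.
From mathcomp Require Import zify ring lra.

Set Implicit Arguments.
Unset Strict Implicit.
Unset Printing Implicit Defensive.
Import Order.TTheory GRing.Theory Num.Theory.
Local Open Scope classical_set_scope.
Local Open Scope ring_scope.

(** * Formal series in several variables z_i, zeta_i *)

Section FiniteSums.
Context {K : numFieldType} {V : lmodType K}.
Implicit Types f g : nat -> V.

(** Three obstacles shape the calculus of series. The series vartheta_ij can only multiply products
    expanded with z_i to the left of z_j, so an ordering of three fields decides which exponentials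
    make sense. Dong's lemma therefore moves c to the left by exchanging neighbours only: each
    exchange keeps the other two exponentials meaningful on both sides. The product A of Y(a) and
    Y(b) is not known to lie in Y_z(V), so the locality axiom cannot be quoted for A and Y(c).
    Instead z_1 and z_2 stay separate, the powers of S_12, S_13 and S_23 are carried as indices, and
    the diagonal is taken only at the end. The derivatives in A do not commute with e^(vartheta_13
    S_13): z_13 D_1 brings down a factor S_13. Hence locality is stated for all shifts of the power
    of the braiding, and each derivative costs one more factor z_13. All products act on the vacuum.
    Setting z_3 = 0 turns Y(c, z_3)1 into c, so that skew-symmetry becomes a comparison of two
    boundary values of one power series. *)

Definition evz f := exists M, forall n, (M <= n)%N -> f n = 0.

(** Outside [evz] the sum takes the default value 0, so the rules below need finite support. *)
Definition nsum f : V := \sum_(n \in [set: nat]) f n.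

Lemma nsumE M f : (forall n, (M <= n)%N -> f n = 0) -> nsum f = \sum_(n < M) f n.
Proof.
move=> f0; rewrite /nsum -(fsbig_widen `I_M)//; first by rewrite -fsbig_ord.
by move=> n [_ /negP]; rewrite -leqNgt => /f0.
Qed.

Lemma evz_common f g : evz f -> evz g ->
  exists M, (forall n, (M <= n)%N -> f n = 0) /\ (forall n, (M <= n)%N -> g n = 0).
Proof.
move=> [M fM] [M' gM]; exists (maxn M M').
by split=> n; rewrite geq_max => /andP[? ?]; [apply: fM|apply: gM].
Qed.

Lemma nsumD f g : evz f -> evz g -> nsum (fun n => f n + g n) = nsum f + nsum g.
Proof.
move=> ef eg; have [M [fM gM]] := evz_common ef eg.
rewrite (nsumE fM) (nsumE gM) (@nsumE M) ?big_split// => n Mn.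
by rewrite fM ?gM ?addr0.
Qed.

Lemma nsum_linear (W : lmodType K) (h : {linear V -> W}) f :
  evz f -> \sum_(n \in [set: nat]) h (f n) = h (nsum f).
Proof.
move=> [M fM]; rewrite (nsumE fM) linear_sum -(fsbig_widen `I_M)//.
  by rewrite -fsbig_ord.
by move=> n [_ /negP]; rewrite -leqNgt => /fM /= ->; rewrite linear0.
Qed.

Lemma nsumZ c f : evz f -> nsum (fun n => c *: f n) = c *: nsum f.
Proof. exact: (@nsum_linear V (c \*: idfun)). Qed.

Lemma nsumS f : evz f -> nsum f = f 0%N + nsum (fun n => f n.+1).
Proof.
move=> [M fM]; rewrite (@nsumE M.+1) ?(@nsumE M).
- by rewrite big_ord_recl.
- by move=> n Mn; apply: fM; apply: leqW.
- by move=> n Mn; apply/fM/ltnW.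
Qed.

End FiniteSums.

(* A monomial, given by the exponents of z_i at (i, false) and of zeta_i at
   (i, true). Exponents of zeta_i are integers too: the series that occur vanish
   where one of them is negative. *)
Definition expo := nat * bool -> int.
Notation zk i := (i%N, false) (only parsing).
Notation lk i := (i%N, true) (only parsing).
Definition delta (k : nat * bool) : expo := fun k' => (k' == k)%:Z.
Notation dz i := (delta (i%N, false)).
Notation dl i := (delta (i%N, true)).
Definition dir (i j : nat) : expo := dz j - dz i.

Lemma expoMn (d : expo) n k : (d *+ n) k = d k *+ n.
Proof. by elim: n => [|n IHn] //; rewrite !mulrS -IHn. Qed.

Lemma expoD (d e : expo) k : (d + e) k = d k + e k. Proof. by []. Qed.
Lemma expoN (d : expo) k : (- d) k = - d k. Proof. by []. Qed.

(** The grading by the number [n] of factors lets [bdd] say that only finitely many terms of a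
    multiplication reach a given coefficient. *)
Inductive cone (D : set expo) : nat -> expo -> Prop :=
| cone0 : cone D 0 0
| coneS n g d : D d -> cone D n g -> cone D n.+1 (g + d).

Lemma coneMn D d n : D d -> cone D n (d *+ n).
Proof. by move=> Dd; elim: n => [|n IHn]; [exact: cone0|rewrite mulrSr; apply: coneS]. Qed.

Lemma coneD D n m g h : cone D n g -> cone D m h -> cone D (n + m) (g + h).
Proof.
move=> ng; elim=> [|{}m {}h d Dd _ IH]; first by rewrite addn0 addr0.
by rewrite addnS addrA; apply: coneS.
Qed.

Ltac expo_solve := apply/funext => ?; rewrite !(expoD, expoN, expoMn); ring.

Section Series.
Context {K : numFieldType} {V : lmodType K}.
Implicit Types (G H : expo -> V) (D : set expo) (i j k l : nat).

Lemma serD G H e : (G + H) e = G e + H e. Proof. by []. Qed.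
Lemma serZ (c : K) G e : (c *: G) e = c *: G e. Proof. by []. Qed.
Lemma serN G e : (- G) e = - G e. Proof. by []. Qed.
Definition serE := (serD, serZ, serN).

(* Power series in the monomials z_j / z_i, for dir i j in D, can be multiplied
   with G. *)
Definition bdd D G := forall e, exists M : nat,
  forall n g, cone D n g -> (M <= n)%N -> G (e - g) = 0.

(** Multiplication by z_i - z_j. *)
Definition zz (i j : nat) G : expo -> V := fun e => G (e - dz i) - G (e - dz j).

(* Multiplication by \sum_(n >= 1) n^-1 z_i^-n z_j^n, the n = 0 term being 0
   since 0^-1 = 0; [th] is multiplication by vartheta_ij. *)
Definition La (i j : nat) G : expo -> V := fun e =>
  nsum (fun n => n%:R^-1 *: G (e - dir i j *+ n)).

Definition th (i j : nat) G : expo -> V := fun e => G (e - dl i) - La i j G e.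

(** The derivation D_(z_i). The shift by [dz i] comes from d/dz_i in the first term and from the
    factor z_i^-1 in the second. *)
Definition DD (i : nat) G : expo -> V := fun e =>
  (e (zk i) + 1)%:~R *: G (e + dz i) + (e (lk i) + 1)%:~R *: G (e + dz i + dl i).

Lemma bdd_shift D G g : bdd D G -> bdd D (fun e => G (e + g)).
Proof.
move=> bG e; have [M GM] := bG (e + g); exists M => n h nh Mn.
by rewrite addrAC (GM n).
Qed.

Lemma bdd_scale D G (c : expo -> K) : bdd D G -> bdd D (fun e => c e *: G e).
Proof.
move=> bG e; have [M GM] := bG e; exists M => n h nh Mn.
by rewrite (GM n)// scaler0.
Qed.

Lemma bdd_add D G H : bdd D G -> bdd D H -> bdd D (fun e => G e + H e).
Proof.
move=> bG bH e; have [[M GM] [M' HM]] := (bG e, bH e).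
exists (maxn M M') => n h nh; rewrite geq_max => /andP[? ?].
by rewrite (GM n)// (HM n)// addr0.
Qed.

Lemma bdd_opp D G : bdd D G -> bdd D (fun e => - G e).
Proof.
by move=> bG e; have [M GM] := bG e; exists M => n h nh Mn; rewrite (GM n) ?oppr0.
Qed.

Lemma bdd0 D : bdd D (0 : expo -> V).
Proof. by move=> e; exists 0%N. Qed.

Lemma bdd_zz D G i j : bdd D G -> bdd D (zz i j G).
Proof. by move=> bG; apply: bdd_add; [|apply: bdd_opp]; apply: (bdd_shift _ bG). Qed.

Lemma bdd_DD D G i : bdd D G -> bdd D (DD i G).
Proof.
move=> bG; apply: bdd_add; apply: (bdd_scale (fun e => _)).
  exact: bdd_shift bG.
exact: (bdd_shift _ (bdd_shift _ bG)).
Qed.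

Lemma bdd_evz D G e d : D d -> bdd D G -> evz (fun n => G (e - d *+ n)).
Proof.
by move=> Dd bG; have [M GM] := bG e; exists M => n Mn; apply: GM Mn; apply: coneMn.
Qed.

Lemma evz_scale (f : nat -> V) (c : nat -> K) : evz f -> evz (fun n => c n *: f n).
Proof. by move=> [M fM]; exists M => n Mn; rewrite fM// scaler0. Qed.

Lemma evz_dir D G e i j (c : nat -> K) : D (dir i j) -> bdd D G ->
  evz (fun n => c n *: G (e - dir i j *+ n)).
Proof. by move=> Dd bG; apply: evz_scale (bdd_evz e Dd bG). Qed.

Lemma bdd_La D G i j : D (dir i j) -> bdd D G -> bdd D (La i j G).
Proof.
move=> Dd bG e; have [M GM] := bG e; exists M => n g ng Mn.
rewrite /La (@nsumE _ _ 0%N) ?big_ord0// => m _.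
rewrite -addrA -opprD (GM (n + m)%N) ?scaler0 ?(leq_trans Mn)// ?leq_addr//.
by apply: coneD => //; apply: coneMn.
Qed.

Lemma bdd_th D G i j : D (dir i j) -> bdd D G -> bdd D (th i j G).
Proof.
move=> Dd bG; apply: bdd_add; first exact: (bdd_shift _ bG).
exact/bdd_opp/bdd_La.
Qed.

Lemma LaD D G H i j : D (dir i j) -> bdd D G -> bdd D H ->
  La i j (G + H) = La i j G + La i j H.
Proof.
move=> Dd bG bH; apply/funext => e; rewrite /La !serE.
rewrite -(nsumD (evz_dir e _ Dd bG) (evz_dir e _ Dd bH)); congr nsum.
by apply/funext => n; rewrite -scalerDr.
Qed.

Lemma LaZ D G i j c : D (dir i j) -> bdd D G -> La i j (c *: G) = c *: La i j G.
Proof.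
move=> Dd bG; apply/funext => e; rewrite /La !serE.
rewrite -(nsumZ _ (evz_dir e _ Dd bG)); congr nsum.
by apply/funext => n; rewrite !scalerA mulrC.
Qed.

Lemma thD D G H i j : D (dir i j) -> bdd D G -> bdd D H ->
  th i j (G + H) = th i j G + th i j H.
Proof.
move=> Dd bG bH; apply/funext => e; rewrite /th (LaD Dd)// !serE.
by rewrite addrACA -opprD.
Qed.

Lemma thZ D G i j c : D (dir i j) -> bdd D G -> th i j (c *: G) = c *: th i j G.
Proof.
by move=> Dd bG; apply/funext => e; rewrite /th (LaZ _ Dd)// !serE scalerBr.
Qed.

Lemma th0 i j : th i j (0 : expo -> V) = 0.
Proof.
apply/funext => e; rewrite /th /La (@nsumE _ _ 0%N) ?big_ord0 ?subr0// => n _.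
exact: scaler0.
Qed.

Lemma La_shift G i j g e : La i j (fun e => G (e + g)) e = La i j G (e + g).
Proof. by rewrite /La; congr nsum; apply/funext => n; rewrite addrAC. Qed.

Lemma th_shift G i j g e : th i j (fun e => G (e + g)) e = th i j G (e + g).
Proof. by rewrite /th La_shift addrAC. Qed.

Lemma th_zz D G i j k l : D (dir i j) -> bdd D G ->
  th i j (zz k l G) = zz k l (th i j G).
Proof.
move=> Dd bG; rewrite (_ : zz k l G = (fun e => G (e - dz k)) + -1 *: (fun e => G (e - dz l))); last first.
  by apply/funext => e; rewrite /zz !serE scaleN1r.
rewrite (thD Dd) ?(thZ _ Dd).
- by apply/funext => e; rewrite !serE !th_shift scaleN1r.
- exact: (bdd_shift _ bG).
- exact: (bdd_shift _ bG).
- exact: (bdd_scale (fun=> -1) (bdd_shift _ bG)).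
Qed.

(** A term with indices n and m shifts by an element of degree n + m of the cone, so one bound [M]
    truncates both double sums and the summations can be exchanged. *)
Lemma La_La D G i j k l : D (dir i j) -> D (dir k l) -> bdd D G ->
  La i j (La k l G) = La k l (La i j G).
Proof.
move=> D1 D2 bG; apply/funext => e; rewrite /La; have [M GM] := bG e.
have GM' n m : (M <= n)%N || (M <= m)%N -> G (e - dir i j *+ n - dir k l *+ m) = 0.
  move=> nm; rewrite -addrA -opprD (GM (n + m)%N)//.
    by apply: coneD; apply: coneMn.
  by case/orP: nm => /leq_trans; apply; rewrite ?leq_addl ?leq_addr.
rewrite (@nsumE _ _ M) => [|n Mn]; last first.
  rewrite (@nsumE _ _ 0%N) ?big_ord0 ?scaler0// => m _.
  by rewrite GM' ?Mn// scaler0.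
rewrite [RHS](@nsumE _ _ M) => [|n Mn]; last first.
  rewrite (@nsumE _ _ 0%N) ?big_ord0 ?scaler0// => m _.
  by rewrite addrAC GM' ?Mn ?orbT// scaler0.
transitivity (\sum_(n < M) \sum_(m < M) (n%:R^-1 * m%:R^-1 : K) *:
    G (e - dir i j *+ n - dir k l *+ m)).
  apply: eq_bigr => n _; rewrite (@nsumE _ _ M) => [|m Mm]; last first.
    by rewrite GM' ?Mm ?orbT// scaler0.
  by rewrite scaler_sumr; apply: eq_bigr => m _; rewrite scalerA.
rewrite exchange_big; apply: eq_bigr => n _ /=.
rewrite (@nsumE _ _ M) => [|m Mm]; last by rewrite addrAC GM' ?Mm// scaler0.
rewrite scaler_sumr; apply: eq_bigr => m _.
by rewrite scalerA mulrC addrAC.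
Qed.

Lemma th_th D G i j k l : D (dir i j) -> D (dir k l) -> bdd D G ->
  th i j (th k l G) = th k l (th i j G).
Proof.
move=> D1 D2 bG.
have thE i' j' (F : expo -> V) : th i' j' F = (fun e => F (e - dl i')) + (- 1) *: La i' j' F.
  by apply/funext => e; rewrite !serE scaleN1r.
have b k' := bdd_shift (- dl k') bG.
have bL i' j' (D' : D (dir i' j')) : bdd D ((- 1) *: La i' j' G).
  exact/(bdd_scale (fun=> -1))/bdd_La.
rewrite thE [RHS]thE [th k l G]thE [th i j G]thE.
rewrite (LaD D1) ?(LaD D2) ?(LaZ _ D1) ?(LaZ _ D2) ?(La_La D1 D2)//; try exact: bdd_La; try exact: bL.
apply/funext => e; rewrite !serE !La_shift [e - _ - dl k]addrAC -!addrA.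
by congr (_ + _); rewrite !scalerDr addrCA.
Qed.

Lemma DDD k G H : DD k (G + H) = DD k G + DD k H.
Proof. by apply/funext => e; rewrite /DD !serE !scalerDr addrACA. Qed.

Lemma DDZ k c G : DD k (c *: G) = c *: DD k G.
Proof.
by apply/funext => e; rewrite /DD !serE !scalerDr !scalerA ![c * _]mulrC.
Qed.

Lemma zzD i j G H : zz i j (G + H) = zz i j G + zz i j H.
Proof. by apply/funext => e; rewrite /zz !serE opprD addrACA. Qed.

Lemma zzZ i j c G : zz i j (c *: G) = c *: zz i j G.
Proof. by apply/funext => e; rewrite /zz !serE scalerBr. Qed.

Lemma zz_zz i j k l G : zz i j (zz k l G) = zz k l (zz i j G).
Proof.
apply/funext => e; rewrite /zz !opprD !opprK addrACA; congr (_ + _).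
  by rewrite [e - dz k - dz i]addrAC [e - dz k - dz j]addrAC.
by rewrite [e - dz l - dz i]addrAC [e - dz l - dz j]addrAC.
Qed.

Lemma deltaE (k k' : nat * bool) : delta k k' = (k' == k)%:Z. Proof. by []. Qed.

(** Leibniz rule for multiplication by the monomial with exponent [g]: the last two terms are D_k of
    that monomial. *)
Lemma DD_shift G k g e : DD k (fun e => G (e - g)) e = DD k G (e - g)
  + (g (zk k))%:~R *: G (e - g + dz k) + (g (lk k))%:~R *: G (e - g + dz k + dl k).
Proof.
rewrite /DD !expoD !expoN [e + dz k + dl k - g]addrAC [e + dz k - g]addrAC.
rewrite -[RHS]addrA [RHS]addrACA -!scalerDl -!rmorphD /=.
by congr (_%:~R *: _ + _%:~R *: _); ring.
Qed.

Lemma DD_zz k i j G : DD k (zz i j G) =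
  zz i j (DD k G) + ((k == i)%:R - (k == j)%:R) *: G.
Proof.
apply/funext => e; have sh g : DD k (fun e => G (e - g)) e
    = DD k (-1 *: fun e => - G (e - g)) e.
  by congr (DD k _ e); apply/funext => e'; rewrite !serE scaleN1r opprK.
rewrite (_ : zz i j G = (fun e => G (e - dz i)) + (-1) *: (fun e => G (e - dz j))); last first.
  by apply/funext => e'; rewrite /zz !serE scaleN1r.
rewrite DDD DDZ !serE !DD_shift !deltaE !xpair_eqE !andbT !andbF !scale0r !addr0.
rewrite scaleN1r /zz opprD addrACA; congr (_ + _).
have h l : (k == l)%:Z%:~R *: G (e - dz l + dz k) = (k == l)%:R *: G e.
  by case: eqVneq => [->|_]; rewrite ?scale0r// subrK.
by rewrite !h scalerBl.
Qed.

(** Multiplication by z_k^-1 \sum_(n >= 1) z_i^-n z_j^n, which is what differentiating the logarithm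
    series produces. For k = j this is the expansion [hh]; for k = i its first term is missing. *)
Definition gg i j k G : expo -> V := fun e =>
  nsum (fun n => G (e + dz k - dir i j *+ n.+1)).

Lemma DD_La D k i j G : D (dir i j) -> bdd D G ->
  DD k (La i j G) = La i j (DD k G) + (dir i j (zk k))%:~R *: gg i j k G.
Proof.
move=> Dd bG; apply/funext => e; rewrite !serE /gg /La /DD.
have ev e' c := evz_dir e' c Dd bG.
have evG := bdd_evz (e + dz k) Dd bG.
have evS : evz (fun n => G (e + dz k - dir i j *+ n.+1)).
  by have [M GM] := evG; exists M => n Mn; apply/GM/leqW.
(* The coefficient n^-1 n is 0 at n = 0 and 1 elsewhere, so the sum takes the form of the derivative
   of the terms n^-1 z_i^-n z_j^n. *)
have -> : nsum (fun n => G (e + dz k - dir i j *+ n.+1))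
   = nsum (fun n => (n%:R^-1 * n%:R : K) *: G (e + dz k - dir i j *+ n)).
  rewrite [RHS]nsumS; last exact: ev.
  rewrite mulr0 scale0r add0r; congr nsum; apply/funext => n.
  by rewrite mulVf ?scale1r// pnatr_eq0.
rewrite -!nsumZ; try exact: ev.
rewrite -!nsumD; try exact/evz_scale/ev; first last.
- have [M GM] := ev (e + dz k) (fun n => n%:R^-1 * (((e - dir i j *+ n) (zk k) + 1)%:~R)).
  have [M' GM'] := ev (e + dz k + dl k) (fun n => n%:R^-1 * (((e - dir i j *+ n) (lk k) + 1)%:~R)).
  exists (maxn M M') => n; rewrite geq_max => /andP[Mn Mn'].
  have := GM n Mn; have := GM' n Mn'; rewrite scalerDr !scalerA.
  rewrite [e - _ + dz k]addrAC [e + dz k - _ + dl k]addrAC => -> ->.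
  by rewrite addr0.
congr nsum; apply/funext => n; rewrite !expoD !expoN !expoMn.
rewrite [e - _ + dz k]addrAC [e + dz k - _ + dl k]addrAC.
have -> : dir i j (lk k) = 0 by rewrite /dir expoD expoN !deltaE !xpair_eqE !andbF subrr.
rewrite mul0rn subr0 scalerDr !scalerA [RHS]addrAC -scalerDl; congr (_ + _); last by rewrite mulrC.
congr (_ *: _); set d := dir i j _; rewrite -[d *+ n]mulr_natr !intrD mulrNz intrM mulrz_nat.
rewrite -[X in X * (_^-1 * _)]intrD -/(d%:~R); move: (n%:R : K) (d%:~R : K) => x y. ring.
Qed.

(* The expansion of 1 / (z_i - z_j) in powers of z_j / z_i. *)
Definition hh i j G : expo -> V := fun e =>
  nsum (fun n => G (e + dz i - dir i j *+ n)).

Lemma zz_hh D i j G : D (dir i j) -> bdd D G -> zz i j (hh i j G) = G.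
Proof.
move=> Dd bG; apply/funext => e; rewrite /zz /hh nsumS; last first.
  exact: bdd_evz Dd bG.
rewrite mulr0n subr0 subrK -[RHS]addr0 -addrA; congr (_ + _).
apply/eqP; rewrite subr_eq0; apply/eqP; congr nsum; apply/funext => n.
by congr G; rewrite mulrS /dir; expo_solve.
Qed.

(** For k = i, the derivative z_i^-1 of zeta_i supplies the term that [gg] lacks, so D_i vartheta_ij
    = 1/(z_i - z_j). For k = j there is no such term and only the sign changes. *)
Lemma DD_th D k i j G : i != j -> D (dir i j) -> bdd D G ->
  DD k (th i j G) = th i j (DD k G) + ((k == i)%:R - (k == j)%:R) *: hh i j G.
Proof.
move=> ij Dd bG; have thE (F : expo -> V) : th i j F = (fun e => F (e - dl i)) - La i j F by [].
have DDN (F : expo -> V) : DD k (- F) = - DD k F by rewrite -scaleN1r DDZ scaleN1r.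
rewrite !thE DDD DDN (DD_La _ Dd bG); apply/funext => e; rewrite !serE DD_shift.
rewrite !deltaE !xpair_eqE !andbF scale0r addr0 !andbT opprD addrACA; congr (_ + _).
have hSi : hh i j G e = G (e + dz i) + gg i j i G e.
  by rewrite /hh nsumS; [rewrite mulr0n subr0|exact: bdd_evz Dd bG].
have hSj : hh i j G e = gg i j j G e.
  by congr nsum; apply/funext => n; congr G; rewrite mulrS /dir; expo_solve.
have -> : dir i j (zk k) = (k == j)%:Z - (k == i)%:Z.
  by rewrite /dir expoD expoN !deltaE !xpair_eqE !andbT.
have -> : e - dl i + dz k + dl k = e + dz k + (dl k - dl i) by expo_solve.
rewrite intrD mulrNz -!pmulrn.
have [->|ki] := eqVneq k i; first rewrite (negbTE ij).
  by rewrite sub0r subr0 scaleN1r opprK !scale1r subrr addr0 hSi.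
have [->|kj] := eqVneq k j.
  by rewrite subr0 sub0r scale0r scale1r scaleN1r sub0r hSj.
by rewrite subr0 !scale0r subr0.
Qed.

End Series.

(** * Truncated exponentials of vartheta_ij and their derivatives *)

Section Exponentials.
Context {K : numFieldType} {V : lmodType K}.
Implicit Types (G H : expo -> V) (D : set expo) (x y : nat -> expo -> V) (i j k l : nat).

(* e^(vartheta_ij S), where x l carries the l-th power of S. *)
Definition Ex (i j r : nat) x : expo -> V :=
  \sum_(l < r) (l`!%:R^-1 : K) *: iter l (th i j) (x l).

Lemma bddD D G H : bdd D G -> bdd D H -> bdd D (G + H).
Proof. exact: bdd_add. Qed.

Lemma bddZ D (c : K) G : bdd D G -> bdd D (c *: G).
Proof. exact: (bdd_scale (fun=> c)). Qed.

Lemma bdd_sum D (I : Type) (s : seq I) (F : I -> expo -> V) :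
  (forall a, bdd D (F a)) -> bdd D (\sum_(a <- s) F a).
Proof. by move=> bF; apply: big_ind => //; [exact: bdd0|exact: bddD]. Qed.

Lemma bdd_iter_th D G i j l : D (dir i j) -> bdd D G -> bdd D (iter l (th i j) G).
Proof. by move=> Dd bG; elim: l => //= l; apply: bdd_th. Qed.

Lemma bdd_iter_zz D G i j l : bdd D G -> bdd D (iter l (zz i j) G).
Proof. by move=> bG; elim: l => //= l; apply: bdd_zz. Qed.

Lemma bdd_iter_DD D G i l : bdd D G -> bdd D (iter l (DD i) G).
Proof. by move=> bG; elim: l => //= l; apply: bdd_DD. Qed.

Lemma bdd_Ex D i j r x : D (dir i j) -> (forall l, bdd D (x l)) -> bdd D (Ex i j r x).
Proof. by move=> Dd bx; apply: bdd_sum => l; apply/bddZ/bdd_iter_th. Qed.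

(** Infinite sums such as [La] are linear only where they are finite, hence the restriction to
    [bdd D] and its preservation. *)
Definition linear_on D (P : (expo -> V) -> expo -> V) :=
  [/\ forall G H, bdd D G -> bdd D H -> P (G + H) = P G + P H,
      forall c G, bdd D G -> P (c *: G) = c *: P G &
      forall G, bdd D G -> bdd D (P G)].

Lemma linear_on_sum D P (I : Type) (s : seq I) (c : I -> K) (F : I -> expo -> V) :
  linear_on D P -> (forall a, bdd D (F a)) ->
  P (\sum_(a <- s) c a *: F a) = \sum_(a <- s) c a *: P (F a).
Proof.
move=> [PD PZ _] bF; elim: s => [|a s IHs].
  by rewrite !big_nil; have := PZ 0 0 (@bdd0 _ _ _); rewrite !scale0r.
rewrite !big_cons PD ?IHs ?PZ//; first exact: bddZ.
by apply: bdd_sum => i; apply: bddZ.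
Qed.

Lemma linear_on_th D i j : D (dir i j) -> linear_on D (th i j).
Proof.
move=> Dd; split=> *; [exact: (thD Dd)|exact: (thZ _ Dd)|exact: bdd_th].
Qed.

Lemma linear_on_zz D i j : linear_on D (zz i j).
Proof. by split=> *; rewrite ?zzD ?zzZ//; apply: bdd_zz. Qed.

Lemma linear_on_DD D i : linear_on D (DD i).
Proof. by split=> *; rewrite ?DDD ?DDZ//; apply: bdd_DD. Qed.

Lemma linear_on_iter D P l : linear_on D P -> linear_on D (iter l P).
Proof.
move=> [PD PZ Pb]; elim: l => [//|l [IHD IHZ IHb]]; split=> [G H bG bH|c G bG|G bG] /=.
- by rewrite IHD// PD//; apply: IHb.
- by rewrite IHZ// PZ//; apply: IHb.
- exact/Pb/IHb.
Qed.

Lemma iter_comm_on D P Q G l : linear_on D Q -> bdd D G ->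
  (forall H, bdd D H -> P (Q H) = Q (P H)) -> P (iter l Q G) = iter l Q (P G).
Proof.
move=> [_ _ Qb] bG PQ; elim: l => //= l <-; rewrite PQ//.
by elim: l => //= l; apply: Qb.
Qed.

Lemma Ex_comm D P i j r x : linear_on D P -> D (dir i j) ->
  (forall G, bdd D G -> P (th i j G) = th i j (P G)) ->
  (forall l, bdd D (x l)) ->
  P (Ex i j r x) = Ex i j r (fun l => P (x l)).
Proof.
move=> lP Dd Pth bx; rewrite /Ex (linear_on_sum _ _ lP) => [|l].
  by apply: eq_bigr => l _; rewrite (iter_comm_on _ (linear_on_th Dd)).
exact: bdd_iter_th.
Qed.

Lemma Ex_zz D i j k l r M x : D (dir i j) -> (forall l, bdd D (x l)) ->
  iter M (zz k l) (Ex i j r x) = Ex i j r (fun n => iter M (zz k l) (x n)).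
Proof.
move=> Dd bx; apply: (Ex_comm _ (linear_on_iter _ (linear_on_zz _ _ _)) Dd _ bx).
move=> G bG; rewrite (iter_comm_on (P := th i j) _ (linear_on_zz D k l))//.
by move=> H bH; rewrite (th_zz _ _ Dd).
Qed.

Lemma Ex_Ex D i j k l r r' (x : nat -> nat -> expo -> V) :
  D (dir i j) -> D (dir k l) -> (forall m n, bdd D (x m n)) ->
  Ex i j r (fun m => Ex k l r' (x m)) = Ex k l r' (fun n => Ex i j r (x^~ n)).
Proof.
move=> Dij Dkl bx; rewrite /Ex.
under eq_bigr => m _.
  rewrite (linear_on_sum _ _ (linear_on_iter m (linear_on_th Dij))); last first.
    by move=> n; apply: bdd_iter_th.
  rewrite scaler_sumr; over.
rewrite exchange_big; apply: eq_bigr => n _ /=.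
rewrite (linear_on_sum _ _ (linear_on_iter n (linear_on_th Dkl))); last first.
  by move=> m; apply: bdd_iter_th.
rewrite scaler_sumr; apply: eq_bigr => m _.
rewrite !scalerA mulrC; congr (_ *: _).
apply: (iter_comm_on (P := iter m (th i j)) _ (linear_on_th Dkl)) => // H bH.
by rewrite (iter_comm_on (P := th k l) _ (linear_on_th Dij))// => *; rewrite (th_th Dkl Dij).
Qed.

Lemma ExD D i j r x y : D (dir i j) -> (forall l, bdd D (x l)) ->
  (forall l, bdd D (y l)) ->
  Ex i j r (fun l => x l + y l) = Ex i j r x + Ex i j r y.
Proof.
move=> Dd bx Db; rewrite /Ex -big_split; apply: eq_bigr => l _ /=.
by have [-> // _ _] := linear_on_iter l (linear_on_th Dd); rewrite scalerDr.
Qed.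

Lemma Ex_sum D i j r (I : Type) (s : seq I) (x : nat -> I -> expo -> V) :
  D (dir i j) -> (forall l a, bdd D (x l a)) ->
  Ex i j r (fun l => \sum_(a <- s) x l a) = \sum_(a <- s) Ex i j r (x^~ a).
Proof.
move=> Dd bx; elim: s => [|a s IHs].
  rewrite big_nil /Ex big1// => l _; rewrite big_nil; case: l => l _ /=.
  by rewrite (_ : iter l _ 0 = 0) ?scaler0//; elim: l => //= l ->; apply: th0.
under [X in Ex _ _ _ X = _]funext => l do rewrite big_cons.
by rewrite big_cons (ExD _ Dd) ?IHs// => l; apply: bdd_sum.
Qed.

(* Both theta_ij and theta_ji satisfy z_ij [D_i, theta] = 1. *)
Definition dual_to (i j p q : nat) :=
  i != j /\ ((p = i /\ q = j) \/ (p = j /\ q = i)).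

Lemma zz_DD_th D i j p q G : dual_to i j p q -> D (dir p q) -> bdd D G ->
  zz i j (DD i (th p q G)) = zz i j (th p q (DD i G)) + G.
Proof.
move=> [ij [[-> ->]|[-> ->]]] Dd bG.
  by rewrite (DD_th _ ij Dd bG) eqxx (negbTE ij) subr0 scale1r zzD (zz_hh Dd).
have ji : j != i by rewrite eq_sym.
rewrite (DD_th _ ji Dd bG) eqxx (negbTE ij) sub0r scaleN1r zzD.
congr (_ + _); rewrite -[RHS](zz_hh Dd bG).
by apply/funext => e; rewrite /zz !serN opprK addrC.
Qed.

Lemma zz_DD_iter_th D i j p q G l : dual_to i j p q -> D (dir p q) -> bdd D G ->
  zz i j (DD i (iter l (th p q) G)) =
  zz i j (iter l (th p q) (DD i G)) + l%:R *: iter l.-1 (th p q) G.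
Proof.
move=> du Dd bG; have bl l' := bdd_iter_th l' Dd bG.
have bl' l' := bdd_iter_th l' Dd (bdd_DD i bG).
elim: l => [|l IHl]; first by rewrite scale0r addr0.
rewrite iterS (zz_DD_th du Dd)// -(th_zz _ _ Dd); last exact: bdd_DD.
rewrite IHl (thD Dd) ?(thZ _ Dd)//; first last.
- exact: bddZ.
- exact: bdd_zz.
rewrite (th_zz _ _ Dd)//= -addrA; congr (_ + _).
case: l {IHl} => [|l] /=; first by rewrite scale0r add0r scale1r.
by rewrite -[l.+2%:R]natr1 scalerDl scale1r.
Qed.

(** Since z_ij [D_i, vartheta] = 1, differentiating e^(vartheta S) brings down one S, which is the
    shift from [x l] to [x l.+1]. *)
Lemma zz_DD_Ex D i j p q r x : dual_to i j p q -> D (dir p q) ->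
  (forall l, bdd D (x l)) -> x r = 0 ->
  zz i j (DD i (Ex p q r x)) =
  zz i j (Ex p q r (fun l => DD i (x l))) + Ex p q r (fun l => x l.+1).
Proof.
move=> du Dd bx xr.
have lin : linear_on D (fun G => zz i j (DD i G)).
  split=> [G H _ _|c G _|G bG]; [by rewrite DDD zzD|by rewrite DDZ zzZ|].
  by apply: bdd_zz; apply: bdd_DD.
rewrite /Ex (linear_on_sum _ _ lin); last by move=> l; apply: bdd_iter_th.
under eq_bigr => l _ do rewrite (zz_DD_iter_th _ du Dd)// scalerDr scalerA.
rewrite big_split /=; congr (_ + _).
  by rewrite (linear_on_sum _ _ (linear_on_zz D i j))// => l;
    apply: (bdd_iter_th _ Dd); apply: bdd_DD.
(* The term l = r vanishes by [xr], and the term l = 0 by its factor l. Shifting the index then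
   restores an exponential truncated at the same [r]. *)
have -> : \sum_(l < r) (l`!%:R^-1 * l%:R : K) *: iter l.-1 (th p q) (x l) =
   \sum_(l < r.+1) (l`!%:R^-1 * l%:R : K) *: iter l.-1 (th p q) (x l).
  rewrite big_ord_recr /= xr (_ : iter _ _ 0 = 0) ?scaler0 ?addr0//.
  by elim: r.-1 => //= n ->; apply: th0.
rewrite big_ord_recl mulr0 scale0r add0r; apply: eq_bigr => l _ /=.
congr (_ *: _); rewrite /bump /= add1n factS natrM invfM mulrAC mulVf ?mul1r//.
by rewrite pnatr_eq0.
Qed.

Lemma DD_Ex D k i j r x : k != i -> k != j -> i != j -> D (dir i j) ->
  (forall l, bdd D (x l)) ->
  DD k (Ex i j r x) = Ex i j r (fun l => DD k (x l)).
Proof.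
move=> ki kj ij Dd bx; apply: (Ex_comm _ (linear_on_DD _ _) Dd _ bx) => G bG.
by rewrite (DD_th _ ij Dd bG) (negbTE ki) (negbTE kj) subrr scale0r addr0.
Qed.

(** D_i + D_j kills vartheta_ij, its two derivatives being opposite. *)
Lemma DD2_Ex D i j r x : i != j -> D (dir i j) -> (forall l, bdd D (x l)) ->
  DD i (Ex i j r x) + DD j (Ex i j r x) = Ex i j r (fun l => DD i (x l) + DD j (x l)).
Proof.
move=> ij Dd bx; have lin : linear_on D (fun G => DD i G + DD j G).
  split=> [G H _ _|c G _|G bG]; first by rewrite !DDD addrACA.
  - by rewrite !DDZ [RHS]scalerDr.
  - by apply: bddD; apply: bdd_DD.
apply: (Ex_comm _ lin Dd _ bx) => G bG; rewrite !(DD_th _ ij Dd bG) !eqxx (negbTE ij) eq_sym (negbTE ij).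
rewrite (thD Dd); [|exact: bdd_DD..].
by rewrite subr0 sub0r scale1r scaleN1r addrACA subrr addr0.
Qed.

(* Locality of the family x_l against y_l: x_l and y_l are the two orderings of
   a product to which the l-th power of the braiding has been applied. *)
Definition Loc i j r R x y := forall s,
  iter R (zz i j) (Ex i j r (fun l => x (s + l)%N))
  = iter R (zz i j) (Ex j i r (fun l => y (s + l)%N)).

Lemma DD_iter_zz i j R G : i != j ->
  DD i (iter R (zz i j) G) = iter R (zz i j) (DD i G) + R%:R *: iter R.-1 (zz i j) G.
Proof.
move=> ij; elim: R => [|R IHR]; first by rewrite scale0r addr0.
rewrite iterS DD_zz eqxx (negbTE ij) subr0 scale1r IHR zzD zzZ /= -addrA.
congr (_ + _); case: R {IHR} => [|R] /=; first by rewrite scale0r add0r scale1r.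
by rewrite -[R.+2%:R]natr1 scalerDl scale1r.
Qed.

(** Multiplying the derivative by z_ij avoids dividing by z_i - z_j and raises the order by one. The
    factor S brought down turns the shift s into s + 1, which is why [Loc] quantifies over all
    shifts. *)
Lemma Loc_DD D D' i j r R x y : i != j -> D (dir i j) -> D' (dir j i) ->
  (forall l, bdd D (x l)) -> (forall l, bdd D' (y l)) ->
  (forall l, (r <= l)%N -> x l = 0) -> (forall l, (r <= l)%N -> y l = 0) ->
  Loc i j r R x y -> Loc i j r R.+1 (fun l => DD i (x l)) (fun l => DD i (y l)).
Proof.
move=> ij Dd Dd' bx Db x0 y0 xy s.
have iterzz G : iter R.+1 (zz i j) G = iter R (zz i j) (zz i j G) by rewrite iterSr.
have zzB M (G H : expo -> V) : iter M (zz i j) (G + H) = iter M (zz i j) G + iter M (zz i j) H.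
  by elim: M => //= M ->; rewrite zzD.
(* The right-hand side involves [z] only through the two sides of [Loc] at the shifts s and s + 1.
   The formula is the same for vartheta_ij and vartheta_ji. *)
have key p q E z : dual_to i j p q -> E (dir p q) -> (forall l, bdd E (z l)) ->
    (forall l, (r <= l)%N -> z l = 0) ->
    iter R.+1 (zz i j) (Ex p q r (fun l => DD i (z (s + l)%N)))
    = DD i (zz i j (iter R (zz i j) (Ex p q r (fun l => z (s + l)%N))))
      - R.+1%:R *: iter R (zz i j) (Ex p q r (fun l => z (s + l)%N))
      - iter R (zz i j) (Ex p q r (fun l => z (s.+1 + l)%N)).
  move=> du Ed bz z0; rewrite -iterS DD_iter_zz// PeanoNat.Nat.pred_succ addrK.
  rewrite !iterzz (zz_DD_Ex du Ed)//; last by rewrite z0 ?leq_addl.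
  rewrite zzB -addrA.
  rewrite (_ : (fun l => z (s + l.+1)%N) = fun l => z (s.+1 + l)%N) ?subrr ?addr0//.
  by apply/funext => l; rewrite addnS.
rewrite (key i j D)//; last by split=> //; left.
rewrite (key j i D')//; last by split=> //; right.
by rewrite !xy.
Qed.

End Exponentials.

Section IntSums.
Context {V : zmodType}.
Implicit Types f g : int -> V.

Definition zsum f : V := \sum_(i \in [set: int]) f i.

Lemma zsumE B n f : (forall i : int, i < B \/ B + n%:Z <= i -> f i = 0) ->
  zsum f = \sum_(m < n) f (B + m%:Z).
Proof.
move=> f0; rewrite /zsum (_ : [set: int] = [set` predT]); last exact/seteqP.
rewrite -(@bigfs _ _ _ _ [seq B + m%:Z | m <- index_iota 0 n])//.
- by rewrite big_map big_mkord.
- by rewrite map_inj_uniq ?iota_uniq// => m m' /addrI [].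
- move=> i _; apply: contraNeq => fi; apply/mapP.
  have [iB|Bi] := ltP i B; first by rewrite f0 ?eqxx// in fi; left.
  have [Bni|iB] := leP (B + n%:Z) i; first by rewrite f0 ?eqxx// in fi; right.
  by exists `|i - B|%N; rewrite ?mem_index_iota; lia.
Qed.

Definition evzZ f := exists (B : int) n, forall i : int, i < B \/ B + n%:Z <= i -> f i = 0.

Lemma evzZ_common f g : evzZ f -> evzZ g -> exists (B : int) n,
  (forall i : int, i < B \/ B + n%:Z <= i -> f i = 0) /\
  (forall i : int, i < B \/ B + n%:Z <= i -> g i = 0).
Proof.
move=> [B [n fB]] [B' [n' gB]].
exists (- (`|B|%N + `|B'|%N)%:Z), (2 * (`|B|%N + `|B'|%N) + n + n')%N.
by split=> i ?; [apply: fB|apply: gB]; lia.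
Qed.

Lemma zsumD f g : evzZ f -> evzZ g -> zsum (fun i => f i + g i) = zsum f + zsum g.
Proof.
move=> ef eg; have [B [n [fB gB]]] := evzZ_common ef eg.
rewrite (zsumE fB) (zsumE gB) (@zsumE B n) ?big_split// => i iB.
by rewrite fB ?gB ?addr0.
Qed.

Lemma zsumB f g : evzZ f -> evzZ g -> zsum (fun i => f i - g i) = zsum f - zsum g.
Proof.
move=> ef eg; have [B [n [fB gB]]] := evzZ_common ef eg.
rewrite (zsumE fB) (zsumE gB) (@zsumE B n) ?sumrB// => i iB.
by rewrite fB ?gB ?subr0.
Qed.

Lemma zsum_shift f k : evzZ f -> zsum (fun i => f (i + k)) = zsum f.
Proof.
move=> [B [n fB]]; rewrite (zsumE fB) (@zsumE (B - k) n) => [|i iB].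
  by apply: eq_bigr => m _; congr f; ring.
by apply: fB; lia.
Qed.

Lemma evzZ_shift f k : evzZ f -> evzZ (fun i => f (i + k)).
Proof. by move=> [B [n fB]]; exists (B - k), n => i iB; apply: fB; lia. Qed.

End IntSums.

(** * Supports: absence of negative powers and of logarithms *)

Section Supports.
Context {K : numFieldType} {V : lmodType K}.
Implicit Types (G H : expo -> V) (x : nat -> expo -> V) (i j : nat).

Definition nonneg k G := forall e : expo, e k < 0 -> G e = 0.
Definition zero_exp k G := forall e : expo, e k != 0 -> G e = 0.

Lemma nonnegD k G H : nonneg k G -> nonneg k H -> nonneg k (G + H).
Proof. by move=> g h e ek; rewrite serD g ?h ?addr0. Qed.
Lemma zero_expD k G H : zero_exp k G -> zero_exp k H -> zero_exp k (G + H).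
Proof. by move=> g h e ek; rewrite serD g ?h ?addr0. Qed.
Lemma nonnegZ k (c : K) G : nonneg k G -> nonneg k (c *: G).
Proof. by move=> g e ek; rewrite serZ g ?scaler0. Qed.
Lemma zero_expZ k (c : K) G : zero_exp k G -> zero_exp k (c *: G).
Proof. by move=> g e ek; rewrite serZ g ?scaler0. Qed.

Lemma nonneg_zz k i j G : nonneg k G -> nonneg k (zz i j G).
Proof. by move=> g e ek; rewrite /zz !g ?subr0// !expoD !expoN !deltaE; lia. Qed.

Lemma zero_exp_zz (k : nat) i j G : zero_exp (lk k) G -> zero_exp (lk k) (zz i j G).
Proof.
by move=> g e ek; rewrite /zz !g ?subr0// !expoD !expoN !deltaE !xpair_eqE !andbF subr0.
Qed.

Lemma nonneg_th k i j G : k != zk i -> nonneg k G -> nonneg k (th i j G).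
Proof.
move=> ki g e ek; have dk : 0 <= dir i j k.
  by rewrite /dir expoD expoN !deltaE (negbTE ki) subr0; case: eqP.
rewrite /th g ?sub0r; last by rewrite expoD expoN deltaE; lia.
rewrite /La (@nsumE _ _ 0%N) ?big_ord0 ?oppr0// => n _.
rewrite g ?scaler0// expoD expoN expoMn.
by apply: le_lt_trans ek; rewrite gerBl mulrn_wge0.
Qed.

Lemma zero_exp_th (k : nat) i j G : k != i -> zero_exp (lk k) G -> zero_exp (lk k) (th i j G).
Proof.
move=> ki g e ek; rewrite /th g ?sub0r; last first.
  by rewrite expoD expoN deltaE xpair_eqE (negbTE ki) subr0.
rewrite /La (@nsumE _ _ 0%N) ?big_ord0 ?oppr0// => n _.
by rewrite g ?scaler0// expoD expoN expoMn /dir expoD expoN !deltaE !xpair_eqE !andbF subrr mul0rn subr0.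
Qed.

(** d/dz_i annihilates z_i^0, but z_i^-1 d/dzeta_i would create z_i^-1 from a logarithm; this is why
    zeta_i must be absent when [k] is the exponent of z_i. *)
Lemma nonneg_DD k i G : (k == zk i -> zero_exp (lk i) G) -> nonneg k G -> nonneg k (DD i G).
Proof.
move=> gl g e ek; rewrite /DD.
have [ki|ki] := eqVneq k (zk i).
  have -> : (e (lk i) + 1)%:~R *: G (e + dz i + dl i) = 0.
    have [->|l0] := eqVneq (e (lk i) + 1) 0; first by rewrite scale0r.
    rewrite gl ?ki// ?scaler0// !expoD !deltaE !xpair_eqE !andbF eqxx /=.
    by rewrite addr0.
  rewrite addr0; have [->|l0] := eqVneq (e (zk i) + 1) 0; first by rewrite scale0r.
  rewrite g ?scaler0// expoD deltaE ki eqxx; rewrite ki in ek; lia.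
rewrite g ?scaler0 ?add0r; last by rewrite expoD deltaE (negbTE ki) addr0.
have [kl|kl] := eqVneq k (lk i); last first.
  by rewrite g ?scaler0// !expoD !deltaE (negbTE ki) (negbTE kl) !addr0.
have [->|l0] := eqVneq (e (lk i) + 1) 0; first by rewrite scale0r.
rewrite g ?scaler0// !expoD !deltaE kl xpair_eqE eqxx andbF eqxx; rewrite kl in ek; lia.
Qed.

Lemma zero_exp_DD (k : nat) i G : zero_exp (lk k) G -> zero_exp (lk k) (DD i G).
Proof.
move=> g e ek; rewrite /DD g ?scaler0 ?add0r; last by rewrite expoD deltaE xpair_eqE andbF addr0.
have [ki|ki] := eqVneq k i; last first.
  by rewrite g ?scaler0// !expoD !deltaE !xpair_eqE andbF (negbTE ki) !addr0.
have [->|l0] := eqVneq (e (lk i) + 1) 0; first by rewrite scale0r.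
by rewrite g ?scaler0// !expoD !deltaE ki xpair_eqE andbF eqxx addr0.
Qed.

Lemma nonneg_iter_th k i j n G : k != zk i -> nonneg k G -> nonneg k (iter n (th i j) G).
Proof. by move=> ki g; elim: n => //= n; apply: nonneg_th. Qed.

Lemma zero_exp_iter_th (k : nat) i j n G : k != i -> zero_exp (lk k) G ->
  zero_exp (lk k) (iter n (th i j) G).
Proof. by move=> ki g; elim: n => //= n; apply: zero_exp_th. Qed.

Lemma nonneg_Ex k i j r x : k != zk i -> (forall l, nonneg k (x l)) -> nonneg k (Ex i j r x).
Proof.
move=> ki gx; apply: big_ind => [e _|G H|l _]; [by []|exact: nonnegD|].
by apply/nonnegZ/nonneg_iter_th.
Qed.

Lemma zero_exp_Ex (k : nat) i j r x : k != i -> (forall l, zero_exp (lk k) (x l)) ->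
  zero_exp (lk k) (Ex i j r x).
Proof.
move=> ki gx; apply: big_ind => [e _|G H|l _]; [by []|exact: zero_expD|].
by apply/zero_expZ/zero_exp_iter_th.
Qed.

Lemma nonneg_iter_zz k i j R G : nonneg k G -> nonneg k (iter R (zz i j) G).
Proof. by move=> g; elim: R => //= R; apply: nonneg_zz. Qed.

Lemma zero_exp_iter_zz (k : nat) i j R G : zero_exp (lk k) G -> zero_exp (lk k) (iter R (zz i j) G).
Proof. by move=> g; elim: R => //= R; apply: zero_exp_zz. Qed.

(** Each term of vartheta_ij contains zeta_i or a positive power of z_j. Setting both to 0 kills it,
    so that in [Ex_low] only the term l = 0 survives. *)
Lemma th_low i j G (e : expo) : i != j -> nonneg (zk j) G -> nonneg (lk i) G ->
  e (zk j) <= 0 -> e (lk i) <= 0 -> th i j G e = 0.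
Proof.
move=> ij gz gl ej ei; rewrite /th gl ?sub0r; last first.
  by rewrite expoD expoN deltaE eqxx; lia.
rewrite /La (@nsumE _ _ 0%N) ?big_ord0 ?oppr0// => -[|n] _; first by rewrite invr0 scale0r.
rewrite gz ?scaler0// expoD expoN expoMn /dir expoD expoN !deltaE !xpair_eqE eqxx eq_sym (negbTE ij).
by rewrite subr0; lia.
Qed.

Lemma Ex_low i j r x (e : expo) : i != j ->
  (forall l, nonneg (zk j) (x l)) -> (forall l, nonneg (lk i) (x l)) ->
  e (zk j) <= 0 -> e (lk i) <= 0 -> Ex i j r.+1 x e = x 0%N e.
Proof.
move=> ij gz gl ej ei; rewrite /Ex big_ord_recl serD serZ /= invr1 scale1r.
rewrite -[RHS]addr0; congr (_ + _).
rewrite (_ : (\sum_(l < r) _) e = \sum_(l < r) ((bump 0 l)`!%:R^-1 : K) *: iter (bump 0 l) (th i j) (x (bump 0 l)) e).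
  apply: big1 => l _; rewrite /bump /= add1n /= th_low ?scaler0//.
    by apply: nonneg_iter_th => //; rewrite xpair_eqE andbT eq_sym.
  by apply: nonneg_iter_th => //; rewrite xpair_eqE andbF.
by elim/big_rec2: _ => // l G H _ <-.
Qed.

Lemma zzE i j G e : zz i j G e = G (e - dz i) - G (e - dz j). Proof. by []. Qed.

(** At z_j = 0 each factor z_i - z_j acts as z_i. In [zz_low_l] the roles are exchanged and each
    factor contributes a sign. *)
Lemma zz_low_r i j R G (e : expo) : i != j -> nonneg (zk j) G -> e (zk j) <= 0 ->
  iter R (zz i j) G e = G (e - dz i *+ R).
Proof.
move=> ij g; elim: R e => [|R IHR] e ej /=; first by rewrite mulr0n subr0.
rewrite zzE [X in _ - X](nonneg_iter_zz _ _ _ g) ?subr0.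
  rewrite IHR; first by congr G; rewrite mulrS; expo_solve.
  by rewrite expoD expoN deltaE xpair_eqE andbT eq_sym (negbTE ij) subr0.
by rewrite expoD expoN deltaE eqxx; lia.
Qed.

Lemma zz_low_l i j R G (e : expo) : i != j -> nonneg (zk i) G -> e (zk i) <= 0 ->
  iter R (zz i j) G e = (-1) ^+ R *: G (e - dz j *+ R).
Proof.
move=> ij g; elim: R e => [|R IHR] e ej /=; first by rewrite mulr0n subr0 scale1r.
rewrite zzE [X in X - _](nonneg_iter_zz _ _ _ g) ?sub0r.
  rewrite IHR; first by rewrite exprS mulN1r scaleNr; congr (- (_ *: G _)); rewrite mulrS; expo_solve.
  by rewrite expoD expoN deltaE xpair_eqE andbT (negbTE ij) subr0.
by rewrite expoD expoN deltaE eqxx; lia.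
Qed.

End Supports.

(** * Skew-symmetry *)

Section SkewSymmetry.
Context {K : numFieldType} {V : lmodType K}.
Implicit Types (G H : expo -> V) (D : set expo).

Definition ex3 (m1 m2 m3 : int) : expo := fun k =>
  if k == zk 1 then m1 else if k == zk 2 then m2 else if k == zk 3 then m3 else 0.

Lemma ex3D m1 m2 m3 n1 n2 n3 : ex3 m1 m2 m3 + ex3 n1 n2 n3 = ex3 (m1 + n1) (m2 + n2) (m3 + n3).
Proof. by apply/funext => k; rewrite expoD /ex3; do ![case: ifP => _ //]. Qed.

Lemma ex3N m1 m2 m3 : - ex3 m1 m2 m3 = ex3 (- m1) (- m2) (- m3).
Proof. by apply/funext => k; rewrite expoN /ex3; do ![case: ifP => _ //]. Qed.

Lemma ex3Mn m1 m2 m3 n : ex3 m1 m2 m3 *+ n = ex3 (m1 *+ n) (m2 *+ n) (m3 *+ n).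
Proof. by apply/funext => k; rewrite expoMn /ex3; do ![case: ifP => _ //]; rewrite mul0rn. Qed.

Lemma dz_ex3 : [/\ dz 1 = ex3 1 0 0, dz 2 = ex3 0 1 0 & dz 3 = ex3 0 0 1].
Proof.
split; apply/funext => k; rewrite deltaE /ex3.
- by case: ifP => // _; do ![case: ifP => //].
- by case: ifP => [/eqP ->|_] //; case: ifP => // _; case: ifP.
- by case: ifP => [/eqP ->|_] //; case: ifP => [/eqP ->|_] //; case: ifP.
Qed.

Definition DDs G : expo -> V := DD 1 G + DD 2 G + DD 3 G.

Definition postcomp (T : V -> V) G : expo -> V := fun e => T (G e).

Lemma linear_on_DDs D : linear_on D DDs.
Proof.
split=> [G H _ _|c G _|G bG]; rewrite /DDs.
- by rewrite !DDD (addrACA (DD 1 G)) (addrACA (DD 1 G + DD 2 G)).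
- by rewrite !DDZ [in RHS]scalerDr [c *: (DD 1 G + _)]scalerDr.
- by apply: bddD; first apply: bddD; apply: bdd_DD.
Qed.

Lemma addr_cancel1 (W : zmodType) (a b c x : W) : a + x + b + (c - x) = a + b + c.
Proof. by rewrite (addrAC a x) addrACA subrr addr0. Qed.

Lemma addr_cancel2 (W : zmodType) (a b c x : W) : a + (b + x) + (c - x) = a + b + c.
Proof. by rewrite (addrA a) addrACA subrr addr0. Qed.

Lemma DDs_zz (i : nat) G : (0 < i < 3)%N -> DDs (zz i 3 G) = zz i 3 (DDs G).
Proof.
case: i => [|[|[|]]]//= _; rewrite /DDs !DD_zz (zzD _ _ (DD 1 G + DD 2 G))
  (zzD _ _ (DD 1 G)) /= ?(subr0, sub0r, scale0r, addr0) scale1r scaleN1r.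
  exact: addr_cancel1.
exact: addr_cancel2.
Qed.

Lemma DDs_th D (i : nat) G : (0 < i < 3)%N -> D (dir 3 i) -> bdd D G ->
  DDs (th 3 i G) = th 3 i (DDs G).
Proof.
move=> i3 Dd bG; have i3' : 3%N != i by case: i i3 {Dd} => [|[|[|]]].
have bD k := bdd_DD k bG.
rewrite /DDs !(DD_th _ i3' Dd bG) (thD Dd (bddD (bD 1) (bD 2)) (bD 3)) (thD Dd (bD 1) (bD 2)).
case: i i3 {i3' Dd} => [|[|[|]]]//= _; rewrite ?(subr0, sub0r, scale0r, addr0) scale1r scaleN1r.
  by rewrite -[X in _ + (_ + X)]opprK addr_cancel1.
by rewrite -[X in _ + (_ + X)]opprK addr_cancel2.
Qed.

Lemma postcomp_th D (T : {linear V -> V}) i j G : D (dir i j) -> bdd D G ->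
  postcomp T (th i j G) = th i j (postcomp T G).
Proof.
move=> Dd bG; apply/funext => e; rewrite /postcomp /th linearB /=; congr (_ - _).
rewrite /La -[LHS](@nsum_linear _ _ _ T); last exact: (evz_dir e (fun n => n%:R^-1) Dd bG).
by congr nsum; apply/funext => n; rewrite linearZ.
Qed.

Lemma postcomp_zz (T : {linear V -> V}) i j G :
  postcomp T (zz i j G) = zz i j (postcomp T G).
Proof. by apply/funext => e; rewrite /postcomp /zz linearB. Qed.

Lemma linear_on_postcomp D (T : {linear V -> V}) : linear_on D (postcomp T).
Proof.
split=> [G H _ _|c G _|G bG].
- by apply/funext => e; rewrite /postcomp !serD linearD.
- by apply/funext => e; rewrite /postcomp !serZ linearZ.
- by move=> e; have [M GM] := bG e; exists M => n h nh Mn; rewrite /postcomp (GM n)// linear0.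
Qed.

(* [s] and [g] are the logarithm-free parts of A(z)c and of the skew product
   c(z)u with u = A(z)1 at z = 0. The common values z_12^R (...) of the two
   orderings of A(z_1)c(z_2)1 form a power series with coefficients [phi], for
   which translation covariance is the recursion below. *)
Definition skew_system (T : V -> V) (s g : int -> V) := exists R0 : nat, forall R,
  (R0 <= R)%N -> exists phi : nat -> nat -> V,
  [/\ forall i j, i.+1%:R *: phi i.+1 j + j.+1%:R *: phi i j.+1 = T (phi i j),
      forall i, phi i 0%N = s (i%:Z - R%:Z) &
      forall j, phi 0%N j = (-1) ^+ R *: g (j%:Z - R%:Z)].

(** The row phi_0 is given by [g], and the recursion yields each next row after division by i + 1.
    The column phi_(i,0) then returns [s]. *)
Lemma skew_unique (T : V -> V) s s' g : skew_system T s g -> skew_system T s' g -> s = s'.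
Proof.
move=> [R0 sP] [R0' s'P]; apply/funext => m.
(* R >= |m| makes m + R a natural number, at which phi_(m+R,0) = s m can be read. *)
pose R := (maxn (maxn R0 R0') `|m|%N).
have [|phi [phiT phis phig]] := sP R; first by rewrite !leq_max leqnn.
have [|psi [psiT psis psig]] := s'P R; first by rewrite !leq_max leqnn orbT.
have eq i : forall j, phi i j = psi i j.
  elim: i => [|i IHi] j; first by rewrite phig psig.
  have : i.+1%:R *: phi i.+1 j = i.+1%:R *: psi i.+1 j :> V.
    by apply: (addIr (j.+1%:R *: phi i j.+1)); rewrite phiT !IHi psiT.
  by move/(congr1 (GRing.scale (i.+1%:R^-1 : K))); rewrite !scalerA mulVf ?pnatr_eq0// !scale1r.
have := phis (absz (m + R%:Z)); rewrite eq psis (_ : _ - R%:Z = m)// /R; lia.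
Qed.

(** In [G] the field c(z_3) stands next to the vacuum, in [G'] it stands in front. The support
    conditions of both sides hold for the common value, since the exponentials with vartheta_13,
    vartheta_23 spoil only z_1, z_2 and those with vartheta_31, vartheta_32 only z_3. The other
    factor may depend on both z_1 and z_2, the diagonal entering only through [s]. *)
Lemma skew_of_locality (T : {linear V -> V}) D (G G' : nat -> nat -> expo -> V)
    r r' R1 R2 s g :
  D (dir 3 1) -> D (dir 3 2) -> (forall k l, bdd D (G' k l)) ->
  iter R1 (zz 1 3) (Ex 1 3 r.+1 (fun k => iter R2 (zz 2 3) (Ex 2 3 r'.+1 (G k))))
  = iter R1 (zz 1 3) (Ex 3 1 r.+1 (fun k => iter R2 (zz 2 3) (Ex 3 2 r'.+1 (G' k)))) ->
  (forall k l, [/\ nonneg (zk 3) (G k l), zero_exp (lk 3) (G k l),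
     nonneg (lk 1) (G k l) & nonneg (lk 2) (G k l)]) ->
  (forall k l, [/\ nonneg (zk 1) (G' k l), nonneg (zk 2) (G' k l),
     zero_exp (lk 1) (G' k l), zero_exp (lk 2) (G' k l) & nonneg (lk 3) (G' k l)]) ->
  (forall k l, DDs (G' k l) = postcomp T (G' k l)) ->
  (forall m, s m = zsum (fun i => G 0%N 0%N (ex3 i (m - i) 0))) ->
  (forall m, g m = G' 0%N 0%N (ex3 0 0 m)) ->
  skew_system T s g.
Proof.
move=> D31 D32 bG' loc supG supG' cov sE gE; exists (R1 + R2)%N => R leR.
(* On z_1 = z_2 the R - R2 factors z_13 and the R2 factors z_23 together give (z - z_3)^R. *)
pose F := iter (R - R2) (zz 1 3) (Ex 1 3 r.+1 (fun k => iter R2 (zz 2 3) (Ex 2 3 r'.+1 (G k)))).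
have F' : F = iter (R - R2) (zz 1 3) (Ex 3 1 r.+1 (fun k => iter R2 (zz 2 3) (Ex 3 2 r'.+1 (G' k)))).
  by rewrite /F -(subnK (_ : (R1 <= R - R2)%N)) ?iterD ?loc//; lia.
have F3 : nonneg (zk 3) F.
  apply: nonneg_iter_zz; apply: nonneg_Ex => // k; apply: nonneg_iter_zz.
  by apply: nonneg_Ex => // l; case: (supG k l).
have Fl3 : zero_exp (lk 3) F.
  apply: zero_exp_iter_zz; apply: zero_exp_Ex => // k; apply: zero_exp_iter_zz.
  by apply: zero_exp_Ex => // l; case: (supG k l).
have F1 : nonneg (zk 1) F.
  rewrite F'; apply: nonneg_iter_zz; apply: nonneg_Ex => // k; apply: nonneg_iter_zz.
  by apply: nonneg_Ex => // l; case: (supG' k l).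
have F2 : nonneg (zk 2) F.
  rewrite F'; apply: nonneg_iter_zz; apply: nonneg_Ex => // k; apply: nonneg_iter_zz.
  by apply: nonneg_Ex => // l; case: (supG' k l).
have Fl1 : zero_exp (lk 1) F.
  rewrite F'; apply: zero_exp_iter_zz; apply: zero_exp_Ex => // k; apply: zero_exp_iter_zz.
  by apply: zero_exp_Ex => // l; case: (supG' k l).
have Fl2 : zero_exp (lk 2) F.
  rewrite F'; apply: zero_exp_iter_zz; apply: zero_exp_Ex => // k; apply: zero_exp_iter_zz.
  by apply: zero_exp_Ex => // l; case: (supG' k l).
have FT : DDs F = postcomp T F.
  have comm P : linear_on D P -> (forall i G, (0 < i < 3)%N -> P (zz i 3 G) = zz i 3 (P G)) ->
      (forall i G, (0 < i < 3)%N -> D (dir 3 i) -> bdd D G -> P (th 3 i G) = th 3 i (P G)) ->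
      P F = iter (R - R2) (zz 1 3) (Ex 3 1 r.+1 (fun k => iter R2 (zz 2 3)
        (Ex 3 2 r'.+1 (fun l => P (G' k l))))).
    move=> lP Pzz Pth.
    have Pz i M (H : expo -> V) : (0 < i < 3)%N -> P (iter M (zz i 3) H) = iter M (zz i 3) (P H).
      by move=> i3; elim: M => //= M <-; rewrite Pzz.
    rewrite F' Pz// (Ex_comm _ lP D31)//; first last.
    - by move=> k; apply: bdd_iter_zz; apply: bdd_Ex.
    - by move=> H bH; apply: Pth.
    congr (iter _ _ (Ex 3 1 r.+1 _)); apply/funext => k.
    by rewrite Pz// (Ex_comm _ lP D32)// => H bH; apply: Pth.
  rewrite (comm _ (linear_on_DDs D)); first last.
  - by move=> i H i3 Di bH; apply: (DDs_th i3 Di bH).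
  - by move=> i H i3; apply: DDs_zz.
  rewrite (comm _ (linear_on_postcomp D T)); first last.
  - by move=> i H i3 Di bH; apply: (postcomp_th _ Di bH).
  - by move=> i H i3; apply: postcomp_zz.
  congr (iter _ _ (Ex 3 1 r.+1 _)); apply/funext => k.
  by congr (iter _ _ (Ex 3 2 r'.+1 _)); apply/funext => l; rewrite cov.
have [d1 d2 d3] := dz_ex3.
(* Without logarithms each D_i acts as d/dz_i. *)
have FTe m1 m2 m3 : T (F (ex3 m1 m2 m3)) = (m1 + 1)%:~R *: F (ex3 (m1 + 1) m2 m3)
    + (m2 + 1)%:~R *: F (ex3 m1 (m2 + 1) m3) + (m3 + 1)%:~R *: F (ex3 m1 m2 (m3 + 1)).
  have := congr1 (@^~ (ex3 m1 m2 m3)) FT; rewrite /postcomp => <-.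
  rewrite /DDs !serD /DD [F (_ + dl 1)]Fl1 ?[F (_ + dl 2)]Fl2 ?[F (_ + dl 3)]Fl3 //.
  by rewrite !scaler0 !addr0 d1 d2 d3 !ex3D !addr0.
(* At z_3 = 0 both exponentials reduce to 1 and the prefactor to z_1^(R - R2) z_2^R2. *)
have FL m1 m2 : F (ex3 m1 m2 0) = G 0%N 0%N (ex3 (m1 - (R - R2)%N%:Z) (m2 - R2%:Z) 0).
  have nzG k l := let: And4 g _ _ _ := supG k l in g.
  have nlG k l := let: And4 _ _ g _ := supG k l in g.
  have nlG2 k l := let: And4 _ _ _ g := supG k l in g.
  rewrite /F zz_low_r//; last first.
    by apply: nonneg_Ex => // k; apply: nonneg_iter_zz; apply: nonneg_Ex.
  rewrite d1 ex3Mn ex3N ex3D !mul0rn !oppr0 !addr0.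
  rewrite Ex_low//; first last.
  - by move=> k; apply: nonneg_iter_zz; apply: nonneg_Ex.
  - by move=> k; apply: nonneg_iter_zz; apply: nonneg_Ex.
  rewrite zz_low_r//; last exact: nonneg_Ex.
  rewrite d2 ex3Mn ex3N ex3D !mul0rn !oppr0 !addr0.
  by rewrite Ex_low// !pmulrn !intz.
have FR m : F (ex3 0 0 m) = (-1) ^+ R *: G' 0%N 0%N (ex3 0 0 (m - R%:Z)).
  have nzG1 k l := let: And5 g _ _ _ _ := supG' k l in g.
  have nzG2 k l := let: And5 _ g _ _ _ := supG' k l in g.
  have nlG k l := let: And5 _ _ _ _ g := supG' k l in g.
  rewrite F' zz_low_l//; last first.
    by apply: nonneg_Ex => // k; apply: nonneg_iter_zz; apply: nonneg_Ex.
  rewrite d3 ex3Mn ex3N ex3D !mul0rn !oppr0 !addr0.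
  rewrite Ex_low//; first last.
  - by move=> k; apply: nonneg_iter_zz; apply: nonneg_Ex.
  - by move=> k; apply: nonneg_iter_zz; apply: nonneg_Ex.
  rewrite zz_low_l//; last exact: nonneg_Ex.
  rewrite d3 ex3Mn ex3N ex3D !mul0rn !oppr0 !addr0.
  rewrite Ex_low// !pmulrn !intz scalerA -exprD subnK ?(leq_trans (leq_addl _ _) leR)//.
  by congr (_ *: G' _ _ (ex3 _ _ _)); lia.
(* These are the coefficients of [F] on z_1 = z_2; the range 0 <= m <= i suffices as no negative
   powers occur. D_1 + D_2 becomes the derivative on the diagonal: the weights m and i + 1 - m add
   up to i + 1. *)
exists (fun i j => \sum_(m < i.+1) F (ex3 m%:Z (i%:Z - m%:Z) j%:Z)); split.
- move=> i j; rewrite [RHS]linear_sum /=; under [RHS]eq_bigr => m _ do rewrite FTe.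
  rewrite !big_split /=; congr (_ + _); last first.
    rewrite scaler_sumr; apply: eq_bigr => m _.
    by rewrite pmulrn; congr (_%:~R *: F (ex3 _ _ _)); lia.
  pose f m := F (ex3 m%:Z (i.+1%:Z - m%:Z) j%:Z).
  have -> : \sum_(m < i.+1) (m%:Z + 1)%:~R *: F (ex3 (m%:Z + 1) (i%:Z - m%:Z) j%:Z)
      = \sum_(m < i.+2) m%:R *: f m.
    rewrite [RHS]big_ord_recl [X in _ = X + _]scale0r add0r; apply: eq_bigr => m _.
    by rewrite /f /= /bump leq0n pmulrn; congr (_%:~R *: F (ex3 _ _ _)); lia.
  have -> : \sum_(m < i.+1) (i%:Z - m%:Z + 1)%:~R *: F (ex3 m (i%:Z - m%:Z + 1) j%:Z)
      = \sum_(m < i.+2) (i.+1 - m)%:R *: f m.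
    rewrite [RHS]big_ord_recr /= subnn scale0r addr0; apply: eq_bigr => m _.
    by rewrite /f pmulrn; congr (_%:~R *: F (ex3 _ _ _)); have := ltn_ord m; lia.
  rewrite -big_split scaler_sumr; apply: eq_bigr => m _ /=.
  by rewrite -scalerDl -natrD subnKC //; have := ltn_ord m; rewrite ltnS.
- move=> i; rewrite sE (@zsumE _ (- (R - R2)%N%:Z) i.+1).
    apply: eq_bigr => m _; rewrite FL; congr (G _ _ (ex3 _ _ _)); lia.
  move=> m mi; have := FL (m + (R - R2)%N%:Z) (i%:Z - R%:Z - m + R2%:Z).
  rewrite !addrK => <-; case: mi => mi; [apply: F1|apply: F2]; rewrite /ex3 /=; lia.
- by move=> j; rewrite big_ord1 gE -FR.
Qed.

End SkewSymmetry.

(** * Functionals on tensor products *)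

(* The transpose of the operator [f] on formal sums, acting on functionals. *)
Definition pull (A B : Type) (W : nmodType) (f : A -> seq B) (F : B -> W) (x : A) : W :=
  \sum_(y <- f x) F y.

Lemma sum_fsum_ext (A B : Type) (W : nmodType) (f : A -> seq B) (F : B -> W) s :
  \sum_(y <- fsum_ext f s) F y = \sum_(x <- s) pull f F x.
Proof. by rewrite /fsum_ext big_flatten big_map. Qed.

Section Twist.
Context {K : fieldType} {U : superspaceType K}.
Implicit Types (u v : U).

Lemma ptwist_linear q k u v : ptwist q (k *: u + v) = k *: ptwist q u + ptwist q v.
Proof.
rewrite /ptwist !hcomp_is_linear !scalerDr !scalerA [_ ^+ q * k]mulrC.
by rewrite addrACA.
Qed.

Lemma hcomp_ptwist p q u : hcomp p (ptwist q u) = (-1) ^+ (p && q) *: hcomp p u.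
Proof.
rewrite /ptwist linearD linearZ /= !hcompE.
by case: p; case: q => /=; rewrite ?expr0 ?expr1 ?scaler0 ?addr0 ?add0r ?scale1r.
Qed.

Lemma ptwist_hcomp p q u : ptwist q (hcomp p u) = (-1) ^+ (p && q) *: hcomp p u.
Proof.
rewrite /ptwist !hcompE.
by case: p; case: q => /=; rewrite ?expr0 ?expr1 ?scaler0 ?addr0 ?add0r ?scale1r.
Qed.

Lemma ptwistC p q u : ptwist p (ptwist q u) = ptwist q (ptwist p u).
Proof.
rewrite {1}/ptwist [RHS]/ptwist !hcomp_ptwist /= !scalerA.
by congr (_ + _ *: _); case: p; case: q; rewrite /= ?expr0 ?expr1 ?mul1r ?mulr1.
Qed.

Lemma ptwist_homog_map p q (f : {linear U -> U}) u : homog_map p f ->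
  ptwist q (f u) = (-1) ^+ (p && q) *: f (ptwist q u).
Proof.
move=> hf.
have tw r v : hcomp r v = v -> ptwist q v = (-1) ^+ (r && q) *: v.
  by move=> hv; rewrite -{1}hv ptwist_hcomp hv.
rewrite -{1}(hcomp_sum u) linearD /= -[f (hcomp false u)]scale1r ptwist_linear scale1r.
rewrite (tw p (f (hcomp false u))) 1?(tw (~~ p) (f (hcomp true u))); first last.
- by apply: (hf false); rewrite /homog hcompE.
- by apply: (hf true); rewrite /homog hcompE.
rewrite /ptwist linearD linearZ /= scalerDr scalerA -exprD.
congr (_ + _ *: _).
by case: p {hf tw}; case: q; rewrite //= ?expr0 ?expr1 // expr2 mulrNN mulr1.
Qed.

End Twist.

Section Functionals.
Context {K : fieldType} {U : superspaceType K} {W : lmodType K}.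
Implicit Types (F : U * U -> W) (H : U * U * U -> W).

Definition lin2 F :=
  (forall k u v w, F (k *: u + v, w) = k *: F (u, w) + F (v, w)) /\
  (forall k u v w, F (w, k *: u + v) = k *: F (w, u) + F (w, v)).

Definition lin3 H :=
  (forall c, lin2 (fun y => H (y, c))) /\ (forall a, lin2 (fun y => H (a, y.1, y.2))).

Lemma lin2_0l F w : lin2 F -> F (0, w) = 0.
Proof. by case=> /(_ (-1) 0 0 w) + _; rewrite scaler0 addr0 scaleN1r addNr. Qed.

Lemma lin2_0r F w : lin2 F -> F (w, 0) = 0.
Proof. by case=> _ /(_ (-1) 0 0 w); rewrite scaler0 addr0 scaleN1r addNr. Qed.

Lemma lin2_Zl F k u w : lin2 F -> F (k *: u, w) = k *: F (u, w).
Proof.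
by move=> lF; have := lF.1 k u 0 w; rewrite addr0 => ->; rewrite lin2_0l ?addr0.
Qed.

Lemma lin2_Zr F k u w : lin2 F -> F (w, k *: u) = k *: F (w, u).
Proof.
by move=> lF; have := lF.2 k u 0 w; rewrite addr0 => ->; rewrite lin2_0r ?addr0.
Qed.

Lemma lin2_Dl F u v w : lin2 F -> F (u + v, w) = F (u, w) + F (v, w).
Proof. by move=> lF; rewrite -[u]scale1r lF.1 !scale1r. Qed.

Lemma lin2_Dr F u v w : lin2 F -> F (w, u + v) = F (w, u) + F (w, v).
Proof. by move=> lF; rewrite -[u]scale1r lF.2 !scale1r. Qed.

(** Bilinear functionals respect the congruence generated by multilinearity. All identities between
    formal sums are used through such functionals, so no quotient is ever formed. *)
Lemma lin2_tens F s t : lin2 F -> tens_eq s t -> \sum_(x <- s) F x = \sum_(x <- t) F x.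
Proof.
move=> lF; elim=> {s t} [s t st|s|s t _ ->|s t u _ -> _ ->|s s' t t' _ h _ h'|s t] //.
- case: st => [w|u u' w|u w w'|c u w]; rewrite !big_cons ?big_nil ?addr0.
  + exact: lin2_0l.
  + exact: lin2_Dl.
  + exact: lin2_Dr.
  + by rewrite lin2_Zl// lin2_Zr.
- by rewrite !big_cat /= h h'.
- by rewrite !big_cat /= addrC.
Qed.

Lemma lin3_tens H s t : lin3 H -> tens3_eq s t -> \sum_(x <- s) H x = \sum_(x <- t) H x.
Proof.
move=> [lH1 lH2]; elim=> {s t} [s t st|s|s t _ ->|s t u _ -> _ ->|s s' t t' _ h _ h'|s t] //.
- case: st => {s t} [s t x st|u s t st]; rewrite !big_map.
    by apply: (lin2_tens (lH1 x)); apply: fsum_gen.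
  by apply: (lin2_tens (lH2 u)); apply: fsum_gen.
- by rewrite !big_cat /= h h'.
- by rewrite !big_cat /= addrC.
Qed.

Definition lin_op (f : U * U -> seq (U * U)) := forall F, lin2 F -> lin2 (pull f F).

Lemma lin_op_te S : lin_op (te_op S).
Proof.
move=> F lF; split=> k u v w; rewrite /pull /te_op !big_map scaler_sumr -big_split;
  apply: eq_bigr => i _ /=.
  by rewrite ptwist_linear linearP lF.1.
by rewrite linearP lF.2.
Qed.

Lemma lin_op_flip : lin_op flip_op.
Proof.
move=> F lF; split=> k u v w; rewrite /pull /flip_op !big_map scaler_sumr -big_split;
  apply: eq_bigr => i _ /=.
  by rewrite ptwist_linear lF.2.
by rewrite linearP lF.1.
Qed.

Lemma pull12E f H a b c : pull (op12 f) H (a, b, c) = pull f (fun y => H (y, c)) (a, b).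
Proof. by rewrite /pull /op12 big_map. Qed.

Lemma pull23E f H a b c :
  pull (op23 f) H (a, b, c) = pull f (fun y => H (a, y.1, y.2)) (b, c).
Proof. by rewrite /pull /op23 big_map. Qed.

Lemma pull13E f H : pull (op13 f) H =1
  pull (op23 flip_op) (pull (op12 f) (pull (op23 flip_op) H)).
Proof. by move=> x; rewrite {1}/pull /op13 !sum_fsum_ext. Qed.

Lemma lin3_pull12 f H : lin_op f -> lin3 H -> lin3 (pull (op12 f) H).
Proof.
move=> lf [lH1 lH2]; split=> [c|a].
  have := lf _ (lH1 c); rewrite [X in lin2 X](_ : _ = (fun y => pull (op12 f) H (y, c)))//.
  by apply/funext => -[x y]; rewrite pull12E.
split=> k u v w /=; rewrite !pull12E.
  by rewrite (lf _ (lH1 w)).2.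
rewrite /pull scaler_sumr -big_split; apply: eq_bigr => -[x y] _.
exact: (lH2 x).2.
Qed.

Lemma lin3_pull23 f H : lin_op f -> lin3 H -> lin3 (pull (op23 f) H).
Proof.
move=> lf [lH1 lH2]; split=> [c|a]; last first.
  have := lf _ (lH2 a); rewrite [X in lin2 X](_ : _ = (fun y => pull (op23 f) H (a, y.1, y.2)))//.
  by apply/funext => -[x y]; rewrite pull23E.
split=> k u v w /=; rewrite !pull23E; last first.
  by rewrite (lf _ (lH2 w)).1.
rewrite /pull scaler_sumr -big_split; apply: eq_bigr => -[x y] _.
exact: (lH1 y).1.
Qed.

Lemma lin3_pull13 f H : lin_op f -> lin3 H -> lin3 (pull (op13 f) H).
Proof.
move=> lf lH; rewrite (_ : pull (op13 f) H = pull (op23 flip_op) (pull (op12 f) (pull (op23 flip_op) H))).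
  by apply: (lin3_pull23 lin_op_flip); apply: (lin3_pull12 lf); apply: (lin3_pull23 lin_op_flip).
by apply/funext => x; apply: pull13E.
Qed.

Lemma pull_flipK F x : lin2 F -> pull flip_op (pull flip_op F) x = F x.
Proof.
move=> lF; case: x => a b; rewrite /pull /flip_op /= !big_cons !big_nil !addr0 /=.
rewrite !hcomp_ptwist !ptwist_hcomp /= !expr0 !expr1 !scale1r.
rewrite lin2_Zl// lin2_Zr// scalerA mulrNN mulr1 scale1r.
by rewrite -!(lin2_Dl _ _ _ lF) hcomp_sum -(lin2_Dr _ _ _ lF) hcomp_sum.
Qed.

Lemma iter_pull12 f H k a b c :
  iter k (pull (op12 f)) H (a, b, c) = iter k (pull f) (fun y => H (y, c)) (a, b).
Proof.
elim: k a b => //= k IHk a b; rewrite pull12E.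
by apply: eq_bigr => -[x y] _; rewrite IHk.
Qed.

Lemma iter_pull23 f H k a b c :
  iter k (pull (op23 f)) H (a, b, c) = iter k (pull f) (fun y => H (a, y.1, y.2)) (b, c).
Proof.
elim: k b c => //= k IHk b c; rewrite pull23E.
by apply: eq_bigr => -[x y] _; rewrite IHk.
Qed.

(** Both flips must see the same parity component of c, so one index q remains and twists a and b
    simultaneously. *)
Lemma pull_flip12_23 H a b c : lin3 H ->
  pull (op23 flip_op) (pull (op12 flip_op) H) (a, b, c)
  = \sum_(q <- [:: false; true]) H (hcomp q c, ptwist q a, ptwist q b).
Proof.
move=> [lH1 lH2]; rewrite pull23E {1}/pull {1}/flip_op /= !big_cons big_nil /= !pull12E.
rewrite /pull /flip_op /= !big_cons !big_nil !addr0 /= !hcompE /=.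
by rewrite !(lin2_0l _ (lH1 _)) add0r addr0.
Qed.

(* Moving c through a (x) b commutes with the even operator S on a (x) b. *)
Lemma pull12_flip S H x : lin3 H ->
  pull (op12 (te_op S)) (pull (op23 flip_op) (pull (op12 flip_op) H)) x
  = pull (op23 flip_op) (pull (op12 flip_op) (pull (op23 (te_op S)) H)) x.
Proof.
move=> lH; case: x => [[a b] c]; rewrite pull12E.
rewrite pull_flip12_23; last by apply: lin3_pull23 => //; apply: lin_op_te.
rewrite /pull /te_op big_map.
under eq_bigr => i _ do rewrite -/(pull _ _ _) -/(pull (op23 _) _ _) pull_flip12_23//.
rewrite exchange_big; apply: eq_bigr => q _ /=; rewrite !big_map.
apply: eq_bigr => i _ /=.
rewrite (ptwist_homog_map _ _ (te_lhom i)) (ptwist_homog_map _ _ (te_rhom i)).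
have lq := lH.2 (hcomp q c).
have /= -> := lin2_Zl _ _ _ lq; have /= -> := lin2_Zr _ _ _ lq.
rewrite scalerA ptwistC -exprD; case: (te_par i && q); rewrite /= ?expr0 ?scale1r//.
by rewrite expr2 mulrNN mulr1 scale1r.
Qed.

End Functionals.

Section Restriction.
Context {K : fieldType} {U : superspaceType K} {W : lmodType K}.
Variables (A : set U) (S : even_tensor_end U).
Implicit Types (F : U * U -> W) (H : U * U * U -> W).
Hypothesis A_hcomp : forall q a, A a -> A (hcomp q a).
Hypothesis A_ptwist : forall q a, A a -> A (ptwist q a).
Hypothesis braidS : braiding_on A S.

Definition A2 (x : U * U) := A x.1 /\ A x.2.
Definition A3 (x : U * U * U) := [/\ A x.1.1, A x.1.2 & A x.2].

Definition stable (B C : eqType) (P : B -> Prop) (Q : C -> Prop) (f : B -> seq C) :=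
  forall x, P x -> forall y, y \in f x -> Q y.

(** The axioms on the braiding hold on [A] only, so an identity of functionals may be used under
    [pull] only if the operator keeps all factors in [A]. *)
Lemma eq_pull (B C : eqType) (P : B -> Prop) (Q : C -> Prop) (f : B -> seq C)
    (F G : C -> W) x :
  stable P Q f -> (forall y, Q y -> F y = G y) -> P x -> pull f F x = pull f G x.
Proof. by move=> sf FG Px; apply: eq_big_seq => y yf; apply/FG/(sf x). Qed.

Lemma stable_te : stable A2 A2 (te_op S).
Proof.
case: braidS => stS _ _ _ _ -[a b] [/= Aa Ab] y /mapP[i _ ->] /=; split=> /=.
  exact: (stS i _ (A_ptwist _ Aa)).1.
exact: (stS i _ Ab).2.
Qed.

Lemma stable_flip : stable A2 A2 flip_op.
Proof.
move=> [a b] [/= Aa Ab] y /mapP[q _ ->]; split=> /=; [exact: A_hcomp|exact: A_ptwist].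
Qed.

Lemma stable12 f : stable A2 A2 f -> stable A3 A3 (op12 f).
Proof.
move=> sf [[a b] c] [/= Aa Ab Ac] y /mapP[z zf ->].
by have [] := sf (a, b) _ z zf; split.
Qed.

Lemma stable23 f : stable A2 A2 f -> stable A3 A3 (op23 f).
Proof.
move=> sf [[a b] c] [/= Aa Ab Ac] y /mapP[z zf ->].
by have [] := sf (b, c) _ z zf; split.
Qed.

Lemma stable13 f : stable A2 A2 f -> stable A3 A3 (op13 f).
Proof.
move=> sf x Ax y; rewrite /op13 /fsum_ext => /flatten_mapP[z + zy].
move=> /flatten_mapP[w wx zw].
apply: (stable23 stable_flip) zy; apply: (stable12 sf) zw.
exact: (stable23 stable_flip) wx.
Qed.

Lemma pull_te_flip F x : lin2 F -> A2 x ->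
  pull flip_op (pull (te_op S) F) x = pull (te_op S) (pull flip_op F) x.
Proof.
move=> lF; case: x => a b [/= Aa Ab]; case: braidS => _ /(_ a b Aa Ab) h _ _ _.
by have := lin2_tens lF h; rewrite !sum_fsum_ext.
Qed.

Lemma pull_comm3 f g H x : commute3 A f g -> lin3 H -> A3 x ->
  pull f (pull g H) x = pull g (pull f H) x.
Proof.
move=> fg lH; case: x => [[a b] c] [/= Aa Ab Ac].
by have := lin3_tens lH (fg a b c Aa Ab Ac); rewrite !sum_fsum_ext.
Qed.

Lemma iter_comm3 (f g : U * U * U -> seq (U * U * U)) k l H x :
  stable A3 A3 f -> stable A3 A3 g ->
  (forall H', lin3 H' -> lin3 (pull f H')) -> (forall H', lin3 H' -> lin3 (pull g H')) ->
  (forall H' x', lin3 H' -> A3 x' -> pull f (pull g H') x' = pull g (pull f H') x') ->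
  lin3 H -> A3 x ->
  iter k (pull f) (iter l (pull g) H) x = iter l (pull g) (iter k (pull f) H) x.
Proof.
move=> sf sg lf lg fg lH.
have lfk k' : lin3 (iter k' (pull f) H) by elim: k' => //= k'; apply: lf.
have step l' H' x' : lin3 H' -> A3 x' ->
    pull f (iter l' (pull g) H') x' = iter l' (pull g) (pull f H') x'.
  move=> lH'; elim: l' x' => // l' IH x' Ax' /=; rewrite fg//.
    by apply: (eq_pull sg) Ax' => y; apply: IH.
  by elim: l' {IH} => //= l'; apply: lg.
elim: k x => // k IHk x Ax /=.
by rewrite -step//; apply: (eq_pull sf) Ax => y; apply: IHk.
Qed.

End Restriction.

(** * Two-variable series inside series in several variables *)

Section Lift.
Context {K : numFieldType} {V : lmodType K}.
Implicit Types (F : series2 V) (i j : nat).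

Definition extend4 F (m1 l1 m2 l2 : int) : V :=
  if l1 is Posz j1 then if l2 is Posz j2 then F m1 j1 m2 j2 else 0 else 0.

(** Such an [f] may involve the remaining variables but is constant for every shift in z_i, zeta_i,
    z_j, zeta_j, hence for z_ij, vartheta_ij and D_i. *)
Definition indep (X : Type) i j (f : expo -> X) :=
  forall e g, (forall k, k.1 != i -> k.1 != j -> g k = 0) -> f (e + g) = f e.

(* A series in two variables, read in z_i and z_j and followed by the operator
   [O]; both may depend on the remaining variables. *)
Definition lift2 i j (O : expo -> V -> V) (F : expo -> series2 V) : expo -> V :=
  fun e => O e (extend4 (F e) (e (zk i)) (e (lk i)) (e (zk j)) (e (lk j))).

Definition bnd2 F := exists M : int, forall m1 j1 m2 j2, m2 < M -> F m1 j1 m2 j2 = 0.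

Variables (i j : nat) (O : expo -> V -> V).
Hypothesis ij : i != j.
Hypothesis O_linear : forall e, linear (O e).
Hypothesis O_indep : indep i j O.

Let Opack e : {linear V -> V} := HB.pack (O e) (GRing.isLinear.Build K V V *:%R (O e) (@O_linear e)).

Let O0 e : O e 0 = 0. Proof. exact: (linear0 (Opack e)). Qed.
Let OD e u v : O e (u + v) = O e u + O e v. Proof. exact: (linearD (Opack e)). Qed.
Let OB e u v : O e (u - v) = O e u - O e v. Proof. exact: (linearB (Opack e)). Qed.
Let OZ e c v : O e (c *: v) = c *: O e v. Proof. by have := O_linear e c v 0; rewrite O0 !addr0. Qed.

Let dz_out i' k : i' \in [:: i; j] -> k.1 != i -> k.1 != j -> (dz i') k = 0.
Proof.
case: k => k b; rewrite deltaE xpair_eqE !inE /= => ii' ki kj.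
by case: eqP => // ki'; move: ii'; rewrite -ki' (negbTE ki) (negbTE kj).
Qed.

Let dl_out i' k : i' \in [:: i; j] -> k.1 != i -> k.1 != j -> (dl i') k = 0.
Proof.
case: k => k b; rewrite deltaE xpair_eqE !inE /= => ii' ki kj.
by case: eqP => // ki'; move: ii'; rewrite -ki' (negbTE ki) (negbTE kj).
Qed.

Lemma lift2_shift (F : expo -> series2 V) e g : indep i j F ->
  (forall k, k.1 != i -> k.1 != j -> g k = 0) ->
  lift2 i j O F (e + g) = O e (extend4 (F e) (e (zk i) + g (zk i)) (e (lk i) + g (lk i))
    (e (zk j) + g (zk j)) (e (lk j) + g (lk j))).
Proof. by move=> iF g0; rewrite /lift2 !expoD (O_indep _ g0) (iF _ _ g0). Qed.

Let i_in : i \in [:: i; j]. Proof. by rewrite inE eqxx. Qed.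
Let j_in : j \in [:: i; j]. Proof. by rewrite !inE eqxx orbT. Qed.
Let ji : (j == i) = false. Proof. by rewrite eq_sym (negbTE ij). Qed.

Lemma lift2_zz (F : expo -> series2 V) : indep i j F ->
  lift2 i j O (fun e => z12_mul (F e)) = zz i j (lift2 i j O F).
Proof.
move=> iF; apply/funext => e; rewrite zzE !lift2_shift// => [|k ki kj|k ki kj]; first last.
- by rewrite expoN dz_out ?oppr0.
- by rewrite expoN dz_out ?oppr0.
rewrite -OB /lift2 !expoN !deltaE !xpair_eqE !eqxx !andbF ji (negbTE ij) !oppr0 !addr0.
by congr (O e _); rewrite /extend4 /z12_mul; case: (e (lk i)) => // l; case: (e (lk j)) => //; rewrite subr0.
Qed.

Lemma lift2_Dz1 (F : expo -> series2 V) : indep i j F ->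
  lift2 i j O (fun e => Dz1 (F e)) = DD i (lift2 i j O F).
Proof.
move=> iF; apply/funext => e; rewrite /DD -[e + _ + _]addrA !lift2_shift// => [|k ki kj|k ki kj]; first last.
- exact: dz_out.
- by rewrite expoD dz_out// dl_out.
rewrite -!OZ -OD /lift2 !expoD !deltaE !xpair_eqE !eqxx !andbF ji !addr0 !add0r.
congr (O e _); rewrite /extend4 /Dz1; case: (e (lk i)) => [l|l]; last first.
  case: l => [|l]; first by rewrite (_ : Negz 0 + 1 = 0)// scale0r scaler0 addr0.
  by rewrite !scaler0 addr0.
by case: (e (lk j)) => l'; rewrite ?scaler0 ?addr0//= -PoszD addn1 pmulrn.
Qed.

Lemma lift2_swap (F : expo -> series2 V) :
  lift2 j i O F = lift2 i j O (fun e => swap12 (F e)).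
Proof.
apply/funext => e; rewrite /lift2 /extend4 /swap12.
by congr (O e _); case: (e (lk i)); case: (e (lk j)).
Qed.

Lemma lift2_th (F : expo -> series2 V) : indep i j F -> (forall e, bnd2 (F e)) ->
  lift2 i j O (fun e => theta12_mul (F e)) = th i j (lift2 i j O F).
Proof.
move=> iF bF; apply/funext => e; rewrite /th /La.
rewrite lift2_shift// => [|k ki kj]; last by rewrite expoN dl_out ?oppr0.
have [M FM] := bF e.
pose f n := extend4 (F e) (e (zk i) + n%:Z) (e (lk i)) (e (zk j) - n%:Z) (e (lk j)).
have shiftE n : lift2 i j O F (e - dir i j *+ n) = O e (f n).
  rewrite lift2_shift// => [|k ki kj]; last first.
    by rewrite /dir expoN expoMn expoD expoN !dz_out// subrr mul0rn oppr0.
  rewrite /dir !expoN !expoMn !expoD !expoN !deltaE !xpair_eqE !eqxx !andbF ji (negbTE ij).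
  by congr (O e (extend4 _ _ _ _ _)) => /=; lia.
have fM n : (absz (e (zk j) - M) + 1 <= n)%N -> f n = 0.
  move=> nM; rewrite /f /extend4; case: (e (lk i)) => // l; case: (e (lk j)) => // l'.
  by apply: FM; lia.
rewrite -[X in nsum X](_ : (fun n => Opack e (n%:R^-1 *: f n)) = _); last first.
  by apply/funext => n; rewrite shiftE linearZ.
rewrite [nsum _](@nsum_linear _ _ _ (Opack e)); last first.
  by exists (absz (e (zk j) - M) + 1)%N => n /fM ->; rewrite scaler0.
rewrite /= -OB; congr (O e _); rewrite !expoN !deltaE !xpair_eqE !eqxx !andbF ji.
rewrite !oppr0 !addr0 /extend4 /theta12_mul /nsum /f /extend4.
case: (e (lk i)) => [l|l]; last first.
  rewrite [Negz l + _](_ : _ = Negz l.+1) /=; last by lia.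
  by rewrite fsbig1 ?subr0// => n _; rewrite scaler0.
case: (e (lk j)) => l'; last first.
  by rewrite fsbig1 ?subr0 //; [case: l|move=> n _; rewrite scaler0].
congr (_ - _); first by case: l => // l; rewrite -addn1 PoszD addrK.
(* The sum in [La] has the additional index n = 0, whose coefficient 0^-1 is 0. *)
apply: fsbig_widen => // n /=; move=> [_ /negP]; rewrite -eqn0Ngt => /eqP ->.
by rewrite invr0 scale0r.
Qed.

Lemma lift2_sum (I : Type) (s : seq I) (c : I -> K) (F : I -> expo -> series2 V) :
  lift2 i j O (fun e m1 j1 m2 j2 => \sum_(x <- s) c x *: F x e m1 j1 m2 j2)
  = \sum_(x <- s) c x *: lift2 i j O (F x).
Proof.
apply/funext => e; elim: s => [|x s IHs].
  rewrite big_nil /lift2 /extend4; case: (e (lk i)) => l; rewrite ?O0//.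
  by case: (e (lk j)) => l'; rewrite ?big_nil ?O0.
rewrite big_cons serD -IHs serZ /lift2 /extend4.
case: (e (lk i)) => l; last by rewrite !O0 scaler0 addr0.
case: (e (lk j)) => l'; last by rewrite !O0 scaler0 addr0.
by rewrite big_cons OD OZ.
Qed.

End Lift.

(** * Locality of fields *)

Section Fields.
Context {K : numFieldType} {V : lmodType K}.
Implicit Types (a b : LF V) (i j : nat).

Definition lfc a v (m l : int) : V := if l is Posz j then a v m j else 0.

Definition fld a i (e : expo) v := lfc a v (e (zk i)) (e (lk i)).

Lemma lfc_linear a m l : linear (fun v => lfc a v m l).
Proof. by move=> k u v; case: l => l /=; rewrite ?LF_linearE ?scaler0 ?addr0. Qed.

Lemma fld_linear a i e : linear (fld a i e).
Proof. exact: lfc_linear. Qed.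

Lemma lfc0 a m l : lfc a 0 m l = 0.
Proof. by have := lfc_linear a m l (-1) 0 0; rewrite scaler0 addr0 scaleN1r addNr. Qed.

Lemma fld0 a i e : fld a i e 0 = 0.
Proof. exact: lfc0. Qed.

Lemma lfc_linear_l k a b v m l : lfc (k *: a + b) v m l = k *: lfc a v m l + lfc b v m l.
Proof. by case: l => l //=; rewrite scaler0 addr0. Qed.

Lemma lfc_bound a v : exists M : int, forall m l, m < M -> lfc a v m l = 0.
Proof.
have [M [J aP]] := (LFP a).2 v; exists M => m [l|l] mM //=.
by apply: aP; left.
Qed.

(** Two neighbouring fields inside a longer product: [O] stands for the fields to their left, [v]
    for the vector produced by those to their right. *)
Definition pfun i j (O : expo -> V -> V) (v : expo -> V) (x : LF V * LF V) : expo -> V :=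
  fun e => O e (fld x.1 i e (fld x.2 j e (v e))).

End Fields.

Section Transport.
Context {K : numFieldType} {V : superspaceType K}.
Variable S : even_tensor_end (LF V).
Implicit Types (a b : LF V) (s : seq (LF V * LF V)) (i j : nat)
  (O : expo -> V -> V).

Lemma sum_te_iter (W : nmodType) l s (F : LF V * LF V -> W) :
  \sum_(x <- te_iter S l s) F x = \sum_(x <- s) iter l (pull (te_op S)) F x.
Proof.
elim: l F => // l IHl F; rewrite [te_iter _ _ _]iterS sum_fsum_ext.
by rewrite -/(te_iter S l s) IHl -iterSr.
Qed.

Lemma te_nilpotent (W : lmodType K) r l x (F : LF V * LF V -> W) :
  tens_eq (te_iter S r [:: x]) [::] -> (r <= l)%N -> lin2 F ->
  iter l (pull (te_op S)) F x = 0.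
Proof.
move=> r0 /subnK <- lF; have : tens_eq (te_iter S (l - r + r) [:: x]) [::].
  by elim: (l - r)%N => // n IHn; apply: (te_op_eq S IHn).
by move/(lin2_tens lF); rewrite big_nil sum_te_iter big_seq1.
Qed.

Lemma mu12_bnd2 s v : bnd2 (mu12 s v).
Proof.
elim: s => [|x s [M IHs]]; first by exists 0 => *; rewrite /mu12 big_nil.
have [M' [J xP]] := (LFP x.2).2 v; exists (Order.min M M') => m1 j1 m2 j2.
rewrite lt_min => /andP[mM mM']; rewrite /mu12 big_cons.
rewrite xP; last by left.
rewrite -[x.1 0 m1 j1]/(lfc x.1 0 m1 j1%:Z) lfc0 add0r.
exact: (IHs m1 j1 m2 j2).
Qed.

Lemma theta_bnd2 (F : series2 V) : bnd2 F -> bnd2 (theta12_mul F).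
Proof.
move=> [M FM]; exists M => m1 j1 m2 j2 mM; rewrite /theta12_mul fsbig1 ?subr0.
  by case: j1 => // j1; apply: FM.
by move=> n _; rewrite FM ?scaler0//; apply: le_lt_trans mM; rewrite gerBl.
Qed.

Lemma lift2_pfun i j O v s : (forall e, linear (O e)) ->
  lift2 i j O (fun e => mu12 s (v e)) = \sum_(x <- s) pfun i j O v x.
Proof.
move=> lO; transitivity (lift2 i j O (fun e m1 j1 m2 j2 =>
    \sum_(x <- s) (1 : K) *: x.1 (x.2 (v e) m2 j2) m1 j1)).
  congr lift2; apply/funext => e; rewrite /mu12; do 4 apply/funext => ?.
  by apply: eq_bigr => x _; rewrite scale1r.
rewrite [LHS](lift2_sum i j lO s (fun=> 1)
  (fun (x : LF V * LF V) e m1 j1 m2 j2 => x.1 (x.2 (v e) m2 j2) m1 j1)).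
apply: eq_bigr => x _; rewrite scale1r; apply/funext => e.
rewrite /lift2 /pfun /fld; congr (O e _); rewrite /extend4 /lfc.
case: (e (lk i)) => // l; case: (e (lk j)) => // l'.
by rewrite -[RHS]/(lfc x.1 0 _ l%:Z) lfc0.
Qed.

Lemma exp_mu12E r s v : (forall l, (r <= l)%N -> mu12 (te_iter S l s) v = fun _ _ _ _ => 0) ->
  exp_mu12 S s v = fun m1 j1 m2 j2 => \sum_(l < r)
    l`!%:R^-1 *: iter l theta12_mul (mu12 (te_iter S l s) v) m1 j1 m2 j2.
Proof.
move=> s0; do 4 apply/funext => ?; apply: nsumE => l rl; rewrite s0//.
rewrite (_ : iter l _ _ = fun _ _ _ _ => 0) ?scaler0//.
elim: (l) => //= n ->; do 4 apply/funext => ?.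
rewrite /theta12_mul fsbig1 => [|k _]; last by rewrite scaler0.
by rewrite subr0; match goal with |- context [match ?x with _ => _ end] => case: x end.
Qed.

Lemma exp_mu12_bnd2 r s v : (forall l, (r <= l)%N -> mu12 (te_iter S l s) v = fun _ _ _ _ => 0) ->
  bnd2 (exp_mu12 S s v).
Proof.
move=> s0; rewrite (exp_mu12E s0).
have bl l : bnd2 (iter l theta12_mul (mu12 (te_iter S l s) v)).
  by elim: {1}l => [|n IHn] /=; [exact: mu12_bnd2|exact: theta_bnd2].
elim: r {s0} => [|r [M IHr]]; first by exists 0 => *; rewrite big_ord0.
have [M' rM'] := bl r; exists (Order.min M M') => m1 j1 m2 j2.
by rewrite lt_min => /andP[mM mM']; rewrite big_ord_recr /= IHr// rM'// scaler0 addr0.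
Qed.

Lemma lift2_exp_mu12 r i j O v s : i != j -> (forall e, linear (O e)) ->
  indep i j O -> indep i j v ->
  (forall l w, (r <= l)%N -> mu12 (te_iter S l s) w = fun _ _ _ _ => 0) ->
  lift2 i j O (fun e => exp_mu12 S s (v e))
  = Ex i j r (fun l => \sum_(x <- te_iter S l s) pfun i j O v x).
Proof.
move=> ij lO iO iv s0.
pose Th l e := iter l theta12_mul (mu12 (te_iter S l s) (v e)).
transitivity (lift2 i j O (fun e m1 j1 m2 j2 => \sum_(l <- index_enum 'I_r)
   (l`!%:R^-1 : K) *: Th l e m1 j1 m2 j2)).
  by congr lift2; apply/funext => e; rewrite (exp_mu12E (fun l => s0 l (v e))).
rewrite [LHS](lift2_sum i j lO _ _ (fun l : 'I_r => Th l)); apply: eq_bigr => l _; congr (_ *: _).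
rewrite /Th -(lift2_pfun _ _ _ _ lO).
elim: {1 3}(val l) => //= n <-; rewrite -(lift2_th ij lO iO)// => [e g g0|e].
  by rewrite iv.
by elim: n => [|n IHn] /=; [exact: mu12_bnd2|exact: theta_bnd2].
Qed.

Lemma indep_comp i j (X Y : Type) (f : X -> Y) (v : expo -> X) :
  indep i j v -> indep i j (fun e => f (v e)).
Proof. by move=> iv e g g0; rewrite iv. Qed.

Lemma lift2_iter_zz i j O (F : expo -> series2 V) M : i != j -> (forall e, linear (O e)) ->
  indep i j O -> indep i j F ->
  lift2 i j O (fun e => iter M z12_mul (F e)) = iter M (zz i j) (lift2 i j O F).
Proof.
move=> ij lO iO iF; elim: M => //= M <-; rewrite (lift2_zz ij lO iO)//.
by move=> e g g0; rewrite (iF _ _ g0).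
Qed.

Lemma lin2_pfun i j O v : (forall e, linear (O e)) -> lin2 (pfun i j O v).
Proof.
move=> lO; split=> k a b c; apply/funext => e; rewrite serD serZ /pfun /fld /= lfc_linear_l ?lO//.
by rewrite lfc_linear lO.
Qed.

Lemma lin2_mu12 v m1 j1 m2 j2 : lin2 (fun x : LF V * LF V => x.1 (x.2 v m2 j2) m1 j1).
Proof.
split=> k a b c.
  exact: (lfc_linear_l k a b (c v m2 j2) m1 j1%:Z).
have h := lfc_linear_l k a b v m2 j2%:Z.
rewrite [LHS](_ : _ = lfc c (lfc (k *: a + b) v m2 j2%:Z) m1 j1%:Z)//.
by rewrite h lfc_linear.
Qed.

Variable A : set (LF V).
Hypothesis A_hcomp : forall q a, A a -> A (hcomp q a).
Hypothesis A_ptwist : forall q a, A a -> A (ptwist q a).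
Hypothesis braidS : braiding_on A S.

Lemma iter_te_flip (W : lmodType K) l (F : LF V * LF V -> W) x : lin2 F -> A2 A x ->
  pull flip_op (iter l (pull (te_op S)) F) x = iter l (pull (te_op S)) (pull flip_op F) x.
Proof.
move=> lF; elim: l x => // l IHl x Ax /=; rewrite (pull_te_flip braidS)//; last first.
  by elim: l {IHl} => //= l; apply: lin_op_te.
by apply: (eq_pull (stable_te A_ptwist braidS)) Ax => y; apply: IHl.
Qed.

(** Locality is applied to the vector [v e] for each exponent of the remaining variables, and then
    composed with [O]. Because S commutes with the flip, both sides can be written with powers of S
    acting on the same a (x) b. *)
Lemma locality_series i j O v a b N r M R : i != j -> (forall e, linear (O e)) ->
  indep i j O -> indep i j v -> A a -> A b ->
  local_order S a b N -> tens_eq (te_iter S r [:: (a, b)]) [::] ->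
  (N <= M)%N -> (r <= R)%N ->
  iter M (zz i j) (Ex i j R (fun l => iter l (pull (te_op S)) (pfun i j O v) (a, b)))
  = iter M (zz i j) (Ex j i R (fun l =>
      iter l (pull (te_op S)) (pull flip_op (pfun j i O v)) (a, b))).
Proof.
move=> ij lO iO iv Aa Ab loc r0 NM rR.
have ji : j != i by rewrite eq_sym.
have indepC (X : Type) (f : expo -> X) : indep i j f -> indep j i f.
  by move=> f0 e g g0; apply: f0 => k ki kj; apply: g0.
have nil0 l w : (R <= l)%N -> mu12 (te_iter S l [:: (a, b)]) w = fun _ _ _ _ => 0.
  move=> Rl; do 4 apply/funext => ?; rewrite /mu12 sum_te_iter big_seq1.
  exact: (te_nilpotent r0 (leq_trans rR Rl) (lin2_mu12 _ _ _ _ _)).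
have nil1 l w : (R <= l)%N -> mu12 (te_iter S l (flip_op (a, b))) w = fun _ _ _ _ => 0.
  move=> Rl; do 4 apply/funext => ?; rewrite /mu12 sum_te_iter.
  rewrite -/(pull _ _ _) iter_te_flip//; last exact: lin2_mu12.
  apply: (te_nilpotent r0 (leq_trans rR Rl)).
  exact/lin_op_flip/lin2_mu12.
have -> : (fun l => iter l (pull (te_op S)) (pfun i j O v) (a, b))
    = fun l => \sum_(x <- te_iter S l [:: (a, b)]) pfun i j O v x.
  by apply/funext => l; rewrite sum_te_iter big_seq1.
have -> : (fun l => iter l (pull (te_op S)) (pull flip_op (pfun j i O v)) (a, b))
    = fun l => \sum_(x <- te_iter S l (flip_op (a, b))) pfun j i O v x.
  apply/funext => l; rewrite sum_te_iter -/(pull _ _ _) iter_te_flip//.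
  exact: lin2_pfun.
rewrite -(lift2_exp_mu12 ij lO iO iv nil0).
rewrite -(lift2_exp_mu12 ji lO (indepC _ _ iO) (indepC _ _ iv) nil1).
rewrite -(lift2_iter_zz M ij lO iO (indep_comp (exp_mu12 S [:: (a, b)]) iv)).
have /= swapE := lift2_iter_zz M ij lO iO
  (indep_comp (fun w => swap12 (exp_mu12 S (flip_op (a, b)) w)) iv).
rewrite [X in _ = iter M _ X]lift2_swap -swapE.
congr lift2; apply/funext => e; have := loc (v e).
by rewrite -(subnK NM) !iterD => ->.
Qed.

End Transport.

Section MoreDerivations.
Context {K : numFieldType} {V : lmodType K}.
Implicit Types (G : expo -> V) (D : set expo) (i j k l : nat).

Lemma DD_DD k l G : DD k (DD l G) = DD l (DD k G).
Proof.
have [->//|kl] := eqVneq k l.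
apply/funext => e; rewrite /DD !expoD !deltaE !xpair_eqE !andbF !andbT eq_sym (negbTE kl) !addr0.
rewrite !scalerDr !scalerA [RHS]addrACA.
congr (_ *: G _ + _ *: G _ + (_ *: G _ + _ *: G _)); by [exact: mulrC|expo_solve].
Qed.

Lemma DDs_zz12 G : DDs (zz 1 2 G) = zz 1 2 (DDs G).
Proof.
rewrite /DDs !DD_zz (zzD _ _ (DD 1 G + DD 2 G))
  (zzD _ _ (DD 1 G)) /= ?(subr0, sub0r, scale0r, addr0) scale1r scaleN1r.
by rewrite [X in X + _]addrACA subrr addr0.
Qed.

Lemma DDs_th12 D G : D (dir 1 2) -> bdd D G -> DDs (th 1 2 G) = th 1 2 (DDs G).
Proof.
move=> Dd bG; have bD k := bdd_DD k bG; have i12 : 1%N != 2%N by [].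
rewrite /DDs !(DD_th _ i12 Dd bG) (thD Dd (bddD (bD 1%N) (bD 2%N)) (bD 3%N)) (thD Dd (bD 1%N) (bD 2%N)).
rewrite /= ?(subr0, sub0r, scale0r, addr0) scale1r scaleN1r.
by rewrite [X in X + _]addrACA subrr addr0.
Qed.

Lemma DDs_DD k G : DDs (DD k G) = DD k (DDs G).
Proof.
by rewrite /DDs (DDD _ (DD 1 G + DD 2 G)) (DDD _ (DD 1 G)) (DD_DD 1) (DD_DD 2) (DD_DD 3).
Qed.

Lemma postcomp_DD (T : {linear V -> V}) k G : postcomp T (DD k G) = DD k (postcomp T G).
Proof. by apply/funext => e; rewrite /postcomp /DD linearD !linearZ. Qed.

(** In the absence of logarithms this is (d/dz)^p z^(q+p) = (q+p)!/q! z^q, with the denominator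
    cleared. *)
Lemma iter_DD1 p q m2 m3 G : zero_exp (lk 1) G ->
  q`!%:R *: iter p (DD 1) G (ex3 q%:Z m2 m3) = (q + p)`!%:R *: G (ex3 (q + p)%N%:Z m2 m3).
Proof.
elim: p G => [|p IHp] G G0; first by rewrite addn0.
rewrite iterSr IHp; last exact: zero_exp_DD.
have [d1 _ _] := dz_ex3; rewrite /DD [X in _ + _ *: X]G0 ?scaler0 ?addr0; last first.
  by rewrite !expoD /ex3 !deltaE.
rewrite d1 ex3D !addr0 scalerA addnS factS natrM.
congr (_ *: G (ex3 _ _ _)); last by lia.
by rewrite mulrC /ex3 /= -PoszD addn1 pmulrn.
Qed.

Lemma Ex1 i j (x : nat -> expo -> V) : Ex i j 1 x = x 0%N.
Proof. by rewrite /Ex big_ord1 /= invr1 scale1r. Qed.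

End MoreDerivations.

Section Superspace.
Context {K : numFieldType} {V : superspaceType K}.

Lemma ptwist_lfc q (a : LF V) v m l :
  ptwist q (lfc a v m l) = lfc (ptwist q a) (ptwist q v) m l.
Proof.
case: l => l; last by rewrite /ptwist /= !linear0 addr0.
have -> : lfc (ptwist q a) (ptwist q v) m l =
    LF_comp_coef false a (ptwist q v) m l + (-1) ^+ q *: LF_comp_coef true a (ptwist q v) m l.
  by [].
rewrite /LF_comp_coef !hcomp_ptwist /= expr0 !scale1r.
have aZ k w : a (k *: w) m l = k *: a w m l.
  by have := LF_linearE a k w 0 m l; rewrite -[a 0 m l]/(lfc a 0 m l%:Z) lfc0 !addr0.
have aD : a v m l = a (hcomp false v) m l + a (hcomp true v) m l.
  by have := LF_linearE a 1 (hcomp false v) (hcomp true v) m l; rewrite !scale1r hcomp_sum.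
have hZ p k (w : V) : hcomp p (k *: w) = k *: hcomp p w by rewrite linearZ.
rewrite aZ !hZ /ptwist aD !linearD /= scalerA.
have -> : (-1) ^+ q * (-1) ^+ q = 1 :> K by case: (q); rewrite ?mulr1 // expr1 mulrNN mulr1.
rewrite scale1r.
rewrite [X in _ = _ + X]addrC [RHS]addrACA; congr (_ + _); exact: addrC.
Qed.

Lemma homog_map_even (W : superspaceType K) (f : {linear V -> W}) q v :
  homog_map false f -> hcomp q (f v) = f (hcomp q v).
Proof.
move=> hf; have h p : hcomp p (f (hcomp p v)) = f (hcomp p v).
  by have := hf p (hcomp p v); rewrite addbF; apply; rewrite /homog hcompE eqxx.
rewrite -{1}(hcomp_sum v) !linearD /= -(h false) -(h true) !hcompE.
by case: q; rewrite /= ?addr0 ?add0r h.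
Qed.

Lemma ptwist_even (W : superspaceType K) (f : {linear V -> W}) q v :
  homog_map false f -> ptwist q (f v) = f (ptwist q v).
Proof. by move=> hf; rewrite /ptwist !(homog_map_even _ _ hf) linearD linearZ. Qed.

End Superspace.

(** * Products of three fields *)

Section ThreeFields.
Context {K : numFieldType} {V : superspaceType K}.
Variables (vac : V) (T : {linear V -> V}).
Implicit Types (x : LF V * LF V * LF V) (i j k : nat).

(* a(z_i) b(z_j) c(z_k) applied to the vacuum, for x = (a, b, c). *)
Definition prod3 i j k x : expo -> V :=
  fun e => fld x.1.1 i e (fld x.1.2 j e (fld x.2 k e vac)).

Lemma prod3E i j k x e :
  prod3 i j k x e = fld x.1.1 i e (fld x.1.2 j e (fld x.2 k e vac)).
Proof. by []. Qed.

Definition dirs i j k : set expo :=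
  [set d | d = dir i j \/ d = dir i k \/ d = dir j k].

Lemma cone_dirs i j k n g : cone (dirs i j k) n g -> exists n1 n2 n3,
  n = (n1 + n2 + n3)%N /\ g = dir i j *+ n1 + dir i k *+ n2 + dir j k *+ n3.
Proof.
elim=> [|{}n {}g d dD _ [n1 [n2 [n3 [-> ->]]]]]; first by exists 0%N, 0%N, 0%N; rewrite !addr0.
case: dD => [|[|]] ->.
- by exists n1.+1, n2, n3; split; [lia|rewrite !mulrS; expo_solve].
- by exists n1, n2.+1, n3; split; [lia|rewrite !mulrS; expo_solve].
- by exists n1, n2, n3.+1; split; [lia|rewrite !mulrS; expo_solve].
Qed.

(** The exponent of z_k drops by n2 + n3 and is bounded below on the vacuum, so n2 + n3 takes
    finitely many values. For each of them the vector to which the middle field applies is fixed,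
    and a common bound [B] for these vectors limits n1. *)
Lemma bdd_prod3 i j k x : uniq [:: i; j; k] -> bdd (dirs i j k) (prod3 i j k x).
Proof.
rewrite /= !inE negb_or andbT => /andP[/andP[ij ik] jk] e.
have [Mc cM] := lfc_bound x.2 vac.
pose s0 := (absz (e (zk k) - Mc)%R + 1)%N.
pose w s := lfc x.2 vac (e (zk k) - s%:Z) (e (lk k)).
have [B bB] : exists B : int, forall s m l, (s < s0)%N -> m < B -> lfc x.1.2 (w s) m l = 0.
  elim: s0 => [|s [B IHs]]; first by exists 0.
  have [B' sB'] := lfc_bound x.1.2 (w s); exists (Order.min B B') => s' m l.
  rewrite lt_min ltnS leq_eqVlt => /predU1P[->|ss] /andP[mB mB'].
    exact: sB'.
  exact: IHs.
(* One [s0] accounts for n2 + n3 < s0, the other for the n3 steps by which z_j / z_i may be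
   compensated in the exponent e_j - n1 + n3 of z_j. *)
exists (2 * s0 + absz (e (zk j)) + absz B + 1)%N => n g /cone_dirs[n1 [n2 [n3 [-> ->]]]] ng.
have ek b : (e - (dir i j *+ n1 + dir i k *+ n2 + dir j k *+ n3)) (k, b) =
    e (k, b) - (if b then 0 else (n2 + n3)%:Z).
  rewrite expoD expoN !expoD !expoMn /dir !expoD !expoN !deltaE !xpair_eqE !eqxx.
  rewrite ![k == _]eq_sym (negbTE ik) (negbTE jk) /=.
  by case: b; rewrite /= ?mulrS; lia.
rewrite /prod3 /fld !ek subr0.
have [s_ge|s_lt] := leqP s0 (n2 + n3).
  by rewrite cM ?lfc0//; lia.
rewrite -/(w _) bB ?lfc0//.
rewrite expoD expoN !expoD !expoMn /dir !expoD !expoN !deltaE !xpair_eqE !eqxx.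
rewrite [j == i]eq_sym (negbTE ij) (negbTE jk) /=; lia.
Qed.

Lemma nonneg_lk_prod3 i j k x p : p \in [:: i; j; k] -> nonneg (lk p) (prod3 i j k x).
Proof.
have neg (a : LF V) w m l : l < 0 -> lfc a w m l = 0 by case: l.
move=> + e ep; rewrite /prod3 !inE => /or3P[] /eqP pE; rewrite pE in ep.
- exact: neg.
- by rewrite [fld x.1.2 _ _ _]neg ?fld0.
- by rewrite [fld x.2 _ _ _]neg ?fld0.
Qed.

Definition creating (a : LF V) := forall m l, m < 0 \/ l != 0 -> lfc a vac m l = 0.

Lemma nonneg_prod3 i j k x : creating x.2 -> nonneg (zk k) (prod3 i j k x).
Proof.
by move=> cx e ek; rewrite /prod3 [fld x.2 _ _ _]cx ?fld0//; left.
Qed.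

Lemma zero_exp_prod3 i j k x : creating x.2 -> zero_exp (lk k) (prod3 i j k x).
Proof.
by move=> cx e ek; rewrite /prod3 [fld x.2 _ _ _]cx ?fld0//; right.
Qed.

Lemma lin3_prod3 i j k : lin3 (prod3 i j k).
Proof.
split=> a; split=> c b d f; apply/funext => e; rewrite serD serZ /prod3 /fld /=.
- by rewrite lfc_linear_l.
- by rewrite lfc_linear_l lfc_linear.
- by rewrite lfc_linear_l lfc_linear.
- by rewrite lfc_linear_l !lfc_linear.
Qed.

Definition covariant (a : LF V) := forall w m l,
  T (lfc a w m l) = lfc a (T w) m l
    + ((m + 1)%:~R *: lfc a w (m + 1) l + (l + 1)%:~R *: lfc a w (m + 1) (l + 1)).

Lemma covariantP a : LF_ad T a = Dz a -> covariant a.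
Proof.
move=> Ta w m [l|l].
  have := congr1 (fun b : LF V => b w m l) Ta.
  rewrite -[LHS]/(T (a w m l) - a (T w) m l).
  rewrite -[RHS]/((m + 1)%:~R *: a w (m + 1) l + l.+1%:R *: a w (m + 1) l.+1).
  by move/eqP; rewrite subr_eq addrC => /eqP -> /=; rewrite -!PoszD addn1 pmulrn.
rewrite /= linear0 scaler0 !add0r; case: l => [|l]; last by rewrite scaler0.
by rewrite (_ : Negz 0 + 1 = 0) ?scale0r.
Qed.

(** By covariance [T] passes through the fields, leaving one derivation for each, and finally kills
    the vacuum. *)
Lemma DD_prod3 i j k x : uniq [:: i; j; k] -> T vac = 0 ->
  covariant x.1.1 -> covariant x.1.2 -> covariant x.2 ->
  DD i (prod3 i j k x) + (DD j (prod3 i j k x) + DD k (prod3 i j k x))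
  = postcomp T (prod3 i j k x).
Proof.
rewrite /= !inE negb_or andbT => /andP[/andP[ij ik] jk] T0 c1 c2 c3.
apply/funext => e; rewrite !serD /postcomp /DD /prod3 /fld.
rewrite !expoD !deltaE !xpair_eqE !eqxx !andbF.
rewrite ![j == i]eq_sym ![k == i]eq_sym ![k == j]eq_sym (negbTE ij) (negbTE ik) (negbTE jk) /=.
rewrite !addr0 ?add0r c1 c2 c3 T0 lfc0 add0r.
set f1 := lfc x.1.1; set f2 := lfc x.1.2.
have lD1 u v m l : f1 (u + v) m l = f1 u m l + f1 v m l.
  by have := lfc_linear x.1.1 m l 1 u v; rewrite !scale1r.
have lZ1 c v m l : f1 (c *: v) m l = c *: f1 v m l.
  by have := lfc_linear x.1.1 m l c v 0; rewrite lfc0 !addr0.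
have lD2 u v m l : f2 (u + v) m l = f2 u m l + f2 v m l.
  by have := lfc_linear x.1.2 m l 1 u v; rewrite !scale1r.
have lZ2 c v m l : f2 (c *: v) m l = c *: f2 v m l.
  by have := lfc_linear x.1.2 m l c v 0; rewrite lfc0 !addr0.
rewrite !(lD2, lD1, lZ2, lZ1) addrC; congr (_ + _); exact: addrC.
Qed.

Lemma DDs_prod3 i j k x : perm_eq [:: i; j; k] [:: 1; 2; 3]%N -> T vac = 0 ->
  covariant x.1.1 -> covariant x.1.2 -> covariant x.2 ->
  DDs (prod3 i j k x) = postcomp T (prod3 i j k x).
Proof.
move=> pm T0 c1 c2 c3; rewrite -DD_prod3//; last by rewrite (perm_uniq pm).
set F := prod3 _ _ _ _.
have : \sum_(p <- [:: i; j; k]) DD p F = \sum_(p <- [:: 1; 2; 3]%N) DD p F by apply: perm_big.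
by rewrite !big_cons !big_nil !addr0 => ->; rewrite /DDs -(addrA (DD 1 F)).

Qed.

(** Support conditions and translation covariance are closed under sums, so they need checking only
    on pure tensors of an ordered product, before any flip or braiding. *)
Lemma pull_ind (B : eqType) (P : (expo -> V) -> Prop) (Q : B -> Prop)
    (f : B -> seq B) (H : B -> expo -> V) :
  P 0 -> (forall G G', P G -> P G' -> P (G + G')) -> stable Q Q f ->
  (forall y, Q y -> P (H y)) -> forall n z, Q z -> P (iter n (pull f) H z).
Proof.
move=> P0 PD sf PH; elim=> [|n IHn] z Qz /=; first exact: PH.
rewrite /pull big_seq_cond; apply: (big_rec P) => // y G /andP[yz _] PG.
by apply: PD => //; apply/IHn/(sf z).
Qed.

End ThreeFields.

Section LocalPairs.
Context {K : numFieldType} {V : superspaceType K}.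
Variables (vac : V) (S : even_tensor_end (LF V)) (A : set (LF V)).
Hypothesis A_hcomp : forall q a, A a -> A (hcomp q a).
Hypothesis A_ptwist : forall q a, A a -> A (ptwist q a).
Hypothesis braidS : braiding_on A S.
Hypothesis localS : is_local S A.
Local Notation prod3 := (prod3 vac).
Local Notation s12 := (pull (op12 (te_op S))).
Local Notation s23 := (pull (op23 (te_op S))).
Local Notation flip12 := (pull (op12 (@flip_op K (LF V)))).
Local Notation flip23 := (pull (op23 (@flip_op K (LF V)))).
Implicit Types (p q i j k l : nat) (x y : LF V * LF V * LF V).
Implicit Types (H : LF V * LF V * LF V -> expo -> V).

(* Locality of the two orderings h and h', where h l and h' l involve the l-th
   power of the braiding. *)
Definition Eqv p q (h h' : nat -> expo -> V) := exists M R, forall M' R',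
  (M <= M')%N -> (R <= R')%N ->
  iter M' (zz p q) (Ex p q R' h) = iter M' (zz p q) (Ex q p R' h').

Lemma Eqv_sum D D' p q (I : eqType) (s : seq I) (h h' : nat -> I -> expo -> V) :
  D (dir p q) -> D' (dir q p) ->
  (forall l a, bdd D (h l a)) -> (forall l a, bdd D' (h' l a)) ->
  (forall a, a \in s -> Eqv p q (h^~ a) (h'^~ a)) ->
  Eqv p q (fun l => \sum_(a <- s) h l a) (fun l => \sum_(a <- s) h' l a).
Proof.
move=> Dd Dd' bh bh' E.
have [M [R MR]] : exists M R, forall a M' R', a \in s -> (M <= M')%N -> (R <= R')%N ->
    iter M' (zz p q) (Ex p q R' (h^~ a)) = iter M' (zz p q) (Ex q p R' (h'^~ a)).
  elim: s E => [|a s IHs] E; first by exists 0%N, 0%N.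
  have [M [R MR]] := E a (mem_head _ _).
  have [b bs|M' [R' MR']] := IHs; first by apply: E; rewrite inE bs orbT.
  exists (maxn M M'), (maxn R R') => b m r.
  by rewrite inE !geq_max => /predU1P[->|bs] /andP[? ?] /andP[? ?]; [apply: MR|apply: MR'].
exists M, R => M' R' leM leR.
rewrite (Ex_sum _ _ Dd)// (Ex_sum _ _ Dd')//.
have zzs (F : I -> expo -> V) : iter M' (zz p q) (\sum_(a <- s) F a) =
    \sum_(a <- s) iter M' (zz p q) (F a).
  elim: M' {leM} => //= n ->; apply: (big_morph _ (zzD p q)).
  by apply/funext => e; rewrite zzE subrr.
by rewrite !zzs; apply: eq_big_seq => a /MR; apply.
Qed.

Lemma bdd_iter_pull D (f : LF V * LF V * LF V -> seq (LF V * LF V * LF V)) H n x :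
  (forall y, bdd D (H y)) -> bdd D (iter n (pull f) H x).
Proof.
move=> bH; apply: (pull_ind (Q := fun=> True)) => //; first exact: bdd0.
by move=> *; apply: bddD.
Qed.

(** An operator on the factors produces finitely many pure tensors, and the largest of their orders
    of locality serves for the sum. *)
Lemma Eqv_pull D D' p q f (H H' : nat -> LF V * LF V * LF V -> expo -> V) n :
  D (dir p q) -> D' (dir q p) ->
  (forall l y, bdd D (H l y)) -> (forall l y, bdd D' (H' l y)) -> stable (A3 A) (A3 A) f ->
  (forall y, A3 A y -> Eqv p q (H^~ y) (H'^~ y)) ->
  forall x, A3 A x ->
  Eqv p q (fun l => iter n (pull f) (H l) x) (fun l => iter n (pull f) (H' l) x).
Proof.
move=> Dd Dd' bH bH' sf E; elim: n => [|n IHn] x Ax; first exact: E.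
apply: (Eqv_sum Dd Dd') => [l a|l a|a ax].
- exact: bdd_iter_pull.
- exact: bdd_iter_pull.
- exact/IHn/(sf x).
Qed.

Lemma indep_fld i j p (a : LF V) : p != i -> p != j -> indep i j (fun e => fld a p e).
Proof.
by move=> pi pj e g g0; apply/funext => v; rewrite /fld !expoD !g0 ?addr0.
Qed.

(** The two fields nearest the vacuum are exchanged, the leftmost one being [O]. In [local_outer]
    the rightmost field supplies the vector [v] instead. *)
Lemma local_inner p i j x : p != i -> p != j -> i != j -> A3 A x ->
  Eqv i j (fun l => iter l s23 (prod3 p i j) x)
          (fun l => iter l s23 (flip23 (prod3 p j i)) x).
Proof.
move=> pi pj ij; case: x => [[c a] b] [/= Ac Aa Ab].
have [_ /(_ a b Aa Ab)[r _ r0] /(_ a b Aa Ab)[N locN]] := localS.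
exists N, r => M R leM leR.
have lO e : linear (fld c p e) by apply: fld_linear.
have iv : indep i j (fun _ : expo => vac) by [].
have := locality_series A_ptwist braidS ij lO (indep_fld c pi pj) iv Aa Ab locN r0 leM leR.
congr (iter _ _ (Ex _ _ _ _) = iter _ _ (Ex _ _ _ _)); apply/funext => l.
  by rewrite [RHS]iter_pull23.
rewrite [RHS]iter_pull23; congr (iter l _ _ _); apply/funext => -[u v].
by rewrite pull23E.
Qed.

Lemma local_outer i j k x : k != i -> k != j -> i != j -> A3 A x ->
  Eqv i j (fun l => iter l s12 (prod3 i j k) x)
          (fun l => iter l s12 (flip12 (prod3 j i k)) x).
Proof.
move=> ki kj ij; case: x => [[a b] c] [/= Aa Ab Ac].
have [_ /(_ a b Aa Ab)[r _ r0] /(_ a b Aa Ab)[N locN]] := localS.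
exists N, r => M R leM leR.
have lO (e : expo) : linear (@idfun V) by [].
have iv : indep i j (fun e : expo => fld c k e vac).
  by move=> e g g0; rewrite (indep_fld c ki kj).
have iO : indep i j (fun=> @idfun V) by [].
have := locality_series A_ptwist braidS ij lO iO iv Aa Ab locN r0 leM leR.
congr (iter _ _ (Ex _ _ _ _) = iter _ _ (Ex _ _ _ _)); apply/funext => l.
  by rewrite [RHS]iter_pull12.
rewrite [RHS]iter_pull12; congr (iter l _ _ _); apply/funext => -[u v].
by rewrite pull12E.
Qed.

End LocalPairs.

(** * Powers of the braiding on three factors and exchanges of neighbours *)

Section BraidedTriples.
Context {K : numFieldType} {V : superspaceType K}.
Variables (vac : V) (S : even_tensor_end (LF V)) (A : set (LF V)).
Hypothesis A_hcomp : forall q a, A a -> A (hcomp q a).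
Hypothesis A_ptwist : forall q a, A a -> A (ptwist q a).
Hypothesis braidS : braiding_on A S.
Hypothesis localS : is_local S A.
Local Notation prod3 := (prod3 vac).
Local Notation s12 := (pull (op12 (te_op S))).
Local Notation s13 := (pull (op13 (te_op S))).
Local Notation s23 := (pull (op23 (te_op S))).
Local Notation lin3 := (@lin3 K (LF V) _).
Local Notation lin2 := (@lin2 K (LF V) _).
Local Notation flip12 := (pull (op12 (@flip_op K (LF V)))).
Local Notation flip23 := (pull (op23 (@flip_op K (LF V)))).
Implicit Types (p q i j k l : nat) (x y : LF V * LF V * LF V).
Implicit Types (H : LF V * LF V * LF V -> expo -> V).

Definition ZE M p q a b R (x : nat -> expo -> V) : expo -> V :=
  iter M (zz p q) (Ex a b R x).

Lemma bdd_ZE D M p q a b R (h : nat -> expo -> V) : D (dir a b) ->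
  (forall l, bdd D (h l)) -> bdd D (ZE M p q a b R h).
Proof. by move=> Dd bx; apply: bdd_iter_zz; apply: bdd_Ex. Qed.

Lemma ZE_ZE D M M' p q p' q' a b c d R R' (x : nat -> nat -> expo -> V) :
  D (dir a b) -> D (dir c d) -> (forall m n, bdd D (x m n)) ->
  ZE M p q a b R (fun m => ZE M' p' q' c d R' (x m))
  = ZE M' p' q' c d R' (fun n => ZE M p q a b R (x^~ n)).
Proof.
move=> Dab Dcd bx; rewrite /ZE -(Ex_zz _ _ _ _ Dab); last by move=> m; apply: bdd_Ex.
rewrite (Ex_Ex _ _ Dab Dcd bx) -(Ex_zz _ _ _ _ Dcd); last by move=> n; apply: bdd_Ex.
elim: M => //= M ->; elim: M' => //= M' <-; exact: zz_zz.
Qed.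

Lemma Eqv_uniform p q (I : finType) (h h' : I -> nat -> expo -> V) :
  (forall a, Eqv p q (h a) (h' a)) -> exists M R, forall M' R', (M <= M')%N -> (R <= R')%N ->
    forall a, ZE M' p q p q R' (h a) = ZE M' p q q p R' (h' a).
Proof.
move=> E; have [M [R MR]] : exists M R, forall a M' R', a \in enum I -> (M <= M')%N -> (R <= R')%N ->
    ZE M' p q p q R' (h a) = ZE M' p q q p R' (h' a).
  elim: (enum I) => [|a s [M' [R' MR']]]; first by exists 0%N, 0%N.
  have [M [R MR]] := E a; exists (maxn M M'), (maxn R R') => b m r.
  by rewrite inE !geq_max => /predU1P[->|bs] /andP[? ?] /andP[? ?]; [apply: MR|apply: MR'].
by exists M, R => M' R' leM leR a; apply: MR => //; rewrite mem_enum.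
Qed.

Lemma flip23K H : lin3 H -> flip23 (flip23 H) = H.
Proof.
move=> lH; apply/funext => -[[a b] c]; rewrite pull23E.
rewrite -[RHS](pull_flipK (K := K) (U := LF V) (F := fun y : LF V * LF V => H (a, y.1, y.2)) (b, c) (lH.2 a)).
by congr (pull _ _ _); apply/funext => -[u v]; rewrite pull23E.
Qed.

Lemma lin3_s12 H : lin3 H -> lin3 (s12 H).
Proof. by apply: lin3_pull12; apply: lin_op_te. Qed.
Lemma lin3_s23 H : lin3 H -> lin3 (s23 H).
Proof. by apply: lin3_pull23; apply: lin_op_te. Qed.
Lemma lin3_s13 H : lin3 H -> lin3 (s13 H).
Proof. by apply: lin3_pull13; apply: lin_op_te. Qed.
Lemma lin3_flip12 H : lin3 H -> lin3 (flip12 H).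
Proof. by apply: lin3_pull12; apply: lin_op_flip. Qed.
Lemma lin3_flip23 H : lin3 H -> lin3 (flip23 H).
Proof. by apply: lin3_pull23; apply: lin_op_flip. Qed.

Lemma lin3_iter (f : (LF V * LF V * LF V -> expo -> V) -> LF V * LF V * LF V -> expo -> V) n H :
  (forall H', lin3 H' -> lin3 (f H')) -> lin3 H -> lin3 (iter n f H).
Proof. by move=> lf lH; elim: n => //= n; apply: lf. Qed.

(** S_13 is S_12 conjugated by the flip of the last two factors; in its powers the inner flips
    cancel in pairs. *)
Lemma iter_s13_flip k H : lin3 H -> iter k s13 (flip23 H) = flip23 (iter k s12 H).
Proof.
move=> lH; elim: k => //= k ->; rewrite [LHS](_ : _ = flip23 (s12 (flip23 (flip23 (iter k s12 H))))).
  by rewrite flip23K//; apply: lin3_iter lH; apply: lin3_s12.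
by apply/funext => x; apply: pull13E.
Qed.

Lemma iter_s12_flip i H : lin3 H ->
  iter i s12 (flip23 (flip12 H)) = flip23 (flip12 (iter i s23 H)).
Proof.
move=> lH; elim: i => //= i ->; apply/funext => x; apply: pull12_flip.
by apply: lin3_iter lH; apply: lin3_s23.
Qed.

(* The functional [H] after i, k, l applications of the braiding to the factors
   1-2, 1-3, 2-3. *)
Definition braided H i k l x : expo -> V := iter i s12 (iter k s13 (iter l s23 H)) x.

Let st12 : stable (A3 A) (A3 A) (op12 (te_op S)).
Proof. by apply: stable12; apply: (stable_te A_ptwist braidS). Qed.
Let st23 : stable (A3 A) (A3 A) (op23 (te_op S)).
Proof. by apply: stable23; apply: (stable_te A_ptwist braidS). Qed.
Let st13 : stable (A3 A) (A3 A) (op13 (te_op S)).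
Proof. by apply: (stable13 A_hcomp A_ptwist); apply: (stable_te A_ptwist braidS). Qed.

Lemma eq_iter_pull f H H' n x : stable (A3 A) (A3 A) f ->
  (forall y, A3 A y -> H y = H' y) -> A3 A x -> iter n (pull f) H x = iter n (pull f) H' x.
Proof.
move=> sf HH; elim: n x => [|n IHn] x Ax /=; first exact: HH.
by apply: (eq_pull sf) Ax => y; apply: IHn.
Qed.

Lemma iter_s12_s13 k l H x : lin3 H -> A3 A x ->
  iter k s12 (iter l s13 H) x = iter l s13 (iter k s12 H) x.
Proof.
apply: iter_comm3 => //; [exact: lin3_s12|exact: lin3_s13|].
by move=> H' y lH' Ay; apply: (pull_comm3 _ lH' Ay); case: braidS.
Qed.

Lemma iter_s12_s23 k l H x : lin3 H -> A3 A x ->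
  iter k s12 (iter l s23 H) x = iter l s23 (iter k s12 H) x.
Proof.
apply: iter_comm3 => //; [exact: lin3_s12|exact: lin3_s23|].
by move=> H' y lH' Ay; apply: (pull_comm3 _ lH' Ay); case: braidS.
Qed.

Lemma iter_s13_s23 k l H x : lin3 H -> A3 A x ->
  iter k s13 (iter l s23 H) x = iter l s23 (iter k s13 H) x.
Proof.
apply: iter_comm3 => //; [exact: lin3_s13|exact: lin3_s23|].
by move=> H' y lH' Ay; apply: (pull_comm3 _ lH' Ay); case: braidS.
Qed.

(** Since the three actions commute on [A], each can be made the outermost one, where nilpotency on
    a single pair applies. The bound does not depend on the functional, so it serves all orderings
    at once. *)
Lemma braided_nilpotent x : A3 A x -> exists r, forall H i k l, lin3 H ->
  (r <= i)%N || (r <= k)%N || (r <= l)%N -> braided H i k l x = 0.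
Proof.
case: x => [[a b] c] Ax; have [/= Aa Ab Ac] := Ax.
have nil2 u v : A u -> A v -> exists r, forall (F : LF V * LF V -> expo -> V) l,
    lin2 F -> (r <= l)%N -> iter l (pull (te_op S)) F (u, v) = 0.
  move=> Au Av; have [_ /(_ u v Au Av)[r _ r0] _] := localS.
  by exists r => F l lF rl; apply: te_nilpotent r0 rl lF.
have [r1 n1] := nil2 a b Aa Ab; have [r2 n2] := nil2 b c Ab Ac.
(* S_13 is reached through a flip, which splits c into its parity components; both need a bound. *)
have [r3 n3] := nil2 a _ Aa (A_hcomp false Ac); have [r4 n4] := nil2 a _ Aa (A_hcomp true Ac).
exists (maxn (maxn r1 r2) (maxn r3 r4)) => H i k l lH.
have l23 n H' : lin3 H' -> lin3 (iter n s23 H') by apply: lin3_iter; apply: lin3_s23.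
have l13 n H' : lin3 H' -> lin3 (iter n s13 H') by apply: lin3_iter; apply: lin3_s13.
have l12 n H' : lin3 H' -> lin3 (iter n s12 H') by apply: lin3_iter; apply: lin3_s12.
rewrite -orbA !geq_max => /or3P[] /andP[/andP[ri1 ri2] /andP[ri3 ri4]]; rewrite /braided.
- by rewrite iter_pull12 n1//; apply: (l13 _ _ (l23 _ _ lH)).1.
- rewrite iter_s12_s13//; last exact: l23.
  set G := iter i _ _; have lG : lin3 G by apply/l12/l23.
  rewrite -(flip23K lG) iter_s13_flip; last exact: lin3_flip23.
  rewrite pull23E /pull /flip_op /= !big_cons big_nil /= !iter_pull12.
  by rewrite n3// ?n4// ?addr0//; apply: (lin3_flip23 lG).1.
- rewrite (eq_iter_pull (H' := iter l s23 (iter k s13 H)) _ st12)//; last first.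
    by move=> y; apply: iter_s13_s23.
  rewrite iter_s12_s23//; last exact: l13.
  by rewrite iter_pull23 n2//; apply: (l12 _ _ (l13 _ _ lH)).2.
Qed.

(* Orderings of the product of a, b and c as functionals of a (x) b (x) c, the
   variables of a, b and c being z_1, z_2 and z_3. *)
Definition x123 := prod3 1 2 3.
Definition x132 := flip23 (prod3 1 3 2).
Definition x312 := flip23 (flip12 (prod3 3 1 2)).
Definition x321 i := flip23 (flip12 (iter i s23 (flip23 (prod3 3 2 1)))).

Lemma bdd_pull D (f : LF V * LF V * LF V -> seq (LF V * LF V * LF V)) H x :
  (forall y, bdd D (H y)) -> bdd D (pull f H x).
Proof. by move=> bH; apply: (@bdd_iter_pull K V D f H 1). Qed.

Lemma bdd_braided D H i k l x : (forall y, bdd D (H y)) -> bdd D (braided H i k l x).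
Proof. by move=> bH; do 3![apply: bdd_iter_pull => ?]. Qed.

Lemma bdd_x123 x : bdd (dirs 1 2 3) (x123 x).
Proof. exact: bdd_prod3. Qed.
Lemma bdd_x132 x : bdd (dirs 1 3 2) (x132 x).
Proof. by apply: bdd_pull => y; apply: bdd_prod3. Qed.
Lemma bdd_x312 x : bdd (dirs 3 1 2) (x312 x).
Proof. by do 2![apply: bdd_pull => ?]; apply: bdd_prod3. Qed.
Lemma bdd_x321 i x : bdd (dirs 3 2 1) (x321 i x).
Proof.
do 2![apply: bdd_pull => ?]; apply: bdd_iter_pull => ?; apply: bdd_pull => ?.
exact: bdd_prod3.
Qed.

Lemma lin3_x132 : lin3 x132. Proof. exact/lin3_flip23/lin3_prod3. Qed.
Lemma lin3_x312 : lin3 x312. Proof. exact/lin3_flip23/lin3_flip12/lin3_prod3. Qed.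

Lemma Eqv23 i k x : A3 A x -> Eqv 2 3 (fun l => braided x123 i k l x) (fun l => braided x132 i k l x).
Proof.
move=> Ax; have D1 : dirs 1 2 3 (dir 2 3) by right; right.
have D2 : dirs 1 3 2 (dir 3 2) by right; right.
rewrite /braided; apply: (Eqv_pull _ D1 D2) Ax => // [l y|l y|y Ay].
- by do 2![apply: bdd_iter_pull => ?]; apply: bdd_x123.
- by do 2![apply: bdd_iter_pull => ?]; apply: bdd_x132.
apply: (Eqv_pull _ D1 D2) Ay => // [l z|l z|z Az].
- by apply: bdd_iter_pull => ?; apply: bdd_x123.
- by apply: bdd_iter_pull => ?; apply: bdd_x132.
exact: (local_inner _ A_ptwist braidS localS).
Qed.

Lemma braidedD13 H i k k' l x : lin3 H -> A3 A x ->
  braided H i (k + k') l x = iter i s12 (iter k s13 (iter l s23 (iter k' s13 H))) x.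
Proof.
move=> lH; apply: eq_iter_pull => // y; rewrite iterD; apply: eq_iter_pull => // z Az.
exact: iter_s13_s23.
Qed.

Lemma braided_s12_last H i k l x : lin3 H -> A3 A x ->
  braided H i k l x = iter k s13 (iter l s23 (iter i s12 H)) x.
Proof.
move=> lH Ax; rewrite /braided iter_s12_s13//; last by apply: lin3_iter lH; apply: lin3_s23.
by apply: eq_iter_pull Ax => // y; apply: iter_s12_s23.
Qed.

(** The fixed [k] is the shift required by [Loc]. The operators of index i, k and l act outside, and
    the powers k' become powers of S_12 once c has been flipped next to a. *)
Lemma Eqv13 i k l x : A3 A x -> Eqv 1 3 (fun k' => braided x132 i (k + k') l x)
  (fun k' => braided x312 i (k + k') l x).
Proof.
move=> Ax; have D1 : dirs 1 3 2 (dir 1 3) by left.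
have D2 : dirs 3 1 2 (dir 3 1) by left.
under [X in Eqv _ _ X]funext => k' do rewrite (braidedD13 _ _ _ _ lin3_x132 Ax).
under [X in Eqv _ _ _ X]funext => k' do rewrite (braidedD13 _ _ _ _ lin3_x312 Ax).
have b1 n y : bdd (dirs 1 3 2) (iter n s13 x132 y) by apply: bdd_iter_pull => ?; apply: bdd_x132.
have b2 n y : bdd (dirs 3 1 2) (iter n s13 x312 y) by apply: bdd_iter_pull => ?; apply: bdd_x312.
apply: (Eqv_pull _ D1 D2) Ax => // [k' y|k' y|y Ay].
- by do 2![apply: bdd_iter_pull => ?]; apply: b1.
- by do 2![apply: bdd_iter_pull => ?]; apply: b2.
apply: (Eqv_pull _ D1 D2) Ay => // [k' z|k' z|z Az].
- by apply: bdd_iter_pull => ?; apply: b1.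
- by apply: bdd_iter_pull => ?; apply: b2.
apply: (Eqv_pull _ D1 D2) Az => // w Aw.
under [X in Eqv _ _ X]funext => k' do rewrite (iter_s13_flip _ (lin3_prod3 _ _ _ _)).
under [X in Eqv _ _ _ X]funext => k' do rewrite (iter_s13_flip _ (lin3_flip12 (lin3_prod3 _ _ _ _))).
apply: (Eqv_pull 1 D1 D2) Aw => // [k' z'|k' z'||z' Az'].
- by apply: bdd_iter_pull => ?; apply: bdd_prod3.
- by apply: bdd_iter_pull => ?; apply: bdd_pull => ?; apply: bdd_prod3.
- by apply: stable23; apply: stable_flip.
exact: (local_outer _ A_ptwist braidS localS).
Qed.

(** Once c stands in front, S_12 acts on the last two factors. Exchanging a and b is then locality
    of the inner pair, with the powers of S absorbed into [x321]. *)
Lemma Eqv12 k l x : A3 A x -> Eqv 1 2 (fun i => braided x312 i k l x)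
  (fun i => iter k s13 (iter l s23 (x321 i)) x).
Proof.
move=> Ax; have D1 : dirs 3 1 2 (dir 1 2) by right; right.
have D2 : dirs 3 2 1 (dir 2 1) by right; right.
under [X in Eqv _ _ X]funext => i do rewrite (braided_s12_last _ _ _ lin3_x312 Ax)
  (iter_s12_flip _ (lin3_prod3 _ _ _ _)).
have b1 n y : bdd (dirs 3 1 2) (flip23 (flip12 (iter n s23 (prod3 3 1 2))) y).
  by do 2![apply: bdd_pull => ?]; apply: bdd_iter_pull => ?; apply: bdd_prod3.
have b2 := bdd_x321.
apply: (Eqv_pull _ D1 D2) Ax => // [i y|i y|y Ay].
- by apply: bdd_iter_pull => ?; apply: b1.
- by apply: bdd_iter_pull => ?; apply: b2.
apply: (Eqv_pull _ D1 D2) Ay => // z Az.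
apply: (Eqv_pull 1 D1 D2) Az => // [i w|i w||w Aw].
- by apply: bdd_pull => ?; apply: bdd_iter_pull => ?; apply: bdd_prod3.
- by apply: bdd_pull => ?; apply: bdd_iter_pull => ?; apply: bdd_pull => ?; apply: bdd_prod3.
- by apply: stable23; apply: stable_flip.
apply: (Eqv_pull 1 D1 D2) Aw => // [i u|i u||u Au].
- by apply: bdd_iter_pull => ?; apply: bdd_prod3.
- by apply: bdd_iter_pull => ?; apply: bdd_pull => ?; apply: bdd_prod3.
- by apply: stable12; apply: stable_flip.
exact: (local_inner _ A_ptwist braidS localS).
Qed.

End BraidedTriples.

(** * Dong's lemma *)

Section Dong.
Context {K : numFieldType} {V : superspaceType K}.
Variables (vac : V) (S : even_tensor_end (LF V)) (A : set (LF V)).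
Hypothesis A_hcomp : forall q a, A a -> A (hcomp q a).
Hypothesis A_ptwist : forall q a, A a -> A (ptwist q a).
Hypothesis braidS : braiding_on A S.
Hypothesis localS : is_local S A.
Local Notation s13 := (pull (op13 (te_op S))).
Local Notation s23 := (pull (op23 (te_op S))).
Local Notation lin3 := (@lin3 K (LF V) _).
Local Notation braided := (@braided K V S).
Local Notation x123 := (x123 vac).
Local Notation x132 := (x132 vac).
Local Notation x312 := (x312 vac).
Local Notation x321 := (x321 vac S).
Implicit Types (p q i j k l : nat) (x y : LF V * LF V * LF V).
Implicit Types (H : LF V * LF V * LF V -> expo -> V).

Lemma Ex0 i j r : Ex i j r (fun=> 0 : expo -> V) = 0.
Proof.
rewrite /Ex big1// => l _; rewrite (_ : iter l _ _ = 0) ?scaler0//.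
by elim: (nat_of_ord l) => //= n ->; apply: th0.
Qed.

Lemma ZE0 M p q a b R : ZE M p q a b R (fun=> 0 : expo -> V) = 0.
Proof.
rewrite /ZE Ex0; elim: M => //= M ->; apply/funext => e.
by rewrite zzE subrr.
Qed.

(** Nilpotency leaves finitely many index triples with nonzero terms, so a single pair of bounds
    works for all of them. *)
Lemma Eqv_uniform3 p q r (h h' : nat -> nat -> nat -> nat -> expo -> V) :
  (forall i k l, Eqv p q (h i k l) (h' i k l)) ->
  (forall i k l, (r <= i)%N || (r <= k)%N || (r <= l)%N ->
     h i k l = (fun=> 0) /\ h' i k l = (fun=> 0)) ->
  exists M R, forall M' R', (M <= M')%N -> (R <= R')%N ->
    forall i k l, ZE M' p q p q R' (h i k l) = ZE M' p q q p R' (h' i k l).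
Proof.
move=> E h0.
have [M [R MR]] := Eqv_uniform (fun a : 'I_r * 'I_r * 'I_r => E a.1.1 a.1.2 a.2).
exists M, R => M' R' leM leR i k l.
have [ri|ir] := leqP r i; first by have [|-> ->] := h0 i k l; rewrite ?ri// !ZE0.
have [rk|kr] := leqP r k; first by have [|-> ->] := h0 i k l; rewrite ?rk ?orbT// !ZE0.
have [rl|lr] := leqP r l; first by have [|-> ->] := h0 i k l; rewrite ?rl ?orbT// !ZE0.
exact: (MR M' R' leM leR (Ordinal ir, Ordinal kr, Ordinal lr)).
Qed.

Lemma Eqv_uniform2 p q r (h h' : nat -> nat -> nat -> expo -> V) :
  (forall i k, Eqv p q (h i k) (h' i k)) ->
  (forall i k, (r <= i)%N || (r <= k)%N -> h i k = (fun=> 0) /\ h' i k = (fun=> 0)) ->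
  exists M R, forall M' R', (M <= M')%N -> (R <= R')%N ->
    forall i k, ZE M' p q p q R' (h i k) = ZE M' p q q p R' (h' i k).
Proof.
move=> E h0.
have [M [R MR]] := Eqv_uniform (fun a : 'I_r * 'I_r => E a.1 a.2).
exists M, R => M' R' leM leR i k.
have [ri|ir] := leqP r i; first by have [|-> ->] := h0 i k; rewrite ?ri// !ZE0.
have [rk|kr] := leqP r k; first by have [|-> ->] := h0 i k; rewrite ?rk ?orbT// !ZE0.
exact: (MR M' R' leM leR (Ordinal ir, Ordinal kr)).
Qed.

Lemma lin3_x321 i : lin3 (x321 i).
Proof.
apply: lin3_flip23; apply: lin3_flip12; apply: lin3_iter; first exact: lin3_s23.
exact/lin3_flip23/lin3_prod3.
Qed.

Lemma iter_DD_Ex D k i j r M p (h : nat -> expo -> V) : k != i -> k != j -> i != j ->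
  k != p -> D (dir i j) -> (forall l, bdd D (h l)) -> forall n q, k != q ->
  iter n (DD k) (iter M (zz p q) (Ex i j r h)) = iter M (zz p q) (Ex i j r (fun l => iter n (DD k) (h l))).
Proof.
move=> ki kj ij kp Dd bh n q kq.
have zzc G : DD k (iter M (zz p q) G) = iter M (zz p q) (DD k G).
  by elim: M => //= M <-; rewrite DD_zz (negbTE kp) (negbTE kq) subrr scale0r addr0.
elim: n h bh => // n IHn h bh; rewrite iterSr zzc (DD_Ex _ ki kj ij Dd bh) IHn; last first.
  by move=> l; apply: bdd_DD.
by congr (iter M _ (Ex i j r _)); apply/funext => l; rewrite iterSr.
Qed.

(* Dong's lemma in three variables. The first conclusion moves a next to the
   vacuum, so that B x312 has no negative powers of z_1 when a is creating. *)
Lemma dong x r0 : A3 A x -> exists r N0, (r0 <= r)%N /\ forall N, (N0 <= N)%N ->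
  let B H k l := ZE N 1 2 1 2 r.+1 (fun i => braided H i k l x) in
  (forall k l, B x312 k l = ZE N 1 2 2 1 r.+1 (fun i => iter k s13 (iter l s23 (x321 i)) x)) /\
  forall p, exists R1 R2,
  iter R1 (zz 1 3) (Ex 1 3 r.+1 (fun k => iter R2 (zz 2 3) (Ex 2 3 r.+1 (fun l => iter p (DD 1) (B x123 k l)))))
  = iter R1 (zz 1 3) (Ex 3 1 r.+1 (fun k => iter R2 (zz 2 3) (Ex 3 2 r.+1 (fun l => iter p (DD 1) (B x312 k l))))).
Proof.
move=> Ax.
have [rn nil] := braided_nilpotent A_hcomp A_ptwist braidS localS Ax.
have lx123 := lin3_prod3 vac 1 2 3.
have lx132 := lin3_x132 vac; have lx312 := lin3_x312 vac.
have [M1 [R1 E1]] := Eqv_uniform2 (r := rn)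
  (fun i k => Eqv23 vac A_hcomp A_ptwist braidS localS i k Ax) (fun i k ik =>
    conj (funext (fun l => nil _ i k l lx123 (introT orP (or_introl ik))))
         (funext (fun l => nil _ i k l lx132 (introT orP (or_introl ik))))).
have [M2 [R2 E2]] := Eqv_uniform3 (r := rn)
  (fun i s l => Eqv13 vac A_hcomp A_ptwist braidS localS i s l Ax) (fun i s l isl =>
    conj (funext (fun k => nil _ i (s + k)%N l lx132 ltac:(move: isl; lia)))
         (funext (fun k => nil _ i (s + k)%N l lx312 ltac:(move: isl; lia)))).
have [N0 [R3 E3]] := Eqv_uniform2 (r := rn)
  (fun k l => Eqv12 vac A_hcomp A_ptwist braidS localS k l Ax) (fun k l kl =>
    conj (funext (fun i => nil _ i k l lx312 ltac:(move: kl; lia)))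
         (funext (fun i => nil (x321 i) 0%N k l (lin3_x321 i) ltac:(move: kl; lia)))).
(* One truncation order for all exponentials, large enough for nilpotency, for the three exchanges
   and for the requested [r0]. *)
pose r := (rn + r0 + R1 + R2 + R3)%N; exists r, N0; split; first by rewrite /r; lia.
move=> N leN B; split=> [k l|p]; first by apply: E3 => //; rewrite /r; lia.
pose y k := ZE M1 2 3 2 3 r.+1 (fun l => B x123 k l).
pose y' k := ZE M1 2 3 3 2 r.+1 (fun l => B x312 k l).
have D123 : [/\ dirs 1 2 3 (dir 1 2), dirs 1 2 3 (dir 1 3) & dirs 1 2 3 (dir 2 3)].
  by split; [left|right; left|right; right].
have D132 : [/\ dirs 1 3 2 (dir 1 3), dirs 1 3 2 (dir 1 2) & dirs 1 3 2 (dir 3 2)].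
  by split; [left|right; left|right; right].
have D312 : [/\ dirs 3 1 2 (dir 3 1), dirs 3 1 2 (dir 3 2) & dirs 3 1 2 (dir 1 2)].
  by split; [left|right; left|right; right].
case: D123 D132 D312 => [d1 d2 d3] [e1 e2 e3] [f1 f2 f3].
have b1 i k l : bdd (dirs 1 2 3) (braided x123 i k l x) by apply: bdd_braided => ?; apply: bdd_x123.
have b2 i k l : bdd (dirs 1 3 2) (braided x132 i k l x) by apply: bdd_braided => ?; apply: bdd_x132.
have b3 i k l : bdd (dirs 3 1 2) (braided x312 i k l x) by apply: bdd_braided => ?; apply: bdd_x312.
have bB1 k l : bdd (dirs 1 2 3) (B x123 k l) by apply: bdd_ZE.
have bB3 k l : bdd (dirs 3 1 2) (B x312 k l) by apply: bdd_ZE.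
(* c passes b by [E1] and then a by [E2]. Before each exchange [ZE_ZE] brings the relevant
   exponential innermost, which is allowed because all exponentials present fit the current
   ordering; e^(vartheta_12 S_12) stays throughout. *)
have loc : Loc 1 3 r.+1 M2 y y'.
  move=> s; rewrite -[LHS]/(ZE M2 1 3 1 3 r.+1 (fun k => y (s + k)%N)).
  rewrite -[RHS]/(ZE M2 1 3 3 1 r.+1 (fun k => y' (s + k)%N)).
  transitivity (ZE N 1 2 1 2 r.+1 (fun i => ZE M1 2 3 3 2 r.+1 (fun l =>
      ZE M2 1 3 1 3 r.+1 (fun k => braided x132 i (s + k) l x)))).
    transitivity (ZE M2 1 3 1 3 r.+1 (fun k => ZE N 1 2 1 2 r.+1 (fun i =>
        ZE M1 2 3 3 2 r.+1 (fun l => braided x132 i (s + k) l x)))).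
      congr (ZE _ _ _ _ _ _ _); apply/funext => k.
      rewrite /y /B (ZE_ZE _ _ _ _ _ _ _ _ d3 d1)//.
      congr (ZE _ _ _ _ _ _ _); apply/funext => i; apply: E1 => //; rewrite /r; lia.
    rewrite (ZE_ZE _ _ _ _ _ _ _ _ e1 e2); last by move=> *; apply: bdd_ZE.
    congr (ZE _ _ _ _ _ _ _); apply/funext => i.
    by rewrite (ZE_ZE _ _ _ _ _ _ _ _ e1 e3).
  under [X in ZE N 1 2 1 2 r.+1 X = _]funext => i.
    rewrite [X in ZE M1 2 3 3 2 r.+1 X](_ : _ = fun l => ZE M2 1 3 3 1 r.+1 (fun k => braided x312 i (s + k) l x)); last first.
      by apply/funext => l; apply: E2 => //; rewrite /r; lia.
    rewrite (ZE_ZE _ _ _ _ _ _ _ _ f2 f1)//; over.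
  rewrite (ZE_ZE _ _ _ _ _ _ _ _ f3 f1); last by move=> *; apply: bdd_ZE.
  congr (ZE _ _ _ _ _ _ _); apply/funext => k.
  by rewrite (ZE_ZE _ _ _ _ _ _ _ _ f3 f2).
(* D_1 passes through the factors that involve only z_2 and z_3. *)
have Dy n : iter n (DD 1) \o y = fun k => ZE M1 2 3 2 3 r.+1 (fun l => iter n (DD 1) (B x123 k l)).
  by apply/funext => k; apply: (iter_DD_Ex _ _ _ _ _ _ d3).
have Dy' n : iter n (DD 1) \o y' = fun k => ZE M1 2 3 3 2 r.+1 (fun l => iter n (DD 1) (B x312 k l)).
  by apply/funext => k; apply: (iter_DD_Ex _ _ _ _ _ _ f2).
have bDy n k : bdd (dirs 1 2 3) ((iter n (DD 1) \o y) k).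
  by rewrite Dy; apply: bdd_ZE => // l; apply: bdd_iter_DD.
have bDy' n k : bdd (dirs 3 1 2) ((iter n (DD 1) \o y') k).
  by rewrite Dy'; apply: bdd_ZE => // l; apply: bdd_iter_DD.
have DD0 : DD 1 (0 : expo -> V) = 0 by apply/funext => e; rewrite /DD !scaler0 addr0.
have y0 n k : (r.+1 <= k)%N -> (iter n (DD 1) \o y) k = 0 /\ (iter n (DD 1) \o y') k = 0.
  move=> rk; have z H l : lin3 H -> B H k l = 0.
    move=> lH; rewrite /B (_ : (fun i => _) = fun=> 0) ?ZE0//.
    by apply/funext => i; apply: nil => //; move: rk; rewrite /r; lia.
  rewrite /= /y /y' (_ : (fun l => B x123 k l) = fun=> 0); last by apply/funext => l; apply: z.
  rewrite (_ : (fun l => B x312 k l) = fun=> 0); last by apply/funext => l; apply: z.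
  by rewrite !ZE0; have -> : iter n (DD 1) (0 : expo -> V) = 0 by elim: n => //= n ->.
(* Each derivative in z_1 costs one more factor z_13. *)
have locp n : Loc 1 3 r.+1 (M2 + n) (iter n (DD 1) \o y) (iter n (DD 1) \o y').
  elim: n => [|n IHn]; first by rewrite addn0.
  rewrite addnS; apply: (Loc_DD _ d2 f1 (bDy n) (bDy' n)) IHn => // k /(y0 n)[]//.
exists (M2 + p)%N, M1; have := locp p 0%N.
by rewrite Dy Dy'.
Qed.

End Dong.

(** * The products of fields *)

Section Diagonal.
Context {K : numFieldType} {V : lmodType K}.
Implicit Types (F G : series2 V).

Definition fin2 F := bnd2 F /\ bnd2 (swap12 F).

Lemma zsum_linear (h : {linear V -> V}) (f : int -> V) : evzZ f ->
  zsum (fun i => h (f i)) = h (zsum f).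
Proof.
move=> [B [n fB]]; rewrite (zsumE fB) (@zsumE _ B n) ?linear_sum// => i /fB ->.
exact: linear0.
Qed.

Lemma fin2_evz F m k l : fin2 F -> evzZ (fun i => F i k (m - i) l).
Proof.
move=> [[M FM] [M' FM']]; exists (M' : int), (absz (m - M - M')%R + 1)%N => i [iM|iM].
  exact: (FM' (m - i) l i k).
by apply: FM; lia.
Qed.

Lemma bnd2_z12 F : bnd2 F -> bnd2 (z12_mul F).
Proof. by move=> [M FM]; exists M => m1 j1 m2 j2 mM; rewrite /z12_mul !FM ?subr0//; lia. Qed.

Lemma bnd2_swap_z12 F : bnd2 (swap12 F) -> bnd2 (swap12 (z12_mul F)).
Proof.
move=> [M FM]; exists M => m1 j1 m2 j2 mM; rewrite /swap12 /z12_mul.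
by rewrite -/(swap12 F m1 j1 (m2 - 1) j2) -/(swap12 F (m1 - 1) j1 m2 j2) !FM ?subr0//; lia.
Qed.

Lemma fin2_z12 F : fin2 F -> fin2 (z12_mul F).
Proof. by move=> [bF bF']; split; [apply: bnd2_z12|apply: bnd2_swap_z12]. Qed.

Lemma fin2_Dz1 F : fin2 F -> fin2 (Dz1 F).
Proof.
move=> [[M FM] [M' FM']]; split.
  by exists M => m1 j1 m2 j2 mM; rewrite /Dz1 !FM// !scaler0 addr0.
exists (M' - 1) => m1 j1 m2 j2 mM; rewrite /swap12 /Dz1.
rewrite -/(swap12 F m1 j1 (m2 + 1) j2) -/(swap12 F m1 j1 (m2 + 1) j2.+1).
by rewrite !FM' ?scaler0 ?addr0//; lia.
Qed.

Lemma fin2_scale F (c : K) : fin2 F -> fin2 (fun m1 j1 m2 j2 => c *: F m1 j1 m2 j2).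
Proof.
move=> [[M FM] [M' FM']]; split.
  by exists M => *; rewrite FM// scaler0.
by exists M' => m1 j1 m2 j2 mM; have := FM' m1 j1 m2 j2 mM; rewrite /swap12 => ->; rewrite scaler0.
Qed.

Lemma fin2_iter F f n : (forall G, fin2 G -> fin2 (f G)) -> fin2 F -> fin2 (iter n f F).
Proof. by move=> ff fF; elim: n => //= n; apply: ff. Qed.

Lemma evzZ_sum (I : Type) (s : seq I) (f : I -> int -> V) :
  (forall a, evzZ (f a)) -> evzZ (fun i => \sum_(a <- s) f a i).
Proof.
move=> ef; elim: s => [|a s IHs]; first by exists 0, 0%N => *; rewrite big_nil.
have [B [n [fB gB]]] := evzZ_common (ef a) IHs.
by exists B, n => i iB; rewrite big_cons fB// gB// addr0.
Qed.

Lemma zsum_sum (I : Type) (s : seq I) (f : I -> int -> V) : (forall a, evzZ (f a)) ->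
  zsum (fun i => \sum_(a <- s) f a i) = \sum_(a <- s) zsum (f a).
Proof.
move=> ef; elim: s => [|a s IHs].
  by rewrite big_nil (@zsumE _ 0 0%N) ?big_ord0// => *; rewrite big_nil.
under [X in zsum X]funext => i do rewrite big_cons.
by rewrite zsumD ?IHs ?big_cons//; apply: evzZ_sum.
Qed.

Lemma diag12E F m j : fin2 F ->
  diag12 F m j = \sum_(k < j.+1) zsum (fun i => F i k (m - i) (j - k)%N).
Proof.
by move=> fF; rewrite -[RHS]zsum_sum// => k; apply: (fin2_evz _ k (j - k)%N).
Qed.

Lemma diag12_z12 F m j : fin2 F -> diag12 (z12_mul F) m j = 0.
Proof.
move=> fF; rewrite diag12E; last exact: fin2_z12.
apply: big1 => k _; rewrite /z12_mul zsumB; last 2 first.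
- have := evzZ_shift (- 1) (fin2_evz (m - 1) k (j - k)%N fF).
  by congr evzZ; apply/funext => i; congr (F _ _ _ _); ring.
- have := fin2_evz (m - 1) k (j - k)%N fF.
  by congr evzZ; apply/funext => i; congr (F _ _ _ _); ring.
rewrite -[X in _ - X](zsum_shift (- 1)); last first.
  have := fin2_evz (m - 1) k (j - k)%N fF.
  by congr evzZ; apply/funext => i; congr (F _ _ _ _); ring.
apply/eqP; rewrite subr_eq0; apply/eqP; congr zsum; apply/funext => i.
by congr (F _ _ _ _); ring.
Qed.

Definition Dz2 F : series2 V := swap12 (Dz1 (swap12 F)).

(** The weights i and m + 1 - i with which the two derivations hit a diagonal term add up to m + 1,
    and those of the logarithms to j + 1. *)
Lemma diag12_Dz F m j : fin2 F -> diag12 (Dz1 F) m j + diag12 (Dz2 F) m j =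
  (m + 1)%:~R *: diag12 F (m + 1) j + j.+1%:R *: diag12 F (m + 1) j.+1.
Proof.
move=> fF; have f2 : fin2 (Dz2 F).
  have := fin2_Dz1 (conj fF.2 fF.1 : fin2 (swap12 F)).
  by case.
rewrite !diag12E//; last exact: fin2_Dz1.
pose f k l i := F i k (m + 1 - i) l.
have ef k l : evzZ (f k l) by apply: fin2_evz.
have efZ (c : int -> K) k l : evzZ (fun i => c i *: f k l i).
  by have [B [n fB]] := ef k l; exists B, n => i iB; rewrite fB// scaler0.
have E1 k : zsum (fun i => Dz1 F i k (m - i) (j - k)%N) =
    zsum (fun i => i%:~R *: f k (j - k)%N i) + k.+1%:R *: zsum (f k.+1 (j - k)%N).
  rewrite -(zsum_shift 1 (efZ (fun i => i%:~R) _ _)) -(zsum_shift 1 (ef k.+1 _)).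
  rewrite -(zsum_linear (_ \*: idfun)); last exact: evzZ_shift.
  rewrite -zsumD; first last.
  - have := evzZ_shift 1 (efZ (fun=> k.+1%:R) k.+1 (j - k)%N); by [].
  - exact: (evzZ_shift 1 (efZ (fun i => i%:~R) _ _)).
  congr zsum; apply/funext => i; rewrite /Dz1 /f /=.
  by congr (_ *: F _ _ _ _ + _ *: F _ _ _ _); ring.
have E2 k : zsum (fun i => Dz2 F i k (m - i) (j - k)%N) =
    zsum (fun i => (m + 1 - i)%:~R *: f k (j - k)%N i) + (j - k).+1%:R *: zsum (f k (j - k).+1).
  rewrite -(zsum_linear (_ \*: idfun)) // -zsumD; [|exact: (efZ (fun i => (m + 1 - i)%:~R))|exact: (efZ (fun=> _))].
  congr zsum; apply/funext => i; rewrite /Dz2 /swap12 /Dz1 /f /=.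
  by congr (_%:~R *: F _ _ _ _ + _ *: F _ _ _ _); ring.
under eq_bigr => k _ do rewrite E1.
under [X in _ + X = _]eq_bigr => k _ do rewrite E2.
rewrite !big_split /= [LHS]addrACA.
congr (_ + _).
  rewrite -big_split scaler_sumr; apply: eq_bigr => k _ /=.
  rewrite -zsumD; [|exact: (efZ (fun i => i%:~R))|exact: (efZ (fun i => (m + 1 - i)%:~R))].
  rewrite -[RHS](zsum_linear ((m + 1)%:~R \*: idfun) (ef k (j - k)%N)).
  congr zsum; apply/funext => i /=.
  by rewrite -scalerDl -intrD addrC subrK.
(* Each of the two logarithmic sums is extended by a term of weight 0, at k = 0 and at k = j + 1
   respectively, so that both run over the same range. *)
have -> : \sum_(k < j.+1) k.+1%:R *: zsum (f k.+1 (j - k)%N) =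
    \sum_(k < j.+2) k%:R *: zsum (f k (j.+1 - k)%N).
  by rewrite [RHS]big_ord_recl [X in _ = X + _]scale0r add0r.
have -> : \sum_(k < j.+1) (j - k).+1%:R *: zsum (f k (j - k).+1) =
    \sum_(k < j.+2) (j.+1 - k)%:R *: zsum (f k (j.+1 - k)%N).
  rewrite [RHS]big_ord_recr /= subnn scale0r addr0; apply: eq_bigr => k _.
  by rewrite subSn// -ltnS.
rewrite -big_split scaler_sumr; apply: eq_bigr => k _ /=.
by rewrite -scalerDl -natrD subnKC// -ltnS.
Qed.

Lemma Dz1_z12 F : Dz1 (z12_mul F) = fun m1 j1 m2 j2 => z12_mul (Dz1 F) m1 j1 m2 j2 + F m1 j1 m2 j2.
Proof.
do 4 apply/funext => ?; rewrite /Dz1 /z12_mul addrK subrK.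
rewrite !scalerBr opprD addrACA intrD scalerDl scale1r -!addrA; congr (_ + _).
by rewrite addrC -!addrA; congr (_ + _); rewrite addrC -addrA.
Qed.

End Diagonal.

Section ProductField.
Context {K : numFieldType} {V : superspaceType K}.
Variables (S : even_tensor_end (LF V)) (A : set (LF V)) (T : {linear V -> V}).
Hypothesis A_hcomp : forall q a, A a -> A (hcomp q a).
Hypothesis A_ptwist : forall q a, A a -> A (ptwist q a).
Hypothesis braidS : braiding_on A S.
Hypothesis localS : is_local S A.
Implicit Types (a b : LF V) (v w : V) (N p : nat).

Definition prod_series a b N p v : series2 V :=
  iter p Dz1 (iter N z12_mul (exp_mu12 S [:: (a, b)] v)).

Lemma te_iter_cat l (s t : seq (LF V * LF V)) : te_iter S l (s ++ t) = te_iter S l s ++ te_iter S l t.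
Proof. by elim: l => //= l; rewrite /te_iter /= => ->; rewrite fsum_ext_cat. Qed.

Lemma te_iter_leq r r' (s : seq (LF V * LF V)) : (r <= r')%N ->
  tens_eq (te_iter S r s) [::] -> tens_eq (te_iter S r' s) [::].
Proof.
move=> /subnK <- r0; elim: (r' - r)%N => // n IHn; exact: (te_op_eq S IHn).
Qed.

Lemma te_flip_nilpotent a b : A a -> A b -> exists r, tens_eq (te_iter S r (flip_op (a, b))) [::].
Proof.
move=> Aa Ab; have [_ nil _] := localS.
have [r _ r0] := nil _ _ (A_hcomp false Ab) (A_ptwist false Aa).
have [r' _ r'0] := nil _ _ (A_hcomp true Ab) (A_ptwist true Aa).
exists (maxn r r'); rewrite -[flip_op _]/([:: _] ++ [:: _]) te_iter_cat.
by apply: (fsum_cat (s' := [::]) (t' := [::])); [apply: te_iter_leq r0|apply: te_iter_leq r'0];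
  rewrite ?leq_maxl ?leq_maxr.
Qed.

Lemma mu12_nil r l s v : tens_eq (te_iter S r s) [::] -> (r <= l)%N ->
  mu12 (te_iter S l s) v = fun _ _ _ _ => 0.
Proof.
move=> r0 rl; do 4 apply/funext => ?; rewrite /mu12.
by rewrite (lin2_tens (lin2_mu12 _ _ _ _ _) (te_iter_leq rl r0)) big_nil.
Qed.

(** The bound in z_2 comes from b acting first on v, the bound in z_1 from the opposite ordering,
    which locality makes equal. *)
Lemma fin2_prod_series a b N p v : A a -> A b -> local_order S a b N ->
  fin2 (prod_series a b N p v).
Proof.
move=> Aa Ab loc; apply: fin2_iter; first exact: fin2_Dz1.
have [_ /(_ a b Aa Ab)[r _ r0] _] := localS.
have [r' r'0] := te_flip_nilpotent Aa Ab.
split.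
  have : bnd2 (exp_mu12 S [:: (a, b)] v) by apply: exp_mu12_bnd2 => l; apply: mu12_nil r0.
  by elim: N {loc} => //= N IHN /IHN; apply: bnd2_z12.
rewrite loc.
have : bnd2 (exp_mu12 S (flip_op (a, b)) v) by apply: exp_mu12_bnd2 => l; apply: mu12_nil r'0.
by elim: N {loc} => //= N IHN /IHN; apply: bnd2_swap_z12.
Qed.

Lemma diag12Z (c : K) (F : series2 V) : fin2 F ->
  diag12 (fun m1 j1 m2 j2 => c *: F m1 j1 m2 j2) = fun m j => c *: diag12 F m j.
Proof.
move=> fF; apply/funext => m; apply/funext => j.
rewrite !diag12E//; last exact: fin2_scale.
rewrite scaler_sumr; apply: eq_bigr => k _.
by rewrite -[RHS](zsum_linear (c \*: idfun) (fin2_evz m k (j - k)%N fF)).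
Qed.

Lemma iter_Dz1_z12 p (F : series2 V) :
  iter p.+1 Dz1 (z12_mul F) = fun m1 j1 m2 j2 => z12_mul (iter p.+1 Dz1 F) m1 j1 m2 j2
    + p.+1%:R *: iter p Dz1 F m1 j1 m2 j2.
Proof.
elim: p => [|p IHp]; first by rewrite /= Dz1_z12; do 4 apply/funext => ?; rewrite scale1r.
rewrite iterS IHp; apply/funext => m1; apply/funext => j1; apply/funext => m2; apply/funext => j2.
transitivity (Dz1 (z12_mul (iter p.+1 Dz1 F)) m1 j1 m2 j2 + p.+1%:R *: Dz1 (iter p Dz1 F) m1 j1 m2 j2).
  rewrite /Dz1 !scalerDr addrACA; congr (_ + _).
  by congr (_ + _); rewrite !scalerA mulrC.
rewrite Dz1_z12 -addrA; congr (_ + _).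
by rewrite -[X in X + _]scale1r -scalerDl nat1r.
Qed.

Lemma fin2_add (F G : series2 V) : fin2 F -> fin2 G ->
  fin2 (fun m1 j1 m2 j2 => F m1 j1 m2 j2 + G m1 j1 m2 j2).
Proof.
move=> [[M FM] [M' FM']] [[L GL] [L' GL']]; split.
  exists (Order.min M L) => m1 j1 m2 j2; rewrite lt_min => /andP[? ?].
  by rewrite FM// GL// addr0.
exists (Order.min M' L') => m1 j1 m2 j2; rewrite lt_min => /andP[h h'].
have := FM' m1 j1 m2 j2 h; have := GL' m1 j1 m2 j2 h'; rewrite /swap12 => -> ->.
by rewrite addr0.
Qed.

Lemma diag12D (F G : series2 V) m j : fin2 F -> fin2 G ->
  diag12 (fun m1 j1 m2 j2 => F m1 j1 m2 j2 + G m1 j1 m2 j2) m j = diag12 F m j + diag12 G m j.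
Proof.
move=> fF fG; rewrite !diag12E//; last exact: fin2_add.
rewrite -big_split; apply: eq_bigr => k _ /=.
by rewrite -(zsumD (fin2_evz m k (j - k)%N fF) (fin2_evz m k (j - k)%N fG)).
Qed.

Lemma local_order_leq a b N N' : (N <= N')%N -> local_order S a b N -> local_order S a b N'.
Proof. by move=> /subnK <- loc v; rewrite !iterD loc. Qed.

(** By the Leibniz rule D_1^(p+1) of z_12 F is z_12 D_1^(p+1) F + (p+1) D_1^p F. The first term
    vanishes on the diagonal, and the factor p + 1 passes from (p+1)! to p!. *)
Lemma nprod_coefS n a b N : A a -> A b -> local_order S a b N ->
  nprod_coef S N.+1 n a b = nprod_coef S N n a b.
Proof.
move=> Aa Ab loc; apply/funext => v; rewrite /nprod_coef.
have locS : local_order S a b N.+1 by move=> w; rewrite /= loc.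
have fin q := fin2_prod_series q v Aa Ab loc.
case E : (N%:Z - 1 - n) => [p|[|p]].
- rewrite (_ : N.+1%:Z - 1 - n = p.+1%:Z); last by lia.
  rewrite diag12Z; last exact: (fin2_prod_series p.+1 v Aa Ab locS).
  rewrite diag12Z; last exact: fin.
  apply/funext => m; apply/funext => j; rewrite iter_Dz1_z12 diag12D; first last.
  - exact: (fin2_scale _ (fin p)).
  - exact: (fin2_z12 (fin p.+1)).
  rewrite diag12_z12; last exact: (fin p.+1).
  rewrite add0r (diag12Z _ (fin p)) scalerA factS natrM invfM mulrAC mulVf ?mul1r//.
  by rewrite pnatr_eq0.
(* Boundary case: the exponent rises from -1 to 0, and the new value is the diagonal of a multiple
   of z_12, that is 0. *)
- rewrite (_ : N.+1%:Z - 1 - n = 0%:Z); last by lia.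
  rewrite diag12Z; last exact: (fin2_prod_series 0 v Aa Ab locS).
  apply/funext => m; apply/funext => j; rewrite [X in _ *: X]diag12_z12 ?scaler0//.
  exact: (fin 0%N).
- by rewrite (_ : N.+1%:Z - 1 - n = Negz p); last by lia.
Qed.

Lemma nprod_valE n a b N p v m j : A a -> A b -> local_order S a b N ->
  N%:Z - 1 - n = p%:Z ->
  nprod S n a b v m j = p`!%:R^-1 *: diag12 (prod_series a b N p v) m j.
Proof.
move=> Aa Ab loc E; rewrite /nprod; set N0 := xget _ _.
have loc0 : local_order S a b N0 by apply: (xgetPex 0%N); exists N.
(* The N chosen by [xget] and the given one are compared through their sum. *)
have add N' d : local_order S a b N' -> local_order S a b (N' + d)%N
    /\ nprod_coef S (N' + d) n a b = nprod_coef S N' n a b.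
  move=> loc'; elim: d => [|d [IHl IH]]; first by rewrite addn0.
  by rewrite addnS; split; [move=> w; rewrite /= IHl|rewrite nprod_coefS].
have -> : nprod_coef S N0 n a b = nprod_coef S N n a b.
  by rewrite -(add N0 N loc0).2 addnC (add N N0 loc).2.
have [_ /(_ a b Aa Ab)[r _ r0] _] := localS.
have [r' r'0] := te_flip_nilpotent Aa Ab.
rewrite insubdK; last exact/asboolP/(nprod_coef_LF n r0 r'0 loc).
rewrite /nprod_coef E.
exact: (congr1 (fun f => f m j) (diag12Z _ (fin2_prod_series p v Aa Ab loc))).
Qed.

Definition single : set expo := [set d | d = dir 1 2].

Lemma cone_single n g : cone single n g -> g = dir 1 2 *+ n.
Proof. by elim=> // {}n {}g d -> _ ->; rewrite mulrSr. Qed.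

Lemma bdd_pfun12 v x : bdd single (pfun 1 2 (fun=> idfun) (fun=> v) x).
Proof.
move=> e; have [M bM] := lfc_bound x.2 v.
exists (absz (e (zk 2) - M) + 1)%N => n g /cone_single -> nM.
rewrite /pfun [fld x.2 _ _ _]bM ?fld0//.
by rewrite expoD expoN expoMn /dir expoD expoN !deltaE /=; lia.
Qed.

Hypothesis A_cov : forall a, A a -> covariant T a.

Lemma DD_pfun12 v x : A2 A x ->
  DD 1 (pfun 1 2 (fun=> idfun) (fun=> v) x) + DD 2 (pfun 1 2 (fun=> idfun) (fun=> v) x)
  + pfun 1 2 (fun=> idfun) (fun=> T v) x = postcomp T (pfun 1 2 (fun=> idfun) (fun=> v) x).
Proof.
case: x => a b [/= Aa Ab]; apply/funext => e; rewrite !serD /postcomp /DD /pfun /fld /=.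
rewrite !expoD !deltaE !xpair_eqE !eqxx /= !addr0 ?add0r (A_cov Aa) (A_cov Ab).
set f1 := lfc a.
have lD1 u u' m l : f1 (u + u') m l = f1 u m l + f1 u' m l.
  by have := lfc_linear a m l 1 u u'; rewrite !scale1r.
have lZ1 c u m l : f1 (c *: u) m l = c *: f1 u m l.
  by have := lfc_linear a m l c u 0; rewrite lfc0 !addr0.
by rewrite !(lD1, lZ1) [LHS]addrC -[RHS]addrA; congr (_ + _); rewrite [LHS]addrC.
Qed.

Lemma DD_prod_series12 a b v l :
  A a -> A b ->
  let F u := iter l (pull (te_op S)) (pfun 1 2 (fun=> idfun) (fun=> u)) (a, b) in
  DD 1 (F v) + DD 2 (F v) + F (T v) = postcomp T (F v).
Proof.
move=> Aa Ab; have : A2 A (a, b) by [].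
elim: l (a, b) => [|l IHl] x Ax F; first exact: DD_pfun12.
rewrite /F /= /pull.
have DDsum k (s : seq (LF V * LF V)) (G : LF V * LF V -> expo -> V) :
    DD k (\sum_(y <- s) G y) = \sum_(y <- s) DD k (G y).
  apply: (big_morph _ (DDD k)); apply/funext => e.
  by rewrite /DD !scaler0 addr0.
have pcsum (s : seq (LF V * LF V)) (G : LF V * LF V -> expo -> V) :
    postcomp T (\sum_(y <- s) G y) = \sum_(y <- s) postcomp T (G y).
  apply: (big_morph (postcomp T)) => [G1 G2|]; apply/funext => e; rewrite /postcomp.
    by rewrite serD linearD.
  exact: linear0.
rewrite !DDsum pcsum -!big_split; apply: eq_big_seq => y yx /=.
exact/IHl/(stable_te A_ptwist braidS Ax).
Qed.

Definition pt (m1 : int) (j1 : nat) (m2 : int) (j2 : nat) : expo := fun k =>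
  if k == zk 1 then m1 else if k == lk 1 then j1%:Z else
  if k == zk 2 then m2 else if k == lk 2 then j2%:Z else 0.

Lemma pt_delta m1 j1 m2 j2 :
  [/\ pt m1 j1 m2 j2 + dz 1 = pt (m1 + 1) j1 m2 j2,
      pt m1 j1 m2 j2 + dl 1 = pt m1 j1.+1 m2 j2,
      pt m1 j1 m2 j2 + dz 2 = pt m1 j1 (m2 + 1) j2 &
      pt m1 j1 m2 j2 + dl 2 = pt m1 j1 m2 j2.+1].
Proof.
split; apply/funext => k; rewrite expoD deltaE /pt.
all: case k1: (k == zk 1); first by move/eqP: k1 => k1; subst k; rewrite /= ?addr0.
all: case k2: (k == lk 1); first by move/eqP: k2 => k2; subst k; rewrite /= ?addr0 -?PoszD ?addn1.
all: case k3: (k == zk 2); first by move/eqP: k3 => k3; subst k; rewrite /= ?addr0.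
all: case k4: (k == lk 2); first by move/eqP: k4 => k4; subst k; rewrite /= ?addr0 -?PoszD ?addn1.
all: by rewrite ?addr0.
Qed.

(** The vector may depend on other variables, so the formula serves both for a constant vector, in
    the covariance of products, and for Y(c, z_3)1. *)
Lemma prod_series_lift a b N p r (v : expo -> V) : indep 1 2 v ->
  tens_eq (te_iter S r [:: (a, b)]) [::] ->
  iter p (DD 1) (iter N (zz 1 2) (Ex 1 2 r (fun l =>
    iter l (pull (te_op S)) (pfun 1 2 (fun=> idfun) v) (a, b))))
  = lift2 1 2 (fun=> idfun) (fun e => prod_series a b N p (v e)).
Proof.
move=> iv r0; have lO (e : expo) : linear (@idfun V) by [].
have iO : indep 1 2 (fun=> @idfun V) by [].
have i12 : 1%N != 2%N by [].
rewrite [X in Ex 1 2 r X](_ : _ = fun l => \sum_(x <- te_iter S l [:: (a, b)]) pfun 1 2 (fun=> idfun) v x); last first.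
  by apply/funext => l; rewrite sum_te_iter big_seq1.
rewrite -(lift2_exp_mu12 i12 lO iO iv)//; last first.
  by move=> l w; apply: mu12_nil.
rewrite -(lift2_iter_zz _ i12 lO iO (indep_comp (exp_mu12 S [:: (a, b)]) iv)).
elim: p => //= p ->.
by rewrite -(lift2_Dz1 i12 lO iO (indep_comp (prod_series a b N p) iv)).
Qed.

Lemma prod_series_pt a b N p v r m1 j1 m2 j2 : tens_eq (te_iter S r [:: (a, b)]) [::] ->
  prod_series a b N p v m1 j1 m2 j2 =
  iter p (DD 1) (iter N (zz 1 2) (Ex 1 2 r (fun l =>
    iter l (pull (te_op S)) (pfun 1 2 (fun=> idfun) (fun=> v)) (a, b)))) (pt m1 j1 m2 j2).
Proof. by move=> r0; rewrite (prod_series_lift _ _ (_ : indep 1 2 (fun=> v))). Qed.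

(** D_1 + D_2 kills z_12 and vartheta_12 and commutes with D_1, while the braiding keeps the factors
    among covariant fields. So the relation for a(z_1)b(z_2)v passes to the whole series. *)
Lemma cov_prod_series a b N p v m1 j1 m2 j2 : A a -> A b ->
  T (prod_series a b N p v m1 j1 m2 j2) = prod_series a b N p (T v) m1 j1 m2 j2
  + (Dz1 (prod_series a b N p v) m1 j1 m2 j2 + Dz2 (prod_series a b N p v) m1 j1 m2 j2).
Proof.
move=> Aa Ab; have [_ /(_ a b Aa Ab)[r _ r0] _] := localS.
pose x u l := iter l (pull (te_op S)) (pfun 1 2 (fun=> idfun) (fun=> u)) (a, b).
pose L u := iter p (DD 1) (iter N (zz 1 2) (Ex 1 2 r (x u))).
have LE u n1 i1 n2 i2 : prod_series a b N p u n1 i1 n2 i2 = L u (pt n1 i1 n2 i2).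
  exact: prod_series_pt.
have bx u l : bdd single (x u l).
  by rewrite /x; elim: l (a, b) => [|l IHl] y; [exact: bdd_pfun12|by apply: bdd_sum => z; apply: IHl].
have d12 : single (dir 1 2) by [].
have covL : DD 1 (L v) + DD 2 (L v) + L (T v) = postcomp T (L v).
  rewrite /L.
  have E : DD 1 (Ex 1 2 r (x v)) + DD 2 (Ex 1 2 r (x v)) + Ex 1 2 r (x (T v)) = postcomp T (Ex 1 2 r (x v)).
    rewrite (DD2_Ex _ _ d12)// -(ExD _ d12)//; last by move=> l; apply: bddD; apply: bdd_DD.
    rewrite (Ex_comm _ (linear_on_postcomp single T) d12)//; last by move=> G bG; apply: postcomp_th d12 bG.
    by congr (Ex 1 2 r _); apply/funext => l; apply: DD_prod_series12.
  have Z n G G' : DD 1 G + DD 2 G + G' = postcomp T G ->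
     DD 1 (iter n (zz 1 2) G) + DD 2 (iter n (zz 1 2) G) + iter n (zz 1 2) G' = postcomp T (iter n (zz 1 2) G).
    move=> EG; elim: n => //= n IHn; rewrite postcomp_zz -IHn (zzD _ _ (_ + _)) (zzD _ _ (DD 1 _)).
    rewrite !DD_zz /= ?(subr0, sub0r) scale1r scaleN1r.
    by congr (_ + _); rewrite addrACA subrr addr0.
  have Dd n G G' : DD 1 G + DD 2 G + G' = postcomp T G ->
     DD 1 (iter n (DD 1) G) + DD 2 (iter n (DD 1) G) + iter n (DD 1) G' = postcomp T (iter n (DD 1) G).
    move=> EG; elim: n => //= n IHn; rewrite postcomp_DD -IHn (DDD _ (_ + _)) (DDD _ (DD 1 _)).
    by rewrite (DD_DD 2 1).
  exact/Dd/Z.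
rewrite !LE -[T _]/(postcomp T (L v) (pt m1 j1 m2 j2)) -covL !serD addrC; congr (_ + _).
have [p1 p2 p3 p4] := pt_delta m1 j1 m2 j2; have [_ p5 _ _] := pt_delta (m1 + 1) j1 m2 j2.
have [_ _ _ p6] := pt_delta m1 j1 (m2 + 1) j2.
rewrite /DD p1 p5 p3 p6 -!LE /Dz2 /swap12 /Dz1.
by rewrite [pt _ _ _ _ (zk 1)]/= [pt _ _ _ _ (lk 1)]/= [pt _ _ _ _ (zk 2)]/= [pt _ _ _ _ (lk 2)]/=
  -!PoszD !addn1 !pmulrn.
Qed.

(** Restricting the two-variable covariance relation to the diagonal turns D_1 + D_2 into D_z. *)
Lemma nprod_covariant n a b : A a -> A b -> LF_ad T (nprod S n a b) = Dz (nprod S n a b).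
Proof.
move=> Aa Ab; have [_ _ /(_ a b Aa Ab)[N0 loc0]] := localS.
pose N := (N0 + absz n + 1)%N; pose p := absz (N%:Z - 1 - n)%R.
have loc : local_order S a b N by apply: local_order_leq loc0; rewrite /N; lia.
have E : N%:Z - 1 - n = p%:Z by rewrite /p /N; lia.
have val v m j := nprod_valE v m j Aa Ab loc E.
have fin v := fin2_prod_series p v Aa Ab loc.
apply: LFext => v m j; rewrite -[LHS]/(T (nprod S n a b v m j) - nprod S n a b (T v) m j).
rewrite -[RHS]/((m + 1)%:~R *: nprod S n a b v (m + 1) j + j.+1%:R *: nprod S n a b v (m + 1) j.+1).
rewrite !val linearZ -scalerBr !scalerA ![_ * p`!%:R^-1]mulrC -!scalerA -scalerDr /=; congr (_ *: _).
rewrite -(diag12_Dz m j (fin v)).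
have f2 : fin2 (Dz2 (prod_series a b N p v)).
  by have [h1 h2] := fin v; have := fin2_Dz1 (conj h2 h1 : fin2 (swap12 _)); case.
rewrite -(diag12D _ _ (fin2_Dz1 (fin v)) f2).
apply/eqP; rewrite subr_eq addrC; apply/eqP.
have f3 : fin2 (fun m1 j1 m2 j2 => Dz1 (prod_series a b N p v) m1 j1 m2 j2 + Dz2 (prod_series a b N p v) m1 j1 m2 j2).
  exact: fin2_add (fin2_Dz1 (fin v)) f2.
rewrite -(diag12D _ _ (fin (T v)) f3) !diag12E//; last exact: fin2_add (fin (T v)) f3.
rewrite linear_sum; apply: eq_bigr => k _; rewrite -(zsum_linear T (fin2_evz m k (j - k)%N (fin v))).
by congr zsum; apply/funext => i; rewrite cov_prod_series.
Qed.

End ProductField.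

(** * The product identity *)

Section LogVertexAlgebra.
Context {K : numFieldType} {V : superspaceType K}.
Variable L : log_vertex_algebra V.
Local Notation Y := (lva_Y L).
Local Notation S := (lva_S L).
Local Notation T := (lva_T L).
Local Notation vac := (lva_vac L).
Local Notation A := (range (lva_Y L)).
Local Notation prod3 := (prod3 vac).
Local Notation s12 := (pull (op12 (te_op S))).
Local Notation flip12 := (pull (op12 (@flip_op K (LF V)))).
Local Notation braided := (@braided K V S).
Implicit Types (a b c u v w : V) (x y : LF V * LF V * LF V).

Lemma range_hcomp q (f : LF V) : A f -> A (hcomp q f).
Proof.
by move=> [u _ <-]; exists (hcomp q u) => //; rewrite (homog_map_even _ _ (lva_Y_even L)).
Qed.

Lemma range_ptwist q (f : LF V) : A f -> A (ptwist q f).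
Proof.
by move=> [u _ <-]; exists (ptwist q u) => //; rewrite (ptwist_even _ _ (lva_Y_even L)).
Qed.

Let braidS := lva_braiding L.
Let localS := lva_local L.

Lemma range_covariant (f : LF V) : A f -> covariant T f.
Proof. by move=> [u _ <-]; apply: covariantP; apply: lva_covariance. Qed.

Lemma range_creating (f : LF V) : A f -> creating vac f.
Proof.
move=> [u _ <-] m [l|l] // h; apply: lva_creation.
by case: h => [?|l0]; [left|right; case: l l0].
Qed.

Lemma range_one : A (LFone V).
Proof. by exists vac => //; apply: lva_Y_vac. Qed.

Lemma creation0 u : lfc (Y u) vac 0 0 = u.
Proof. exact: lva_creation0. Qed.

Lemma creation1 u : lfc (Y u) vac 1 0 = T u.
Proof.
have := range_covariant (imageT Y u) vac 0 0.
rewrite creation0 lva_T_vac lfc0 !add0r scale1r => ->.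
by rewrite (range_creating (imageT Y u) (l := 1)) ?scaler0 ?addr0//; right.
Qed.

Lemma lfc_one v m l : lfc (LFone V) v m l = if (m == 0) && (l == 0) then v else 0.
Proof. by case: l => l //=; rewrite ?andbF. Qed.

Lemma DDs_prod3A i j k x : perm_eq [:: i; j; k] [:: 1; 2; 3]%N -> A3 A x ->
  DDs (prod3 i j k x) = postcomp T (prod3 i j k x).
Proof.
move=> pm [A1 A2 A3]; apply: (DDs_prod3 pm (lva_T_vac L)); exact: range_covariant.
Qed.

(* The logarithm-free part of the skew product c(z)w. *)
Definition skew_val w c (m : int) : V :=
  \sum_(q <- [:: false; true]) lfc (Y (hcomp q c)) (ptwist q w) m 0.

Definition covS (G : expo -> V) := DDs G = postcomp T G.

Lemma covS0 : covS 0.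
Proof.
by rewrite /covS /DDs; apply/funext => e; rewrite /postcomp !serD /DD !scaler0 !addr0 linear0.
Qed.

Lemma covSD G H : covS G -> covS H -> covS (G + H).
Proof.
rewrite /covS /DDs !DDD => hG hH.
rewrite (addrACA (DD 1 G)) (addrACA (DD 1 G + DD 2 G)) hG hH.
by apply/funext => e; rewrite /postcomp !serD linearD.
Qed.

Lemma covS_ZE D N r (h : nat -> expo -> V) : D (dir 1 2) -> (forall l, bdd D (h l)) ->
  (forall l, covS (h l)) -> covS (ZE N 1 2 1 2 r h).
Proof.
move=> d12 bh ch; have cE : covS (Ex 1 2 r h).
  rewrite /covS (Ex_comm _ (linear_on_DDs D) d12 _ bh); last by move=> G bG; apply: (DDs_th12 d12 bG).
  rewrite (Ex_comm _ (linear_on_postcomp D T) d12 _ bh); last by move=> G bG; apply: (postcomp_th _ d12 bG).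
  by congr (Ex 1 2 r _); apply/funext => l; apply: ch.
rewrite /ZE; elim: N => // N IHN; rewrite iterS /covS DDs_zz12 IHN.
by rewrite postcomp_zz.
Qed.

Lemma covS_DD p G : covS G -> covS (iter p (DD 1) G).
Proof. by move=> cG; elim: p => //= p IHp; rewrite /covS DDs_DD IHp postcomp_DD. Qed.

Let stA : stable (A2 A) (A2 A) (te_op S) := stable_te range_ptwist braidS.

Lemma braided_prop (P : (expo -> V) -> Prop) (H : LF V * LF V * LF V -> expo -> V) i k l x :
  P 0 -> (forall G G', P G -> P G' -> P (G + G')) ->
  (forall y, A3 A y -> P (H y)) -> A3 A x -> P (braided H i k l x).
Proof.
move=> P0 PD PH; apply: (pull_ind P0 PD (stable12 stA)) => y.
apply: (pull_ind P0 PD (stable13 range_hcomp range_ptwist stA)) => z.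
exact: (pull_ind P0 PD (stable23 stA)).
Qed.

Lemma flip_prop (P : (expo -> V) -> Prop) (f : LF V * LF V * LF V -> seq (LF V * LF V * LF V))
    (H : LF V * LF V * LF V -> expo -> V) x :
  P 0 -> (forall G G', P G -> P G' -> P (G + G')) -> stable (A3 A) (A3 A) f ->
  (forall y, A3 A y -> P (H y)) -> A3 A x -> P (pull f H x).
Proof. by move=> P0 PD sf PH; apply: (pull_ind P0 PD sf PH 1). Qed.

Let st_flip : stable (A2 A) (A2 A) flip_op := stable_flip range_hcomp range_ptwist.

Lemma x312_prop (P : (expo -> V) -> Prop) x : P 0 -> (forall G G', P G -> P G' -> P (G + G')) ->
  (forall y, A3 A y -> P (prod3 3 1 2 y)) -> A3 A x -> P (x312 vac x).
Proof.
move=> P0 PD PH; apply: (flip_prop P0 PD (stable23 st_flip)) => y.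
exact: (flip_prop P0 PD (stable12 st_flip)).
Qed.

Lemma x321_prop (P : (expo -> V) -> Prop) i x : P 0 -> (forall G G', P G -> P G' -> P (G + G')) ->
  (forall y, A3 A y -> P (prod3 3 2 1 y)) -> A3 A x -> P (x321 vac S i x).
Proof.
move=> P0 PD PH; apply: (flip_prop P0 PD (stable23 st_flip)) => y.
apply: (flip_prop P0 PD (stable12 st_flip)) => z.
apply: (pull_ind P0 PD (stable23 stA)) => w.
exact: (flip_prop P0 PD (stable23 st_flip)).
Qed.

Lemma nonneg0 k : nonneg k (0 : expo -> V). Proof. by []. Qed.
Lemma zero_exp0 k : zero_exp k (0 : expo -> V). Proof. by []. Qed.

Lemma nonneg_iter_DD k p (G : expo -> V) : (k == zk 1 -> zero_exp (lk 1) G) ->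
  nonneg k G -> nonneg k (iter p (DD 1) G).
Proof.
move=> z g; elim: p => //= p IHp; apply: nonneg_DD => // /z z1.
by elim: (p) => //= n; apply: zero_exp_DD.
Qed.

Lemma zero_exp_iter_DD (k p : nat) (G : expo -> V) : zero_exp (lk k) G ->
  zero_exp (lk k) (iter p (DD 1) G).
Proof. by move=> z; elim: p => //= p; apply: zero_exp_DD. Qed.

Lemma nonneg_ZE k M p q (i j : nat) R (h : nat -> expo -> V) : k != zk i ->
  (forall l, nonneg k (h l)) -> nonneg k (ZE M p q i j R h).
Proof. by move=> ki nh; apply: nonneg_iter_zz; apply: nonneg_Ex. Qed.

Lemma zero_exp_ZE (k i j : nat) M p q R (h : nat -> expo -> V) : k != i ->
  (forall l, zero_exp (lk k) (h l)) -> zero_exp (lk k) (ZE M p q i j R h).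
Proof. by move=> ki nh; apply: zero_exp_iter_zz; apply: zero_exp_Ex. Qed.

Lemma skew_valZ k w c m : skew_val (k *: w) c m = k *: skew_val w c m.
Proof.
have h q u : lfc (Y (hcomp q u)) (ptwist q (k *: w)) m 0 = k *: lfc (Y (hcomp q u)) (ptwist q w) m 0.
  have := ptwist_linear q k w 0; rewrite addr0 => ->.
  have -> : ptwist q (0 : V) = 0 by rewrite /ptwist !linear0 addr0.
  have e : lfc (Y (hcomp q u)) (k *: ptwist q w + 0) m 0 = k *: lfc (Y (hcomp q u)) (ptwist q w) m 0
      + lfc (Y (hcomp q u)) 0 m 0 by exact: lfc_linear.
  by rewrite e lfc0 addr0.
by rewrite /skew_val !big_cons !big_nil !h scalerDr scalerDr scaler0.
Qed.

(** Setting z_2 = 0 turns Y(b, z_2)1 into b. What remains is c(z_3) on a coefficient of Y(a, z_1)b,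
    with the sign of moving c past both. *)
Lemma x312E a b c x (e : expo) : x = (Y a, Y b, Y c) -> e (zk 2) = 0 -> e (lk 2) = 0 ->
  e (lk 1) = 0 -> e (lk 3) = 0 ->
  x312 vac x e = skew_val (lfc (Y a) b (e (zk 1)) 0) c (e (zk 3)).
Proof.
move=> -> e2 l2 l1 l3; rewrite /x312 pull_flip12_23; last exact: lin3_prod3.
rewrite /skew_val !big_cons !big_nil !serD /prod3 /fld /= e2 l2 l1 l3.
rewrite !(homog_map_even _ _ (lva_Y_even L)) !(ptwist_even _ _ (lva_Y_even L)) !creation0.
by rewrite -!(ptwist_even _ _ (lva_Y_even L)) -!ptwist_lfc.
Qed.

(** d = 0 treats Y(u) and d = 1 treats D_z Y(u). The identity field is placed at z_2 so that the
    three-variable criterion applies to two fields. *)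
Lemma skew_pair u c d :
  skew_system T (fun m => iter d (DD 1) (prod3 1 3 2 (Y u, Y c, LFone V)) (ex3 m 0 0))
         (fun m => d`!%:R *: skew_val (lfc (Y u) vac d%:Z 0) c m).
Proof.
pose x := (Y u, Y c, LFone V).
have Ax : A3 A x by split; [exact: imageT|exact: imageT|exact: range_one].
(* Operators on the first two factors leave the identity field in the third, which makes z_2
   inert. *)
pose Q y := A3 A y /\ y.2 = LFone V.
have stQ f : stable (A2 A) (A2 A) f -> stable Q Q (op12 f).
  move=> sf y [Ay y2] z zf; split; first exact: (stable12 sf Ay zf).
  by move: zf => /mapP[w _ ->].
have Qx : Q x by split.
have [r nil] := braided_nilpotent range_hcomp range_ptwist braidS localS Ax.
pose h k := iter k s12 (prod3 1 3 2) x.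
pose h' k := iter k s12 (flip12 (prod3 3 1 2)) x.
have d13 : dirs 1 3 2 (dir 1 3) by left.
have d31 : dirs 3 1 2 (dir 3 1) by left.
have d32 : dirs 3 1 2 (dir 3 2) by right; left.
have l1 := lin3_prod3 vac 1 3 2.
have l2 := lin3_flip12 (lin3_prod3 vac 3 1 2).
have bh k : bdd (dirs 1 3 2) (h k) by apply: bdd_iter_pull => y; apply: bdd_prod3.
have bh' k : bdd (dirs 3 1 2) (h' k).
  by apply: bdd_iter_pull => y; apply: bdd_pull => z; apply: bdd_prod3.
have h0 k : (r <= k)%N -> h k = 0 /\ h' k = 0.
  by move=> rk; split; [apply: (nil _ k 0 0 l1)%N|apply: (nil _ k 0 0 l2)%N]; rewrite rk.
have E (s : nat) : Eqv 1 3 (fun k => h (s + k)%N) (fun k => h' (s + k)%N).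
  rewrite /h /h'; under [X in Eqv _ _ X]funext => k do rewrite iterD.
  under [X in Eqv _ _ _ X]funext => k do rewrite iterD.
  apply: (Eqv_pull _ d13 d31) Ax => [k y|k y||y Ay].
  - by apply: bdd_iter_pull => z; apply: bdd_prod3.
  - by apply: bdd_iter_pull => z; apply: bdd_pull => w; apply: bdd_prod3.
  - exact: stable12 stA.
  - exact: (local_outer _ range_ptwist braidS localS).
(* Shifts s >= r give zero families, so uniformity over s < r suffices. *)
have [M [R MR]] := Eqv_uniform (fun s : 'I_r => E s).
pose r1 := (r + R)%N.
have loc : Loc 1 3 r1.+1 M h h'.
  move=> s; have [rs|sr] := leqP r s; last first.
    by apply: (MR M r1.+1 _ _ (Ordinal sr)); rewrite // /r1; lia.
  have e1 : (fun k => h (s + k)%N) = fun=> 0.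
    by apply/funext => k; have [] := h0 (s + k)%N (leq_trans rs (leq_addr _ _)).
  have e2 : (fun k => h' (s + k)%N) = fun=> 0.
    by apply/funext => k; have [] := h0 (s + k)%N (leq_trans rs (leq_addr _ _)).
  by rewrite e1 e2 !Ex0.
have bhd n k : bdd (dirs 1 3 2) (iter n (DD 1) (h k)) by apply: bdd_iter_DD.
have bhd' n k : bdd (dirs 3 1 2) (iter n (DD 1) (h' k)) by apply: bdd_iter_DD.
have hd0 n k : (r1.+1 <= k)%N -> iter n (DD 1) (h k) = 0 /\ iter n (DD 1) (h' k) = 0.
  move=> rk; have [|-> ->] := h0 k; first by move: rk; rewrite /r1; lia.
  have -> : iter n (DD 1) (0 : expo -> V) = 0; last by [].
  by elim: n => //= n ->; apply/funext => e; rewrite /DD !scaler0 addr0.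
have locd n : Loc 1 3 r1.+1 (M + n) (fun k => iter n (DD 1) (h k)) (fun k => iter n (DD 1) (h' k)).
  elim: n => [|n IHn]; first by rewrite addn0.
  by rewrite addnS; apply: (Loc_DD _ d13 d31 (bhd n) (bhd' n)) IHn => // k /(hd0 n)[].
have one_creating := range_creating range_one.
have prop (P : (expo -> V) -> Prop) : P 0 -> (forall G G', P G -> P G' -> P (G + G')) ->
    (forall y, Q y -> P (prod3 1 3 2 y)) -> forall k, P (h k).
  by move=> P0 PD PH k; apply: (pull_ind P0 PD (stQ _ stA) PH).
have prop' (P : (expo -> V) -> Prop) : P 0 -> (forall G G', P G -> P G' -> P (G + G')) ->
    (forall y, Q y -> P (prod3 3 1 2 y)) -> forall k, P (h' k).
  move=> P0 PD PH k; apply: (pull_ind P0 PD (stQ _ stA)) Qx => y.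
  exact: (pull_ind P0 PD (stQ _ st_flip) PH 1).
have at0 i j y e : Q y -> prod3 i j 2 y e =
    if (e (zk 2) == 0) && (e (lk 2) == 0) then fld y.1.1 i e (fld y.1.2 j e vac) else 0.
  move=> [_ y2]; rewrite prod3E y2 {3}/fld lfc_one.
  by case: ifP => // _; rewrite !fld0.
have locE := locd d 0%N.
(* With r' = 0 and R2 = 0 the exchange of z_2 and z_3 is trivial, by [Ex1]. *)
apply: (@skew_of_locality _ _ T _ (fun k _ => iter d (DD 1) (h k)) (fun k _ => iter d (DD 1) (h' k))
  r1 0 (M + d) 0 _ _ d31 d32) => [k l|||||m|m].
- exact: bhd'.
- under [X in Ex 1 3 _ X]funext => k do rewrite /= Ex1.
  by under [X in Ex 3 1 _ X]funext => k do rewrite /= Ex1.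
- move=> k _; split.
  + apply: nonneg_iter_DD => //; apply: prop => // [G G'|y Qy e e3]; first exact: nonnegD.
    rewrite at0//; case: ifP => // _; have [[_ Ay _] _] := Qy.
    by rewrite [fld y.1.2 _ _ _](range_creating Ay) ?fld0//; left.
  + apply: zero_exp_iter_DD; apply: prop => // [G G'|y Qy e e3]; first exact: zero_expD.
    rewrite at0//; case: ifP => // _; have [[_ Ay _] _] := Qy.
    by rewrite [fld y.1.2 _ _ _](range_creating Ay) ?fld0//; right.
  + apply: nonneg_iter_DD => //; apply: prop => // [G G'|y _]; first exact: nonnegD.
    exact: nonneg_lk_prod3.
  + apply: nonneg_iter_DD => //; apply: prop => // [G G'|y _]; first exact: nonnegD.
    exact: nonneg_lk_prod3.
- have n1 k : zero_exp (lk 1) (h' k).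
    apply: prop' => // [G G'|y Qy e e3]; first exact: zero_expD.
    rewrite at0//; case: ifP => // _; have [[_ Ay _] _] := Qy.
    by rewrite [fld y.1.2 _ _ _](range_creating Ay) ?fld0//; right.
  move=> k _; split.
  + apply: nonneg_iter_DD => //; apply: prop' => // [G G'|y Qy e e3]; first exact: nonnegD.
    rewrite at0//; case: ifP => // _; have [[_ Ay _] _] := Qy.
    by rewrite [fld y.1.2 _ _ _](range_creating Ay) ?fld0//; left.
  + apply: nonneg_iter_DD => //; apply: prop' => // [G G'|y Qy]; first exact: nonnegD.
    by apply: nonneg_prod3; rewrite Qy.2.
  + exact: zero_exp_iter_DD.
  + apply: zero_exp_iter_DD; apply: prop' => // [G G'|y Qy]; first exact: zero_expD.
    by apply: zero_exp_prod3; rewrite Qy.2.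
  + apply: nonneg_iter_DD => //; apply: prop' => // [G G'|y _]; first exact: nonnegD.
    exact: nonneg_lk_prod3.
- move=> k _; apply: covS_DD; apply: prop' => [|G G'|y [Ay _]]; [exact: covS0|exact: covSD|].
  exact: DDs_prod3A.
(* Only z_2^0 occurs, so the diagonal sum has the single term i = m. *)
- have s2 : zero_exp (zk 2) (h 0%N).
    by move=> e e2; rewrite /h /= at0// (negbTE e2).
  have s2d : zero_exp (zk 2) (iter d (DD 1) (h 0%N)).
    elim: (d) => //= n IHn e e2; rewrite /DD !IHn ?scaler0 ?addr0//;
      by rewrite !expoD !deltaE /= ?addr0.
  rewrite (@zsumE _ m 1) ?big_ord1 ?addr0 ?subrr// => i im.
  by apply: s2d; rewrite /ex3 /=; lia.
- have n1 : zero_exp (lk 1) (h' 0%N).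
    apply: prop' => // [G G'|y Qy e e3]; first exact: zero_expD.
    rewrite at0//; case: ifP => // _; have [[_ Ay _] _] := Qy.
    by rewrite [fld y.1.2 _ _ _](range_creating Ay) ?fld0//; right.
  have := iter_DD1 d 0 0 m n1; rewrite scale1r add0n => ->.
  congr (_ *: _); rewrite -[h' 0%N]/(flip12 (prod3 3 1 2) x) pull12E /pull /flip_op big_map.
  rewrite (_ : (\sum_(q <- _) _) (ex3 d%:Z 0 m) = \sum_(q <- [:: false; true])
      prod3 3 1 2 (hcomp q (Y c), ptwist q (Y u), LFone V) (ex3 d%:Z 0 m)); last first.
    by rewrite !big_cons !big_nil !serD.
  apply: eq_bigr => q _.
  have vacq : ptwist q vac = vac.
    by have := lva_vac_even L; rewrite /homog => <-; rewrite ptwist_hcomp scale1r.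
  rewrite ptwist_lfc vacq -(homog_map_even q c (lva_Y_even L)) prod3E.
  set e := ex3 _ _ _; have [e1 e2 e3] : [/\ e (zk 1) = d%:Z, e (zk 2) = 0 & e (zk 3) = m] by [].
  have [l1' l2' l3'] : [/\ e (lk 1) = 0, e (lk 2) = 0 & e (lk 3) = 0] by [].
  by rewrite /fld e1 e2 e3 l1' l2' l3' lfc_one eqxx.
Qed.

(** The factor p! clears the divided power in the product. Here p = N - 1 - n for a sufficiently
    large N; its value is irrelevant afterwards because p! is invertible. *)
Lemma skew_product a b c n : exists p : nat,
  skew_system T (fun m => p`!%:R *: nprod S n (Y a) (Y b) c m 0%N)
         (skew_val (p`!%:R *: mode (Y a) n b) c).
Proof.
pose x := (Y a, Y b, Y c).
have Ax : A3 A x by split; exact: imageT.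
have Aa : A (Y a) by exact: imageT.
have Ab : A (Y b) by exact: imageT.
have [_ /(_ _ _ Aa Ab)[r0 _ nil] /(_ _ _ Aa Ab)[N1 loc1]] := localS.
have [r [N0 [r0r dongx]]] := dong vac range_hcomp range_ptwist braidS localS r0 Ax.
(* Large enough for Dong's lemma and for the locality of a and b, with |n| + 1 added to make N - 1 -
   n nonnegative. *)
pose N := (N0 + N1 + absz n + 1)%N; pose p := absz (N%:Z - 1 - n)%R.
have E : N%:Z - 1 - n = p%:Z by rewrite /p /N; lia.
have loc : local_order S (Y a) (Y b) N by apply: local_order_leq loc1; rewrite /N; lia.
have nilr : tens_eq (te_iter S r.+1 [:: (Y a, Y b)]) [::] by apply: te_iter_leq nil; apply: leqW.
exists p; have [|B12 dongp] := dongx N; first by rewrite /N; lia.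
have [R1 [R2 dongE]] := dongp p.
pose B H k l := ZE N 1 2 1 2 r.+1 (fun i => braided H i k l x).
have b1 i k l : bdd (dirs 1 2 3) (braided (x123 vac) i k l x) by apply: bdd_braided => ?; apply: bdd_x123.
have b3 i k l : bdd (dirs 3 1 2) (braided (x312 vac) i k l x) by apply: bdd_braided => ?; apply: bdd_x312.
have d31 : dirs 3 1 2 (dir 3 1) by left.
have d32 : dirs 3 1 2 (dir 3 2) by right; left.
have d12 : dirs 3 1 2 (dir 1 2) by right; right.
have z2 i k l : nonneg (zk 2) (braided (x312 vac) i k l x).
  apply: braided_prop Ax => // [G G'|y]; first exact: nonnegD.
  apply: x312_prop => // [G G'|z [_ _ Az]]; first exact: nonnegD.
  exact/nonneg_prod3/range_creating.
have zl2 i k l : zero_exp (lk 2) (braided (x312 vac) i k l x).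
  apply: braided_prop Ax => // [G G'|y]; first exact: zero_expD.
  apply: x312_prop => // [G G'|z [_ _ Az]]; first exact: zero_expD.
  exact/zero_exp_prod3/range_creating.
have nl i k l q : q \in [:: 3; 1; 2]%N -> nonneg (lk q) (braided (x312 vac) i k l x).
  move=> qin; apply: braided_prop Ax => // [G G'|y]; first exact: nonnegD.
  apply: x312_prop => // [G G'|z _]; first exact: nonnegD.
  exact: nonneg_lk_prod3.
(* In [x312] the field a does not act on the vacuum directly. Exchanging it with b by the first half
   of [dong] brings it there, which excludes negative powers of z_1. *)
have zB1 k l : nonneg (zk 1) (B (x312 vac) k l).
  rewrite /B B12; apply: nonneg_ZE => // i; apply: (pull_ind (@nonneg0 _) (@nonnegD _ _ _) (stable13 range_hcomp range_ptwist stA)) Ax => y.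
  apply: (pull_ind (@nonneg0 _) (@nonnegD _ _ _) (stable23 stA)) => z.
  apply: x321_prop => // [G G'|w [_ _ Aw]]; first exact: nonnegD.
  exact/nonneg_prod3/range_creating.
have zlB1 k l : zero_exp (lk 1) (B (x312 vac) k l).
  rewrite /B B12; apply: zero_exp_ZE => // i; apply: (pull_ind (@zero_exp0 _) (@zero_expD _ _ _) (stable13 range_hcomp range_ptwist stA)) Ax => y.
  apply: (pull_ind (@zero_exp0 _) (@zero_expD _ _ _) (stable23 stA)) => z.
  apply: x321_prop => // [G G'|w [_ _ Aw]]; first exact: zero_expD.
  exact/zero_exp_prod3/range_creating.
apply: (skew_of_locality d31 d32 _ dongE) => [k l|k l|k l|k l|m|m].
- by apply: bdd_iter_DD; apply: bdd_ZE.
- split.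
  + apply: nonneg_iter_DD => //; apply: nonneg_ZE => // i.
    apply: braided_prop Ax => // [G G'|y [_ _ Ay]]; first exact: nonnegD.
    exact/nonneg_prod3/range_creating.
  + apply: zero_exp_iter_DD; apply: zero_exp_ZE => // i.
    apply: braided_prop Ax => // [G G'|y [_ _ Ay]]; first exact: zero_expD.
    exact/zero_exp_prod3/range_creating.
  + apply: nonneg_iter_DD => //; apply: nonneg_ZE => // i.
    apply: braided_prop Ax => // [G G'|y _]; first exact: nonnegD.
    exact: nonneg_lk_prod3.
  + apply: nonneg_iter_DD => //; apply: nonneg_ZE => // i.
    apply: braided_prop Ax => // [G G'|y _]; first exact: nonnegD.
    exact: nonneg_lk_prod3.
- split.
  + by apply: nonneg_iter_DD; [move=> _; apply: zlB1|apply: zB1].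
  + by apply: nonneg_iter_DD; [|apply: nonneg_ZE => // i; apply: z2].
  + by apply: zero_exp_iter_DD; apply: zlB1.
  + by apply: zero_exp_iter_DD; apply: zero_exp_ZE => // i; apply: zl2.
  + by apply: nonneg_iter_DD; [|apply: nonneg_ZE => // i; apply: nl].
- apply: covS_DD; apply: (covS_ZE _ _ d12) => // i.
  apply: braided_prop Ax => // [|G G'|y]; [exact: covS0|exact: covSD|].
  apply: x312_prop => [|G G'|z Az]; [exact: covS0|exact: covSD|].
  exact: DDs_prod3A.
(* At z_3 = 0 the field Y(c, z_3) creates c, so the diagonal sum in [s] is the one defining the
   product on c at zeta = 0. *)
- rewrite (nprod_valE range_hcomp range_ptwist localS c m 0 Aa Ab loc E) scalerA divff ?scale1r ?pnatr_eq0 -?lt0n ?fact_gt0//.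
  rewrite /diag12 /zsum; apply: eq_fsbigr => i _; rewrite big_ord1 subn0.
  have iv : indep 1 2 (fun e => fld (Y c) 3 e vac).
    by move=> e g g0; rewrite (indep_fld (i := 1%N) (j := 2%N)).
  transitivity (lift2 1 2 (fun=> idfun) (fun e => prod_series S (Y a) (Y b) N p (fld (Y c) 3 e vac)) (ex3 i (m - i) 0)).
    have vc : fld (Y c) 3 (ex3 i (m - i) 0) vac = c by exact: creation0.
    by rewrite /lift2 vc.
  rewrite -(prod_series_lift N p iv nilr).
  congr (iter p _ (iter N _ (Ex 1 2 _ _)) _); apply/funext => l.
  by rewrite [RHS]iter_pull12.
(* At z_1 = 0 the derivative D_1^p leaves p! times the coefficient of z_1^p, and at z_2 = 0 the
   factor z_12^N is z_1^N. The exponent p - N = -n - 1 is that of the mode. *)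
- have := iter_DD1 p 0 0 m (zlB1 0%N 0%N); rewrite scale1r add0n => ->.
  rewrite skew_valZ; congr (_ *: _); rewrite /B /ZE zz_low_r//; last by apply: nonneg_Ex.
  have [dd1 _ _] := dz_ex3; rewrite dd1 ex3Mn ex3N ex3D !mul0rn !oppr0 !addr0.
  rewrite Ex_low//; last by move=> i; apply: nl.
  rewrite -[braided _ 0 0 0 x]/(x312 vac x) (x312E (erefl x))//.
  rewrite -[mode _ _ _]/(lfc (Y a) b (- n - 1) 0).
  by congr (skew_val (lfc (Y a) b _ 0) c _); rewrite /ex3 /=; lia.
Qed.

(* Covariance recovers the coefficients of zeta^(j+1) from those of zeta^j. *)
Lemma covariant_unique (f g : LF V) : LF_ad T f = Dz f -> LF_ad T g = Dz g ->
  (forall c m, f c m 0%N = g c m 0%N) -> f = g.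
Proof.
move=> cf cg fg0; apply: LFext => c m j; elim: j c m => [|j IHj] c m; first exact: fg0.
have rec (h : LF V) : LF_ad T h = Dz h ->
    j.+1%:R *: h c m j.+1 = T (h c (m - 1) j) - h (T c) (m - 1) j - m%:~R *: h c m j.
  move/(congr1 (fun h : LF V => h c (m - 1) j)).
  rewrite -[LHS]/(T (h c (m - 1) j) - h (T c) (m - 1) j) => ->.
  rewrite -[Dz h c _ _]/((m - 1 + 1)%:~R *: h c (m - 1 + 1) j + j.+1%:R *: h c (m - 1 + 1) j.+1).
  by rewrite subrK addrC addKr.
have := rec f cf; rewrite !IHj -(rec g cg) => /(congr1 (GRing.scale j.+1%:R^-1)).
by rewrite !scalerA mulVf ?pnatr_eq0// !scale1r.
Qed.

Lemma prod3_one u c (e : expo) : e (zk 2) = 0 -> e (lk 2) = 0 -> e (zk 3) = 0 ->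
  e (lk 3) = 0 -> prod3 1 3 2 (Y u, Y c, LFone V) e = lfc (Y u) c (e (zk 1)) (e (lk 1)).
Proof.
move=> e1 e2 e3 e4; rewrite prod3E /fld e1 e2 e3 e4 lfc_one eqxx.
by rewrite -[X in lfc _ X _ _ = _]/(lfc (Y c) vac 0 0) creation0.
Qed.

Lemma skew_Y u c : skew_system T (fun m => Y u c m 0%N) (skew_val u c).
Proof.
have := skew_pair u c 0; congr skew_system; apply/funext => m.
  exact: prod3_one.
by rewrite creation0 scale1r.
Qed.

(** D_z Y(u, z)1 at z = 0 is the coefficient of z in Y(u, z)1, which is Tu by [creation1]. *)
Lemma skew_Dz u c : skew_system T (fun m => Dz (Y u) c m 0%N) (skew_val (T u) c).
Proof.
have := skew_pair u c 1; congr skew_system; apply/funext => m; last first.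
  by rewrite creation1 scale1r.
rewrite [iter _ _ _]/(DD 1 _) /DD !prod3_one//.
rewrite -[RHS]/((m + 1)%:~R *: lfc (Y u) c (m + 1) 0 + 1%:R *: lfc (Y u) c (m + 1) 1).
set e := ex3 m 0 0 + dz 1; set e' := e + dl 1.
have [e1 e2 e3 e4] : [/\ e (zk 1) = m + 1, e (lk 1) = 0, e' (zk 1) = m + 1 & e' (lk 1) = 1].
  by rewrite /e' /e !expoD !deltaE /= /ex3 /= ?addr0 ?add0r.
by rewrite e1 e2 e3 e4 add0r.
Qed.

Lemma LF_ad_Dz (f : LF V) : LF_ad T f = Dz f -> LF_ad T (Dz f) = Dz (Dz f).
Proof.
move=> cf; rewrite -{2}cf; apply: LFext => v m j.
rewrite -[LHS]/(T ((m + 1)%:~R *: f v (m + 1) j + j.+1%:R *: f v (m + 1) j.+1)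
  - ((m + 1)%:~R *: f (T v) (m + 1) j + j.+1%:R *: f (T v) (m + 1) j.+1)).
rewrite -[RHS]/((m + 1)%:~R *: (T (f v (m + 1) j) - f (T v) (m + 1) j)
  + j.+1%:R *: (T (f v (m + 1) j.+1) - f (T v) (m + 1) j.+1)).
by rewrite linearD !linearZ /= !scalerBr opprD addrACA.
Qed.

Lemma Y_T u : Y (T u) = Dz (Y u).
Proof.
have cY w := lva_covariance L w.
apply: covariant_unique => // [|c m]; first exact: LF_ad_Dz.
exact: (congr1 (@^~ m) (skew_unique (skew_Y (T u) c) (skew_Dz u c))).
Qed.

Lemma nprod_Y a b n : nprod S n (Y a) (Y b) = Y (mode (Y a) n b).
Proof.
apply: covariant_unique => [||c m].
- apply: (nprod_covariant range_hcomp range_ptwist braidS localS) => //.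
  exact: range_covariant.
- exact: lva_covariance.
have [p sk] := skew_product a b c n.
have := congr1 (@^~ m) (skew_unique sk (skew_Y (p`!%:R *: mode (Y a) n b) c)).
have -> : Y (p`!%:R *: mode (Y a) n b) c m 0%N = p`!%:R *: Y (mode (Y a) n b) c m 0%N.
  by rewrite linearZ.
move/(congr1 (GRing.scale (p`!%:R^-1 : K))); rewrite !scalerA mulVf ?scale1r//.
by rewrite pnatr_eq0 -lt0n fact_gt0.
Qed.

End LogVertexAlgebra.

Theorem proposition3p5 (R : realType) (V : superspaceType R[i])
    (A : log_vertex_algebra V) (a b : V) :
  (forall n : int,
     nprod (lva_S A) n (lva_Y A a) (lva_Y A b)
     = lva_Y A (mode (lva_Y A a) n b)) /\
  lva_Y A (lva_T A a) = Dz (lva_Y A a).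
Proof. by split=> [n|]; [apply: nprod_Y|rewrite Y_T]. Qed.
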